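(* Let $X$ be a symmetrically self-similar graph with bounded geometry and let $d$ be its transition function. Then the Julia set of $d$ is either a real interval in $\overline{\mathbb{C}}$ (i.e. a connected subset of $\overline{\mathbb{R}}$) or a Cantor set.
   Context: Graphs are connected, locally finite, infinite, undirected, without loops or multiple edges. For $C\subseteq VX$, $\theta C$ is the set of vertices of $VX\setminus C$ adjacent to a vertex of $C$, $\overline C=C\cup\theta C$. For $F\subseteq VX$, $\mathcal{C}_X(F)$ is the set of connected components (as vertex sets) of the subgraph induced on $VX\setminus F$. The reduced graph $X_F$ has vertex set $F$, distinct $x,y$ adjacent iff $x,y\in\theta C$ for some $C\in\mathcal{C}_X(F)$. $X$ is self-similar with respect to $F$ if (F1) no two vertices of $F$ are adjacent in $X$, (F2) distinct $C,D\in\mathcal{C}_X(F)$ satisfy $|\overline C\cap\overline D|\le1$, (F3) there is a graph isomorphism $X\to X_F$. Cells are the elements of $\mathcal{C}_X(F)$; $\hat C$ is the subgraph induced on $\overline C$. Symmetrically self-similar: additionally (S1) all cells finite and any two $\hat C,\hat D$ are isomorphic via an isomorphism mapping $\theta C$ to $\theta D$, and (S3) automorphisms of $\hat C$ preserving $\theta C$ act doubly transitively on $\theta C$. $\theta_X=|\theta C|$. Bounded geometry: vertex degrees bounded, cells finite, boundary sizes of cells bounded. For $B\subseteq\theta C$, $Q_B$ has entries $1/\deg_{\hat C}x$ for $x\sim y$, $x\notin B$, else 0, and $Q^*_B(z)=(I-zQ_B)^{-1}$. The transition function is the rational function $d(z)=(\theta_X-1)(Q^*_{\theta C\setminus\{v\}}(z))_{v,w}$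 for distinct $v,w\in\theta C$ (independent of choices). *)

(* Defs.v *)
From mathcomp Require Import all_boot all_order all_algebra.
From mathcomp Require Import fraction generic_quotient finmap complex.
From mathcomp Require Import all_classical all_reals all_analysis.

Set Implicit Arguments.
Unset Strict Implicit.
Unset Printing Implicit Defensive.

Import Order.TTheory GRing.Theory Num.Theory.
Import numFieldNormedType.Exports.

Local Open Scope classical_set_scope.
Local Open Scope card_scope.
Local Open Scope ring_scope.

Section Graphs.
Context {V : choiceType}.
Implicit Types (adj : rel V) (F C D : set V).

Definition infinite_graph adj : Prop :=
  [/\ irreflexive adj,
      symmetric adj,
      (forall x, finite_set [set y | adj x y]),
      infinite_set [set: V] &
      (forall x y, exists2 p : seq V, path adj x p & last x p = y)].

(* theta C *)
Definition vboundary adj C : set V :=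
  [set y | ~ C y /\ exists2 x, C x & adj x y].

(* \overline C *)
Definition vclosure adj C : set V := C `|` vboundary adj C.

Definition connected_off adj F (x y : V) : Prop :=
  exists p : seq V,
    [/\ path adj x p, last x p = y & all (fun z => z \notin F) (x :: p)].

Definition cells adj F : set (set V) :=
  [set C | exists2 x, ~ F x & C = [set y | connected_off adj F x y]].

(* Adjacency of the reduced graph X_F, whose vertex set is F. *)
Definition reduced_adj adj F (x y : V) : Prop :=
  x <> y /\
  exists C, [/\ cells adj F C, vboundary adj C x & vboundary adj C y].

Definition self_similar adj F : Prop :=
  [/\ (forall x y, F x -> F y -> ~~ adj x y),
      (forall C D, cells adj F C -> cells adj F D -> C <> D ->
         is_subset1 (vclosure adj C `&` vclosure adj D)) &
      (exists f : V -> V, set_bij [set: V] F f /\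
         forall x y, adj x y <-> reduced_adj adj F (f x) (f y))].

(* f restricts to a graph isomorphism from \hat C onto \hat D that maps
   theta C onto theta D; the values of f outside \overline C are irrelevant. *)
Definition cell_iso adj C D (f : V -> V) : Prop :=
  [/\ set_bij (vclosure adj C) (vclosure adj D) f,
      (forall x y, vclosure adj C x -> vclosure adj C y ->
         adj (f x) (f y) = adj x y) &
      f @` vboundary adj C = vboundary adj D].

Definition symmetrically_self_similar adj F : Prop :=
  [/\ self_similar adj F,
      (forall C, cells adj F C -> finite_set C),
      (forall C D, cells adj F C -> cells adj F D ->
         exists f, cell_iso adj C D f) &
      (forall C, cells adj F C -> forall x1 x2 y1 y2,
         vboundary adj C x1 -> vboundary adj C x2 -> x1 <> x2 ->
         vboundary adj C y1 -> vboundary adj C y2 -> y1 <> y2 ->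
         exists f, [/\ cell_iso adj C C f, f x1 = y1 & f x2 = y2])].

Definition bounded_geometry adj F : Prop :=
  [/\ (exists M : nat, forall x, [set y | adj x y] #<= `I_M),
      (forall C, cells adj F C -> finite_set C) &
      (exists M : nat, forall C, cells adj F C ->
         vboundary adj C #<= `I_M)].

End Graphs.

Section Transition.
Context {V : choiceType} (K : fieldType).
Implicit Types (adj : rel V) (B C : set V).

(* The vertex set of \hat C, as a finite type; [fset_set] is only meaningful
   on finite sets, and \overline C is finite when C is a finite cell of a
   locally finite graph. *)
Definition cell_vertices adj C : {fset V} := fset_set (vclosure adj C).

Definition cell_degree adj C (x : V) : nat :=
  #|` [fset y in cell_vertices adj C | adj x y]%fset|.

(* Rows and columns are indexed by \overline C through [enum_rank]. *)
Definition cell_mx adj C B : 'M[{fraction {poly K}}]_#|{: cell_vertices adj C}| :=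
  \matrix_(i, j)
    let x := val (enum_val i) in let y := val (enum_val j) in
    if adj x y && (x \notin B) then (cell_degree adj C x)%:R^-1 else 0.

(* Q^*_B(z) = (I - z Q_B)^{-1}, computed over the field K(z). *)
Definition cell_resolvent adj C B
    (x y : cell_vertices adj C) : {fraction {poly K}} :=
  invmx (1%:M - tofrac 'X *: cell_mx adj C B) (enum_rank x) (enum_rank y).

Definition transition_function adj C
    (v w : cell_vertices adj C) : {fraction {poly K}} :=
  (#|` fset_set (vboundary adj C)|%:R - 1) *
  cell_resolvent (vboundary adj C `\ val v) v w.

End Transition.

(* R[i]^o carries the topology of the modulus on R[i]. *)
Notation sphere R := (one_point_compactification R[i]^o).

Section Julia.
Context {R : realType}.
Local Notation sphere := (sphere R).

(* d is written as p/q in lowest terms; a finite value at infinity is the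
   ratio of the coefficients of degree deg q, which is 0 if deg p < deg q. *)
Definition ratfun_eval (d : {fraction {poly R[i]}}) (z : sphere) : sphere :=
  let r := repr d in
  let g := gcdp (fraction.frac r).1 (fraction.frac r).2 in
  let p := (fraction.frac r).1 %/ g in
  let q := (fraction.frac r).2 %/ g in
  match z with
  | Some a => if q.[a] == 0 then None else Some (p.[a] / q.[a])
  | None => if (size q < size p)%N then None
            else Some (p`_(size q).-1 / lead_coef q)
  end.

Definition cabs (a : R[i]) : R := complex.Re `|a|.

Definition chordal (z w : sphere) : R :=
  match z, w with
  | Some a, Some b =>
      2 * cabs (a - b) /
      (Num.sqrt (1 + cabs a ^+ 2) * Num.sqrt (1 + cabs b ^+ 2))
  | Some a, None | None, Some a => 2 / Num.sqrt (1 + cabs a ^+ 2)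
  | None, None => 0
  end.

(* Normality in the sense of Montel: every sequence of members of the family
   has a subsequence converging uniformly, for the chordal metric, on the
   compact subsets of U. *)
Definition normal_on (U : set sphere) (H : set (sphere -> sphere)) : Prop :=
  forall u : nat -> sphere -> sphere, (forall k, H (u k)) ->
  exists (phi : nat -> nat) (g : sphere -> sphere),
    {homo phi : m n / (m < n)%N} /\
    forall A : set sphere, compact A -> A `<=` U ->
    forall e : R, 0 < e ->
    exists N : nat, forall k, (N <= k)%N -> forall z, A z ->
      chordal (u (phi k) z) (g z) < e.

Definition fatou_set (f : sphere -> sphere) : set sphere :=
  [set z | exists U : set sphere, [/\ open U, U z &
     normal_on U [set h | exists n : nat, h = iter n f]]].

Definition julia_set (f : sphere -> sphere) : set sphere := ~` fatou_set f.

(* The extended real line, as a subset of the sphere. *)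
Definition real_circle : set sphere :=
  [set z | if z is Some a then complex.Im a = 0 else True].

Definition real_interval (A : set sphere) : Prop :=
  [/\ A !=set0, A `<=` real_circle & connected A].

Definition cantor_set (A : set sphere) : Prop :=
  [/\ A !=set0, compact A, perfect_set A & totally_disconnected A].

End Julia.

(* Main.v *)
Require Import Defs.
From mathcomp Require Import all_boot all_order all_algebra all_field.
From mathcomp Require Import fraction generic_quotient finmap complex.
From mathcomp Require Import all_classical all_reals all_analysis.
From mathcomp Require Import zify ring lra.

(* Let th be the size of the boundary of C and c = 1 / (th - 1). The normalised
   adjacency matrix of \hat C is diagonalisable; its eigenvalues kappa lie in
   [-c, 1], because the isomorphism X -> X_F decomposes \hat C into edge-disjoint
   cliques of size at least th. Double transitivity on the boundary gives
   d = (s - t) / (s + c t), where s = sum a_i / (1 - kappa_i z) and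
   t = sum b_i / (1 - kappa_i z) are the spectral transforms of the indicator of the
   boundary and of a difference of two boundary vertices. An affine change of the
   variable 1 / z, sending [-c, 1] to [-1, 1], conjugates d to G = (f + h) / (f - h)
   for two Stieltjes transforms f, h of probability measures on [-1, 1] with the
   same mean.

   Off [-1, 1] the map G strictly increases |nu - 1| + |nu + 1|, so that every orbit
   leaving [-1, 1] tends to infinity; hence the Julia set is the set E of points
   whose orbit stays in [-1, 1], normality failing on E since nearby non-real
   points escape. On each component of {f h < 0} the map G is monotone onto
   [-1, 1] and expands in the coordinate asin, so E is either [-1, 1] or a
   perfect set without interior. *)

Set Implicit Arguments.
Unset Strict Implicit.
Unset Printing Implicit Defensive.

Import Order.TTheory GRing.Theory Num.Theory.
Import numFieldNormedType.Exports.

Local Open Scope classical_set_scope.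
Local Open Scope ring_scope.
Local Open Scope complex_scope.

(** * The Riemann sphere *)

Section Modulus.
Context {R : realType}.
Implicit Types (a b : R[i]).

Lemma normcE_cabs a : `|a| = (cabs a)%:C.
Proof. by rewrite /cabs normc_def. Qed.

Lemma cabsE a : cabs a = Num.sqrt (complex.Re a ^+ 2 + complex.Im a ^+ 2).
Proof. by rewrite /cabs normc_def. Qed.

Lemma cabs_ge0 a : 0 <= cabs a.
Proof. by rewrite cabsE sqrtr_ge0. Qed.

Lemma sqr_cabs a : cabs a ^+ 2 = complex.Re a ^+ 2 + complex.Im a ^+ 2.
Proof. by rewrite cabsE sqr_sqrtr// addr_ge0// sqr_ge0. Qed.

Lemma mul_conjC_cabs a : (a * a^*)%R = (cabs a ^+ 2)%:C.
Proof. by rewrite -sqr_normc normcE_cabs rmorphXn. Qed.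

Lemma cabs_eq0 a : (cabs a == 0) = (a == 0).
Proof. by rewrite -[RHS]normr_eq0 normcE_cabs fmorph_eq0. Qed.

Lemma cabs0 : cabs (0 : R[i]) = 0.
Proof. by apply/eqP; rewrite cabs_eq0. Qed.

Lemma cabs_gt0 a : (0 < cabs a) = (a != 0).
Proof. by rewrite lt_neqAle cabs_ge0 andbT eq_sym cabs_eq0. Qed.

Lemma cabsM a b : cabs (a * b) = cabs a * cabs b.
Proof. by apply: (@complexI R); rewrite rmorphM /= -!normcE_cabs normrM. Qed.

Lemma cabsN a : cabs (- a) = cabs a.
Proof. by rewrite /cabs normrN. Qed.

Lemma cabsB a b : cabs (a - b) = cabs (b - a).
Proof. by rewrite -cabsN opprB. Qed.

Lemma cabsV a : cabs a^-1 = (cabs a)^-1.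
Proof. by apply: (@complexI R); rewrite fmorphV /= -!normcE_cabs normfV. Qed.

Lemma cabsD a b : cabs (a + b) <= cabs a + cabs b.
Proof. by rewrite -lecR rmorphD /= -!normcE_cabs ler_normD. Qed.

Lemma cabs_real (x : R) : cabs x%:C = `|x|.
Proof. by rewrite cabsE /= expr0n addr0 sqrtr_sqr. Qed.

Lemma cabs1 : cabs (1 : R[i]) = 1.
Proof. by rewrite (cabs_real 1) normr1. Qed.

Lemma cabs_nat n : cabs (n%:R : R[i]) = n%:R.
Proof. by rewrite -(rmorph_nat (real_complex R)) cabs_real normr_nat. Qed.

Lemma cabs_dist a b : `|cabs a - cabs b| <= cabs (a - b).
Proof.
rewrite -lecR -cabs_real -!normcE_cabs rmorphB /= -!normcE_cabs.
exact: ler_dist_dist.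
Qed.

Lemma normIm_le_cabs a : `|complex.Im a| <= cabs a.
Proof. by rewrite cabsE -sqrtr_sqr ler_wsqrtr// lerDr sqr_ge0. Qed.

Lemma normRe_le_cabs a : `|complex.Re a| <= cabs a.
Proof. by rewrite cabsE -sqrtr_sqr ler_wsqrtr// lerDl sqr_ge0. Qed.

Lemma Re_le_cabs a : complex.Re a <= cabs a.
Proof. exact: le_trans (ler_norm _) (normRe_le_cabs a). Qed.

Lemma Re_mul a b : complex.Re (a * b) =
  complex.Re a * complex.Re b - complex.Im a * complex.Im b.
Proof. by case: a => ? ?; case: b. Qed.

Lemma Im_mul a b : complex.Im (a * b) =
  complex.Re a * complex.Im b + complex.Im a * complex.Re b.
Proof. by case: a => ? ?; case: b. Qed.

Lemma Re_inv a : complex.Re a^-1 = complex.Re a / cabs a ^+ 2.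
Proof. by rewrite sqr_cabs; case: a. Qed.

Lemma Im_inv a : complex.Im a^-1 = - (complex.Im a / cabs a ^+ 2).
Proof. by rewrite sqr_cabs; case: a. Qed.

Lemma nbhs_complexP (a : R[i]^o) (A : set R[i]^o) :
  nbhs a A <-> exists2 e : R, 0 < e & forall b, cabs (b - a) < e -> A b.
Proof.
split.
  move=> /nbhs_ballP[e /= e0 eA].
  have /complex_realP[r er] := gtr0_real e0.
  exists r; first by rewrite -ltcR -er.
  by move=> b br; apply: eA; rewrite -ball_normE /= distrC normcE_cabs er ltcR.
move=> [e e0 eA]; apply/nbhs_ballP; exists e%:C; first by rewrite /= ltcR.
by move=> b; rewrite -ball_normE /= distrC normcE_cabs ltcR; exact: eA.
Qed.

Lemma cvg_complex T (F : set_system T) {FF : Filter F} (f : T -> R[i]^o)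
    (l : R[i]^o) :
  (forall e : R, 0 < e -> \forall x \near F, cabs (f x - l) < e) -> f @ F --> l.
Proof.
move=> fl A /nbhs_complexP[e e0 eA].
by have := fl _ e0; apply: filterS => x /eA.
Qed.

Lemma continuous_Re : continuous (fun a : R[i]^o => complex.Re a).
Proof.
move=> a; apply/(@cvgrPdist_lt _ _ _ (nbhs a)) => e e0.
apply/nbhs_complexP; exists e => // b.
by apply: le_lt_trans; rewrite cabsB -raddfB normRe_le_cabs.
Qed.

Lemma continuous_cabs : continuous (fun a : R[i]^o => cabs a).
Proof.
move=> a; apply/(@cvgrPdist_lt _ _ _ (nbhs a)) => e e0.
apply/nbhs_complexP; exists e => // b.
by apply: le_lt_trans; rewrite cabsB; exact: cabs_dist.
Qed.

Lemma continuous_of_real : continuous (fun x : R => x%:C : R[i]^o).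
Proof.
move=> x; apply: cvg_complex => e e0.
have /cvgrPdist_lt/(_ _ e0) : (id : R -> R) y @[y --> x] --> x by exact: cvg_id.
by apply: filterS => y; rewrite distrC -rmorphB /= cabs_real.
Qed.

Lemma cabs_le_norm1 (x y : R) : cabs (x +i* y) <= `|x| + `|y|.
Proof.
rewrite -[leRHS]ger0_norm ?addr_ge0// -sqrtr_sqr cabsE ler_wsqrtr//=.
rewrite [leRHS]sqrrD !real_normK ?num_real//.
by rewrite lerD2r lerDl mulrn_wge0// mulr_ge0.
Qed.

Lemma continuous_complex_pair :
  continuous (fun p : R * R => p.1 +i* p.2 : R[i]^o).
Proof.
move=> -[x y]; apply: cvg_complex => e e0.
have e2 : 0 < e / 2 by rewrite divr_gt0.
exists ([set u | `|x - u| < e / 2], [set u | `|y - u| < e / 2]) => /=.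
  by split; apply/nbhs_normP; exists (e / 2).
move=> -[u v] /= [xu yv]; apply: le_lt_trans (cabs_le_norm1 _ _) _.
by rewrite (distrC u) (distrC v) [ltRHS]splitr ltrD.
Qed.

Lemma compact_disc (M : R) : compact [set a : R[i]^o | cabs a <= M].
Proof.
have csquare : compact
    ((fun p : R * R => p.1 +i* p.2 : R[i]^o) @` (`[- M, M] `*` `[- M, M])%classic).
  apply: continuous_compact; last by apply: compact_setX; exact: segment_compact.
  by apply: continuous_subspaceT => x; exact: continuous_complex_pair.
apply: (subclosed_compact _ csquare).
  have -> : [set a : R[i]^o | cabs a <= M] = (@cabs R) @^-1` [set x | x <= M].
    by [].
  apply: preimage_closed; last exact: closed_le.
  by move=> a _; exact: continuous_cabs.
move=> a /= aM; exists (complex.Re a, complex.Im a); last by case: a {aM}.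
by split; rewrite /= in_itv /= -ler_norml (le_trans _ aM)//
  ?normRe_le_cabs ?normIm_le_cabs.
Qed.

Lemma hausdorff_complex : hausdorff_space R[i]^o.
Proof. exact: norm_hausdorff. Qed.

Lemma closed_disc (M : R) : closed [set a : R[i]^o | cabs a <= M].
Proof. by apply: (compact_closed hausdorff_complex); exact: compact_disc. Qed.

Lemma locally_compact_complex : locally_compact [set: R[i]^o].
Proof.
move=> a _; rewrite withinET; exists [set b | cabs b <= cabs a + 1].
  apply/nbhs_complexP; exists 1 => // b ba /=.
  have := le_trans (ler_norm _) (cabs_dist b a); lra.
by split; [exact: compact_disc | exact: closed_disc].
Qed.

End Modulus.

Lemma dnbhs_notin_seq (T : topologicalType) (x : T) (s : seq T) :
  accessible_space T -> \forall y \near x^', y \notin s.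
Proof.
move=> T1; elim: s => [|z s IH]; first exact: filterE.
have yz : \forall y \near x^', y != z.
  have [->|xz] := eqVneq x z; first exact: nbhs_dnbhs_neq.
  have [U [oU /set_mem Ux zU]] := T1 _ _ xz.
  apply: nbhs_dnbhs; apply: filterS (open_nbhs_nbhs (conj oU Ux)) => y Uy.
  by apply/eqP => yz; move: zU; rewrite -yz => /set_mem.
by apply: filterS2 yz IH => y yz ys; rewrite inE negb_or yz.
Qed.

Section Sphere.
Context {R : realType}.
Local Notation sphere := (sphere R).
Implicit Types (a b : R[i]) (x y z : sphere).

Lemma nbhs_infty (A : set sphere) : nbhs (None : sphere) A <->
  A None /\ exists M : R, forall a, M < cabs a -> A (Some a).
Proof.
split.
  move=> [K [cK _] KA]; split; first by apply: KA; right.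
  have cabsK : compact ((@cabs R) @` K).
    apply: continuous_compact cK.
    by apply: continuous_subspaceT => x; exact: continuous_cabs.
  have [M [_ MK]] := compact_bounded cabsK.
  exists (M + 1) => a Ma; apply: KA; left; exists a => // Ka.
  have := MK (M + 1); rewrite ltrDl ltr01 => /(_ isT (cabs a)).
  move=> /(_ (ex_intro2 _ _ a Ka erefl)) /(le_trans (ler_norm _)).
  by rewrite leNgt Ma.
move=> [AN [M MA]]; exists [set a : R[i]^o | cabs a <= M].
  by split; [exact: compact_disc | exact: closed_disc].
move=> x [[a /= /negP]|-> //]; rewrite -ltNge => /MA Aa <- //.
Qed.

Lemma nbhs_finite a (A : set sphere) : nbhs (Some a : sphere) A <->
  exists2 e : R, 0 < e & forall b, cabs (b - a) < e -> A (Some b).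
Proof. exact: (nbhs_complexP a (Some @^-1` A)). Qed.

Lemma hausdorff_sphere : hausdorff_space sphere.
Proof.
exact: one_point_compactification_hausdorff locally_compact_complex
  hausdorff_complex.
Qed.

Lemma compact_sphere : compact [set: sphere].
Proof. exact: one_point_compactification_compact. Qed.

Lemma closed_sphere_compact (A : set sphere) : closed A -> compact A.
Proof. by move=> cA; exact: subclosed_compact cA compact_sphere _. Qed.

Instance sphere_dnbhs_proper z : ProperFilter z^'.
Proof.
apply: Build_ProperFilter_ex => A; case: z => [a|].
  move=> /nbhs_finite[e e0 eA]; exists (Some (a + (e / 2)%:C)); apply: eA.
    rewrite addrC addKr cabs_real gtr0_norm ?divr_gt0//; lra.
  apply/eqP => /Some_inj/eqP; rewrite -subr_eq0 addrC addKr fmorph_eq0.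
  by rewrite gt_eqF// divr_gt0.
move=> /nbhs_infty[_ [M MA]]; exists (Some (`|M| + 1)%:C); apply: MA => //.
by rewrite cabs_real ger0_norm ?addr_ge0//; have := ler_norm M; lra.
Qed.

(* Agreement at all but finitely many points suffices, as the sphere has no
   isolated point. *)
Lemma eq_continuous_cofinite (f g : sphere -> sphere) (s : seq R[i]) :
  continuous f -> continuous g ->
  (forall a, a \notin s -> f (Some a) = g (Some a)) -> f =1 g.
Proof.
move=> cf cg fg z.
have dcvg (k : sphere -> sphere) : continuous k -> k @ z^' --> k z.
  by move=> ck U /ck nU; exact: nbhs_dnbhs nU.
apply: (cvg_unique hausdorff_sphere (dcvg f cf)).
apply: cvg_trans (dcvg g cg); apply: near_eq_cvg.
have := @dnbhs_notin_seq sphere z (None :: map Some s)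
  (hausdorff_accessible hausdorff_sphere).
apply: filterS => -[a|//]; rewrite inE /= => asN.
by rewrite fg//; apply: contra asN => as_; rewrite mem_map// => ? ? [].
Qed.

Definition sphere_inv (x : sphere) : sphere :=
  if x is Some a then if a == 0 then None else Some a^-1 else Some 0.

Lemma sphere_invK : involutive sphere_inv.
Proof.
move=> [a|]; rewrite /sphere_inv ?eqxx//.
by have [->//|a0] := eqVneq a 0; rewrite invr_eq0 (negbTE a0) invrK.
Qed.

Lemma continuous_sphere_inv : continuous sphere_inv.
Proof.
move=> [a|] A; rewrite /sphere_inv.
  have [->|a0] := eqVneq a 0.
    move=> /nbhs_infty[AN [M MA]]; apply/nbhs_finite.
    have M1 : 0 < Num.max M 1 by rewrite lt_max ltr01 orbT.
    exists (Num.max M 1)^-1; first by rewrite invr_gt0.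
    move=> b; rewrite subr0 => bM; rewrite /=.
    have [//|b0] := eqVneq b 0; apply: MA; rewrite cabsV.
    move: bM; rewrite -ltf_pV2 ?invrK ?posrE ?cabs_gt0 ?invr_gt0//.
    by rewrite gt_max => /andP[].
  move=> nA; have near_inv : \forall b \near (a : R[i]^o), A (Some b^-1).
    have : (fun b : R[i]^o => b^-1 : R[i]^o) @ (a : R[i]^o) --> (a^-1 : R[i]^o).
      by apply: (@cvgV _ _ (nbhs (a : R[i]^o)) _ id).
    by move=> /(_ (Some @^-1` A)); apply.
  have near_neq0 : \forall b \near (a : R[i]^o), b != 0.
    exact: (@cvgr_neq0 _ R[i]^o _ _ (nbhs_filter a) id a (fun _ => id) a0).
  change (\forall b \near (a : R[i]^o), A (if b == 0 then None else Some b^-1)).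
  by apply: filterS2 near_neq0 near_inv => b /negbTE ->.
move=> /nbhs_finite[e e0 eA]; apply/nbhs_infty; split.
  by apply: eA; rewrite subrr cabs0.
exists e^-1 => a ae; have a0 : a != 0.
  by rewrite -cabs_gt0 (lt_trans _ ae)// invr_gt0.
rewrite /= (negbTE a0); apply: eA; rewrite subr0 cabsV.
by rewrite -(invrK e) ltf_pV2 ?posrE ?cabs_gt0 ?invr_gt0.
Qed.

(* The point with homogeneous coordinates [a : b]. *)
Definition hcoord a b : sphere := if b == 0 then None else Some (a / b).

Lemma hcoord_eq a b a' b' : (a, b) != (0, 0) -> (a', b') != (0, 0) ->
  a * b' = a' * b -> hcoord a b = hcoord a' b'.
Proof.
rewrite !xpair_eqE !negb_and /hcoord => ab ab' /eqP cross.
have [b0|b0] := eqVneq b 0; have [b'0|b'0] := eqVneq b' 0 => //.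
- move: ab cross; rewrite b0 eqxx orbF mulr0 mulf_eq0 (negbTE b'0).
  by move=> /negbTE ->.
- move: ab' cross; rewrite b'0 eqxx orbF mulr0 [0 == _]eq_sym mulf_eq0.
  by rewrite (negbTE b0) => /negbTE ->.
by congr Some; apply/eqP; rewrite eqr_div.
Qed.

Lemma hcoordM c a b : c != 0 -> hcoord (c * a) (c * b) = hcoord a b.
Proof.
move=> c0; rewrite /hcoord mulf_eq0 (negbTE c0) /=.
by case: eqP => // /eqP b0; rewrite -mulf_div divff// mul1r.
Qed.

Lemma sphere_inv_hcoord a b : (a, b) != (0, 0) ->
  sphere_inv (hcoord a b) = hcoord b a.
Proof.
rewrite xpair_eqE negb_and /sphere_inv /hcoord.
have [->|b0] := eqVneq b 0; first by rewrite orbF => /negbTE ->; rewrite mul0r.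
by rewrite mulf_eq0 invr_eq0 (negbTE b0) orbF invf_div.
Qed.

Lemma cvg_hcoord_finite T (F : set_system T) {FF : Filter F}
    (P Q : T -> R[i]^o) (p q : R[i]^o) : q != 0 -> P @ F --> p -> Q @ F --> q ->
  (fun t => hcoord (P t) (Q t)) @ F --> hcoord p q.
Proof.
move=> q0 cP cQ A; rewrite {1}/hcoord (negbTE q0) => nA.
have : (fun t => P t / Q t : R[i]^o) @ F --> (p / q : R[i]^o).
  exact: (@cvgM _ _ F _ P (fun t => (Q t)^-1) _ _ cP (@cvgV _ _ F _ Q _ q0 cQ)).
move=> /(_ (Some @^-1` A) nA) nPQ.
have nQ : \forall t \near F, Q t != 0 by exact: cvgr_neq0 cQ q0.
change (\forall t \near F, A (hcoord (P t) (Q t))).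
by apply: filterS2 nQ nPQ => t /negbTE Qt; rewrite /hcoord Qt.
Qed.

Lemma cvg_hcoord T (F : set_system T) {FF : Filter F} (P Q : T -> R[i]^o)
    (p q : R[i]^o) : (p, q) != (0, 0) -> P @ F --> p -> Q @ F --> q ->
  (fun t => hcoord (P t) (Q t)) @ F --> hcoord p q.
Proof.
move=> pq cP cQ; have [q0|q0] := eqVneq (q : R[i]) 0.
  2: exact: cvg_hcoord_finite.
have p0 : p != 0 by move: pq; rewrite q0 xpair_eqE eqxx andbT.
have cQP := cvg_hcoord_finite p0 cQ cP.
rewrite -(sphere_inv_hcoord (a := q)); last by rewrite xpair_eqE negb_and p0 orbT.
have nP : \forall t \near F, P t != 0 by exact: cvgr_neq0 cP p0.
move=> A nA; have := continuous_sphere_inv nA => /cQP nA'.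
change (\forall t \near F, A (hcoord (P t) (Q t))).
apply: filterS2 nP nA' => t Pt /=; rewrite sphere_inv_hcoord//.
by rewrite xpair_eqE negb_and Pt orbT.
Qed.

End Sphere.

(** * Rational maps of the sphere *)

Section RationalMaps.
Context {R : realType}.
Local Notation sphere := (sphere R).
Implicit Types (p q P Q : {poly R[i]}) (d : {fraction {poly R[i]}}) (a : R[i]).

Definition ratmap p q (z : sphere) : sphere :=
  match z with
  | Some a => hcoord p.[a] q.[a]
  | None => if (size q < size p)%N then None
            else Some (p`_(size q).-1 / lead_coef q)
  end.

Lemma frac_divE (R' : idomainType) (d : {fraction R'}) :
  d = tofrac (fraction.frac (repr d)).1 / tofrac (fraction.frac (repr d)).2.
Proof.
set r := repr d; have r0 := denom_ratioP r.
apply: (canRL (mulfK _)); first by rewrite tofrac_eq0.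
rewrite -(reprK d) -/r; unlock FracField.tofrac.
rewrite -[_ * _]/(FracField.mul _ _) !piE.
apply/eqmodP; rewrite /= FracField.equivfE /= /FracField.mulf.
by rewrite !numden_Ratio ?mulf_neq0 ?oner_eq0//= ?mulr1 ?mul1r// mulrC.
Qed.

Lemma ratfun_evalE d : exists p q,
  [/\ coprimep p q, q != 0, d = tofrac p / tofrac q
    & ratfun_eval d = ratmap p q].
Proof.
have [n0 dE] := (denom_ratioP (repr d), frac_divE d).
set n := (fraction.frac _).1 in dE; set m := (fraction.frac _).2 in n0 dE.
have g0 : gcdp n m != 0 by rewrite gcdp_eq0 negb_and n0 orbT.
exists (n %/ gcdp n m), (m %/ gcdp n m); split.
- by rewrite coprimep_div_gcd// n0 orbT.
- by rewrite dvdp_div_eq0 ?dvdp_gcdr.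
- rewrite dE -[in tofrac n](divpK (dvdp_gcdl n m)).
  rewrite -[in tofrac m](divpK (dvdp_gcdr n m)) !tofracM.
  by rewrite -mulf_div divff ?mulr1// tofrac_eq0.
by apply: funext => -[a|].
Qed.

Lemma continuous_horner_complex p :
  continuous (fun a : R[i]^o => p.[a] : R[i]^o).
Proof.
elim/poly_ind: p => [|p c IH] a.
  under eq_fun do rewrite horner0.
  by apply: (@cvg_cst _ _ _ (nbhs a)); exact: nbhs_filter.
under eq_fun do rewrite hornerMXaddC.
apply: (@cvgD _ _ _ (nbhs a) _ (fun b : R[i]^o => p.[b] * b : R[i]^o)
  (fun=> c : R[i]^o)); last first.
  by apply: (@cvg_cst _ _ _ (nbhs a)); exact: nbhs_filter.
exact: (@cvgM _ _ (nbhs a) _ (fun b : R[i]^o => p.[b]) id _ _ (IH a) (fun _ => id)).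
Qed.

Lemma coprimep_horner p q a : coprimep p q -> (p.[a], q.[a]) != (0, 0).
Proof.
move=> pq; rewrite xpair_eqE negb_and.
by have [/eqP p0|//] := eqVneq p.[a] 0; rewrite (coprimep_root pq).
Qed.

Definition rev_poly n p : {poly R[i]} := \poly_(i < n.+1) p`_(n - i).

Lemma horner_rev_poly n p a : (size p <= n.+1)%N -> a != 0 ->
  (rev_poly n p).[a] = a ^+ n * p.[a^-1].
Proof.
move=> pn a0; rewrite horner_poly (horner_coef_wide _ pn) mulr_sumr.
rewrite (reindex_inj rev_ord_inj) /=; apply: eq_bigr => i _.
rewrite subSS subKn; last by rewrite -ltnS.
rewrite mulrCA; congr (_ * _).
by rewrite exprVn -exprB ?unitfE// -ltnS.
Qed.

Section AtInfinity.
Variables (p q : {poly R[i]}).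
Hypothesis q_neq0 : q != 0.

Let n := (maxn (size p) (size q)).-1.

Let nS : n.+1 = maxn (size p) (size q).
Proof. by rewrite /n prednK// leq_max [X in _ || X]lt0n size_poly_eq0 q_neq0 orbT. Qed.

Lemma ratmap_inv a : ratmap p q (sphere_inv (Some a)) =
  hcoord (rev_poly n p).[a] (rev_poly n q).[a].
Proof.
have pn : (size p <= n.+1)%N by rewrite nS leq_maxl.
have qn : (size q <= n.+1)%N by rewrite nS leq_maxr.
rewrite /sphere_inv; have [->|a0] := eqVneq a 0; last first.
  by rewrite !horner_rev_poly//= hcoordM// expf_neq0.
rewrite /= !horner_coef0 !coef_poly/= !subn0 /hcoord.
have [qp|pq] := ltnP.
  by rewrite nth_default ?eqxx// -ltnS nS (maxn_idPl _)// ltnW.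
have -> : n = (size q).-1 by rewrite /n (maxn_idPr _).
by rewrite -/(lead_coef q) lead_coef_eq0 (negbTE q_neq0).
Qed.

Lemma rev_poly_at0 : ((rev_poly n p).[0], (rev_poly n q).[0]) != (0, 0).
Proof.
rewrite !horner_coef0 !coef_poly/= !subn0 xpair_eqE negb_and.
have [pq|qp] := leqP (size p) (size q).
  have -> : n = (size q).-1 by rewrite /n (maxn_idPr _).
  by rewrite -/(lead_coef q) lead_coef_eq0 q_neq0 orbT.
have -> : n = (size p).-1 by rewrite /n (maxn_idPl _)// ltnW.
rewrite -/(lead_coef p) lead_coef_eq0 -size_poly_eq0 -lt0n.
by rewrite (leq_ltn_trans _ qp).
Qed.

Lemma continuous_ratmap : coprimep p q -> continuous (ratmap p q).
Proof.
move=> pq [a|].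
  have := cvg_hcoord (coprimep_horner a pq)
    (@continuous_horner_complex p a) (@continuous_horner_complex q a).
  by move=> ca A /ca.
have c0 : {for (Some 0 : sphere), continuous (ratmap p q \o sphere_inv)}.
  have ca := cvg_hcoord rev_poly_at0 (@continuous_horner_complex (rev_poly n p) 0)
    (@continuous_horner_complex (rev_poly n q) 0).
  move=> A; rewrite [X in nbhs X]ratmap_inv => /ca nA.
  change (nbhs (0 : R[i]^o) [set a | A (ratmap p q (sphere_inv (Some a)))]).
  apply: (@filterS _ (nbhs (0 : R[i]^o)) _ _ _ _ nA) => a.
  by rewrite /mkset ratmap_inv.
move=> A nA; have cA := continuous_comp (@continuous_sphere_inv R None) c0.
have /cA : nbhs ((ratmap p q \o sphere_inv) (sphere_inv None)) A.
  by rewrite /comp sphere_invK.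
apply: (@filterS _ (nbhs (None : sphere))) => z.
by rewrite /preimage /comp /mkset sphere_invK.
Qed.

End AtInfinity.

Lemma continuous_ratfun_eval d : continuous (ratfun_eval d).
Proof.
by have [p [q [pq q0 _ ->]]] := ratfun_evalE d; exact: continuous_ratmap.
Qed.

Section Quotient.
Variables (d : {fraction {poly R[i]}}) (P Q : {poly R[i]}).
Hypotheses (Q_neq0 : Q != 0) (dE : d = tofrac P / tofrac Q).

Let quotient_cross p q : q != 0 -> d = tofrac p / tofrac q -> p * Q = P * q.
Proof.
move=> q0; rewrite dE => /esym/eqP; rewrite eqr_div ?tofrac_eq0// -!tofracM.
by rewrite tofrac_eq => /eqP.
Qed.

Lemma ratfun_eval_hcoord a : (P.[a], Q.[a]) != (0, 0) ->
  ratfun_eval d (Some a) = hcoord P.[a] Q.[a].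
Proof.
have [p [q [pq q0 /(quotient_cross q0) cross ->]]] := ratfun_evalE d => PQ.
apply: hcoord_eq => //; first exact: coprimep_horner.
by rewrite -!hornerM cross.
Qed.

Lemma ratfun_eval_hcoord_deriv a : P.[a] = 0 -> Q.[a] = 0 ->
  (P^`().[a], Q^`().[a]) != (0, 0) ->
  ratfun_eval d (Some a) = hcoord P^`().[a] Q^`().[a].
Proof.
have [p [q [pq q0 /(quotient_cross q0) cross ->]]] := ratfun_evalE d.
move=> Pa Qa PQ; apply: hcoord_eq => //; first exact: coprimep_horner.
have := congr1 (fun p => p^`().[a]) cross.
by rewrite !derivM !hornerD !hornerM Pa Qa !mul0r !mulr0 addr0 add0r.
Qed.

Lemma ratfun_eval_infty : (size Q < size P)%N -> ratfun_eval d None = None.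
Proof.
have [p [q [pq q0 /(quotient_cross q0) cross ->]]] := ratfun_evalE d => QP.
have P0 : P != 0 by rewrite -size_poly_gt0 (leq_ltn_trans _ QP).
have p0 : p != 0.
  by have := mulf_neq0 P0 q0; rewrite -cross mulf_eq0 negb_or => /andP[].
have := congr1 (fun p : {poly R[i]} => size p) cross; rewrite !size_mul//.
move: QP p0 q0 Q_neq0; rewrite -!size_poly_gt0 /ratmap => QP p0 q0 Q0 sizeE.
rewrite ifT//; move: QP p0 q0 Q0 sizeE.
by move: (size p) (size q) (size P) (size Q) => np nq nP nQ; lia.
Qed.

End Quotient.

End RationalMaps.

(** * Expanding dynamics on an interval *)

Lemma image_itv_increasing {R : realType} (f : R -> R) (p q x c d : R) :
  {within `[p, q], continuous f} ->
  {in `[p, q] &, {mono f : y z / y <= z}} -> p <= x <= q ->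
  f p <= c -> c <= f x <= d -> d <= f q ->
  exists a b, [/\ p <= a, a <= x <= b, b <= q & f @` `[a, b] = `[c, d]%classic].
Proof.
move=> cf mf /andP[px xq] pc /andP[cx xd] dq.
have pq : p <= q := le_trans px xq.
have cd : c <= d := le_trans cx xd.
have onto a b t : p <= a -> a <= b -> b <= q -> f a <= t <= f b ->
    exists2 s, a <= s <= b & f s = t.
  move=> pa ab bq /andP[at_ tb].
  have cab : {within `[a, b], continuous f}.
    apply: continuous_subspaceW cf => y /=; rewrite !in_itv /= => /andP[ay yb].
    by rewrite (le_trans pa) ?(le_trans yb).
  have [|s] := @IVT _ f a b t ab cab; last by rewrite in_itv; exists s.
  by rewrite ge_min at_ le_max tb orbT.
have [|a /andP[pa ax] fa] := onto p x c (lexx _) px xq; first by rewrite pc.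
have [|b /andP[xb bq] fb] := onto x q d px xq (lexx _); first by rewrite xd.
exists a, b; split=> //; first by rewrite ax.
have mem y : a <= y <= b -> y \in `[p, q].
  by move=> /andP[ay yb]; rewrite in_itv /= (le_trans pa) ?(le_trans yb).
have ab := le_trans ax xb.
apply/seteqP; split=> [_ [y /= yab <-]|t] /=; rewrite in_itv /=.
  rewrite in_itv /= in yab; rewrite -fa -fb !mf ?mem//.
    by rewrite lexx ab.
  by rewrite lexx ab.
rewrite -fa -fb => /(onto a b t pa ab bq)[s sab <-].
by exists s; rewrite //= in_itv.
Qed.

Lemma image_itv_decreasing {R : realType} (f : R -> R) (p q x c d : R) :
  {within `[p, q], continuous f} ->
  {in `[p, q] &, {mono f : y z /~ y <= z}} -> p <= x <= q ->
  d <= f p -> c <= f x <= d -> f q <= c ->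
  exists a b, [/\ p <= a, a <= x <= b, b <= q & f @` `[a, b] = `[c, d]%classic].
Proof.
move=> cf mf xpq pd /andP[cx xd] qc.
have [|||||a [b [pa ab bq fab]]] :=
    @image_itv_increasing R (fun y => - f y) p q x (- d) (- c) _ _ xpq.
- by move=> y; apply: cvgN; exact: cf.
- by move=> y z yI zI; rewrite lerN2 mf.
- by rewrite lerN2.
- by rewrite !lerN2 cx xd.
- by rewrite lerN2.
exists a, b; split=> //; apply/seteqP; split=> [_ [y yab <-]|t /=].
  have : [set - t | t in f @` `[a, b]] (- f y) by exists (f y) => //; exists y.
  rewrite image_comp [X in X _]fab /= !in_itv /= !lerN2.
  by rewrite andbC.
rewrite in_itv /= => /andP[ct td].
have : `[- d, - c]%classic (- t) by rewrite /= in_itv /= !lerN2 ct td.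
by rewrite -fab => -[y yab /oppr_inj <-]; exists y.
Qed.

Section IntervalDynamics.
Context {R : realType}.
Variables (l r : R) (phi g : R -> R) (stay : set R).
Hypothesis lr : l < r.
Hypothesis phi_incr : {in `[l, r] &, {homo phi : x y / x < y}}.
Hypothesis phi_cont : {within `[l, r], continuous phi}.
Hypothesis stay_itv : forall x, stay x -> l <= x <= r /\ l <= g x <= r.

(* phi serves as the coordinate in which g expands distances. *)
Record branch (a b : R) : Prop := Branch {
  branch_ge : l <= a;
  branch_lt : a < b;
  branch_le : b <= r;
  branch_stay : forall x, a <= x <= b -> stay x;
  branch_cont : {within `[a, b], continuous g};
  branch_ends : (g a = l /\ g b = r) \/ (g a = r /\ g b = l);
  branch_expand : forall x y, a <= x -> x < y -> y <= b ->
    phi y - phi x < `|phi (g y) - phi (g x)| }.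

Hypothesis branchP : forall x, stay x -> exists a b, branch a b /\ a <= x <= b.

Definition survivors : set R := [set x | forall n, stay (iter n g x)].

Hypothesis survivors_closed : closed survivors.
Hypothesis fixed_r : g r = r.
Hypothesis survivors_r : survivors r.

Let phi_lt x y : l <= x -> x < y -> y <= r -> phi x < phi y.
Proof.
move=> lx xy yr; apply: phi_incr => //; rewrite in_itv /=.
  by rewrite lx (le_trans (ltW xy)).
by rewrite yr (le_trans lx) ?ltW.
Qed.

Lemma survivors_image x : survivors x -> survivors (g x).
Proof. by move=> Sx n; rewrite -iterSr; exact: Sx. Qed.

Lemma survivors_preimage x : stay x -> survivors (g x) -> survivors x.
Proof. by move=> sx Sgx [|n]//; rewrite iterSr. Qed.

Let survivors_itv x : survivors x -> l <= x <= r.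
Proof. by move=> /(_ 0%N) /stay_itv[]. Qed.

Lemma branch_stretch a b x y : branch a b -> a <= x -> x < y -> y <= b ->
  g x < g y /\ phi y - phi x < phi (g y) - phi (g x) \/
  g y < g x /\ phi y - phi x < phi (g x) - phi (g y).
Proof.
move=> br ax xy yb; have expand := branch_expand br ax xy yb.
have itv t : a <= t <= b -> l <= t <= r /\ l <= g t <= r.
  by move=> /(branch_stay br)/stay_itv.
have [|/andP[lx _] /andP[lgx gxr]] := itv x.
  by rewrite ax (le_trans (ltW xy)).
have [|/andP[_ yr] /andP[lgy gyr]] := itv y.
  by rewrite yb (le_trans ax) ?ltW.
have [gxy|gyx|gE] := ltgtP (g x) (g y).
- by left; split=> //; rewrite -[ltRHS]gtr0_norm// subr_gt0 phi_lt.
- by right; split=> //; rewrite -[ltRHS]gtr0_norm ?subr_gt0 ?phi_lt// distrC.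
move: expand; rewrite gE subrr normr0 subr_lt0 ltNge ltW//.
exact: phi_lt.
Qed.

Lemma branch_monotone a b : branch a b ->
  g a = l /\ g b = r /\ {in `[a, b] &, {mono g : x y / x <= y}} \/
  g a = r /\ g b = l /\ {in `[a, b] &, {mono g : x y /~ x <= y}}.
Proof.
move=> br; have ab := branch_lt br.
have ginj : {in `[a, b] &, injective g}.
  move=> x y; rewrite !in_itv /= => /andP[ax xb] /andP[ay yb] gxy.
  have [xy|yx|//] := ltgtP x y.
    by have [] := branch_stretch br ax xy yb; rewrite gxy ltxx => -[].
  by have [] := branch_stretch br ay yx xb; rewrite gxy ltxx => -[].
have cg := branch_cont br.
case: (branch_ends br) => -[ga gb]; [left|right]; do 2!split=> //.
  by apply: segment_continuous_inj_le => //; rewrite ga gb ltW.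
by apply: segment_continuous_inj_ge => //; rewrite ga gb ltW.
Qed.

Lemma branch_pullback p q x c d : branch p q -> p <= x <= q ->
  l <= c -> c <= g x <= d -> d <= r ->
  exists a b, [/\ p <= a, a <= x <= b, b <= q & g @` `[a, b] = `[c, d]%classic].
Proof.
move=> br xpq lc cxd dr; have cg := branch_cont br.
case: (branch_monotone br) => -[gp [gq mono]].
  by apply: image_itv_increasing; rewrite // ?gp ?gq.
by apply: image_itv_decreasing; rewrite // ?gp ?gq.
Qed.

Definition survivor_seg (a b : R) := forall x, a <= x <= b -> survivors x.

Lemma survivor_seg_image a b x y : branch a b -> a <= x -> x < y -> y <= b ->
  survivor_seg x y -> exists x' y', [/\ x' < y', survivor_seg x' y',
    phi y - phi x < phi y' - phi x' &
    x' = g x /\ y' = g y \/ x' = g y /\ y' = g x].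
Proof.
move=> br ax xy yb Sxy.
have cxy : {within `[x, y], continuous g}.
  apply: continuous_subspaceW (branch_cont br) => t /=; rewrite !in_itv /=.
  by move=> /andP[xt ty]; rewrite (le_trans ax) ?(le_trans ty).
have image t : Num.min (g x) (g y) <= t <= Num.max (g x) (g y) -> survivors t.
  move=> /(IVT (ltW xy) cxy)[s]; rewrite in_itv /= => sxy <-.
  exact/survivors_image/Sxy.
have [[gxy stretch]|[gyx stretch]] := branch_stretch br ax xy yb.
  exists (g x), (g y); split; [by []| |by []|by left].
  by move=> t txy; apply: image; rewrite minElt maxElt gxy.
exists (g y), (g x); split; [by []| |by []|by right].
by move=> t txy; apply: image; rewrite minC maxC minElt maxElt gyx.
Qed.

Lemma closed_survivor_segs :
  closed [set p : R * R | p.1 <= p.2 /\ survivor_seg p.1 p.2].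
Proof.
have -> : [set p : R * R | p.1 <= p.2 /\ survivor_seg p.1 p.2] =
    (fun p => p.2 - p.1) @^-1` [set u | 0 <= u] `&`
    \bigcap_(t in `[0, 1]%classic)
      ((fun p => p.1 + t * (p.2 - p.1)) @^-1` survivors).
  apply/seteqP; split=> -[a b] /=; rewrite subr_ge0 => -[ab Sab]; split=> //.
    move=> t /=; rewrite in_itv /= => /andP[t0 t1]; apply: Sab.
    by apply/andP; split; nra.
  move=> x /andP[ax xb]; have [ba|ba] := leP b a.
    have -> : x = a + 0 * (b - a) by lra.
    by apply: Sab; rewrite /= in_itv /= lexx ler01.
  have ba0 : 0 < b - a by rewrite subr_gt0.
  have -> : x = a + (x - a) / (b - a) * (b - a).
    by rewrite divfK ?gt_eqF// addrC subrK.
  apply: (Sab ((x - a) / (b - a))); rewrite /= in_itv /=.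
  by rewrite divr_ge0 ?subr_ge0 ?(ltW ba)// ler_pdivrMr// mul1r lerD2r.
apply: closedI.
  apply: preimage_closed; last exact: closed_ge.
  by move=> p _; apply: cvgB; [exact: cvg_snd | exact: cvg_fst].
apply: closed_bigI => t _; apply: preimage_closed => // p _.
apply: cvgD; first exact: cvg_fst.
apply: cvgM; first exact: cvg_cst.
by apply: cvgB; [exact: cvg_snd | exact: cvg_fst].
Qed.

Lemma phi_length_cont : {within (`[l, r] `*` `[l, r])%classic,
  continuous (fun p : R * R => phi p.2 - phi p.1)}.
Proof.
apply/subspace_continuousP => -[x y] [/= xI yI].
have /subspace_continuousP cphi := phi_cont.
apply: (@cvgB _ R^o) => A.
  move=> /(cphi _ yI)[e /= e0 eA]; exists (setT, [set u | ball y e u]) => /=.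
    by split; [exact: filterT | apply/nbhs_ballP; exists e].
  by move=> [u v] /= [_ yv] [_ vI]; exact: eA.
move=> /(cphi _ xI)[e /= e0 eA]; exists ([set u | ball x e u], setT) => /=.
  by split; [apply/nbhs_ballP; exists e | exact: filterT].
by move=> [u v] /= [xu _] [uI _]; exact: eA.
Qed.

Lemma longest_survivor_seg (P : set (R * R)) a b :
  closed P -> P (a, b) -> a < b -> survivor_seg a b ->
  exists a' b', [/\ P (a', b'), a' < b', survivor_seg a' b' &
    forall x y, P (x, y) -> x < y -> survivor_seg x y ->
      phi y - phi x <= phi b' - phi a'].
Proof.
move=> cP Pab ab Sab.
pose K := [set p : R * R | p.1 <= p.2 /\ survivor_seg p.1 p.2] `&` P.
have Kitv : K `<=` (`[l, r] `*` `[l, r])%classic.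
  move=> [x y] [[/= xy sxy] _]; split; rewrite /= in_itv /=;
    by apply/survivors_itv/sxy; rewrite ?lexx ?xy.
have cK : compact K.
  apply: subclosed_compact Kitv; first exact: closedI closed_survivor_segs cP.
  by apply: compact_setX; exact: segment_compact.
have Kab : K (a, b) by split=> //; split=> //; exact: ltW.
have [[a' b'] /set_mem[[/= ab' Sab'] Pab'] longest] := compact_EVT_max
  (ex_intro _ _ Kab) cK (continuous_subspaceW Kitv phi_length_cont).
exists a', b'; split=> //; last first.
  move=> x y Pxy xy Sxy; apply: (longest (x, y)); apply/mem_set.
  by do 2!split=> //; exact: ltW.
rewrite lt_neqAle ab' andbT; apply/eqP => aE.
have := longest _ (mem_set Kab); rewrite /= aE subrr subr_le0 leNgt phi_lt//.
  by have /survivors_itv/andP[] : survivors a by apply: Sab; rewrite lexx ltW.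
by have /survivors_itv/andP[] : survivors b by apply: Sab; rewrite lexx ltW.
Qed.

Let survivor_segS a b x y : a <= x -> y <= b ->
  survivor_seg a b -> survivor_seg x y.
Proof.
by move=> ax yb Sab t /andP[xt ty]; apply: Sab; rewrite (le_trans ax xt) (le_trans ty).
Qed.

Let survivor_seg_itv a b : a < b -> survivor_seg a b -> l <= a /\ b <= r.
Proof.
move=> ab Sab; split.
  by have /survivors_itv/andP[] : survivors a by apply: Sab; rewrite lexx ltW.
by have /survivors_itv/andP[] : survivors b by apply: Sab; rewrite lexx ltW.
Qed.

Lemma survivor_seg_right t : t < r -> survivor_seg t r -> survivor_seg l r.
Proof.
move=> tr Str.
have [|a [b [/= -> ar Sar longest]]] :=
    @longest_survivor_seg [set p | p.2 = r] t r _ erefl tr Str.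
  have -> : [set p : R * R | p.2 = r] = snd @^-1` [set r] by [].
  by apply: preimage_closed => [p _|]; [exact: cvg_snd | exact: closed_eq].
have [p [q [br /andP[pr rq]]]] := branchP (survivors_r 0%N).
have qr : q = r by apply/eqP; rewrite eq_le (branch_le br).
rewrite {q}qr in br rq.
have gp : g p = l.
  by case: (branch_ends br) => -[] //; rewrite fixed_r => _ rl; move: lr; rewrite rl ltxx.
have [ap|pa] := leP a p.
  have [x [y [xy Sxy _ xyE]]] := survivor_seg_image br (lexx _) (branch_lt br)
    (lexx _) (survivor_segS ap (lexx _) Sar).
  case: xyE xy Sxy => -[-> ->]; rewrite gp fixed_r// => rl.
  by have := lt_trans rl lr; rewrite ltxx.
have [x [y [xy Sxy stretch xyE]]] :=
  survivor_seg_image br (ltW pa) ar (lexx _) Sar.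
have [lx yr] := survivor_seg_itv xy Sxy.
case: xyE => -[xE yE]; last by move: xy; rewrite xE fixed_r ltNge yr.
have := longest x y; rewrite /= yE fixed_r => /(_ erefl).
rewrite -fixed_r -yE => /(_ xy Sxy); rewrite yE fixed_r.
by rewrite leNgt; move: stretch; rewrite yE fixed_r => ->.
Qed.

Lemma survivor_seg_left t : l < t -> survivor_seg l t -> survivor_seg l r.
Proof.
move=> lt_ Slt.
have [|a [b [/= -> lb Slb longest]]] :=
    @longest_survivor_seg [set p | p.1 = l] l t _ erefl lt_ Slt.
  have -> : [set p : R * R | p.1 = l] = fst @^-1` [set l] by [].
  by apply: preimage_closed => [p _|]; [exact: cvg_fst | exact: closed_eq].
have Sl : survivors l by apply: Slb; rewrite lexx ltW.
have [p [q [br /andP[pl lq]]]] := branchP (Sl 0%N).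
have pE : p = l by apply/eqP; rewrite eq_le (branch_ge br) pl.
rewrite {p}pE in br pl.
have [qb|bq] := leP q b.
  have [x [y [xy Sxy _ xyE]]] := survivor_seg_image br (lexx _) (branch_lt br)
    (lexx _) (survivor_segS (lexx _) qb Slb).
  by case: (branch_ends br) xyE xy Sxy => -[-> ->] [] [-> ->] // /(lt_trans lr);
    rewrite ltxx.
have [x [y [xy Sxy stretch xyE]]] :=
  survivor_seg_image br (lexx _) lb (ltW bq) Slb.
have [lx yr] := survivor_seg_itv xy Sxy.
have [gl|gl] : g l = l \/ g l = r by case: (branch_ends br) => -[]; [left|right].
  case: xyE => -[xE yE]; last by move: xy; rewrite yE gl ltNge lx.
  have xl : x = l by rewrite xE.
  by move: stretch; rewrite ltNge (longest x y)// xl.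
case: xyE => -[xE yE]; first by move: xy; rewrite xE gl ltNge yr.
by apply: (@survivor_seg_right x); rewrite -gl -yE.
Qed.

(* A longest segment of survivors cannot lie in a branch, whose expansion would
   produce a longer one; so it contains an endpoint of a branch, and the image
   of a piece of it has l or r as an endpoint. *)
Lemma survivors_segment a b : a < b -> survivor_seg a b -> survivor_seg l r.
Proof.
move=> ab Sab; have [|a' [b' [_ ab' Sab' longest]]] :=
    @longest_survivor_seg setT a b _ I ab Sab; first exact: closedT.
pose c := (a' + b') / 2.
have ac : a' < c by rewrite /c; lra.
have cb : c < b' by rewrite /c; lra.
have Sc : survivors c by apply: Sab'; rewrite !ltW.
have [p [q [br /andP[pc cq]]]] := branchP (Sc 0%N).
pose x := Num.max a' p; pose y := Num.min b' q.
have [ax px] : a' <= x /\ p <= x by rewrite /x !le_max !lexx orbT.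
have [yb yq] : y <= b' /\ y <= q by rewrite /y !ge_min !lexx orbT.
have xy : x < y.
  rewrite /x /y gt_max !lt_min ab' (branch_lt br).
  by rewrite (lt_le_trans ac) ?(le_lt_trans pc).
have [x' [y' [xy' Sxy' stretch xyE]]] :=
  survivor_seg_image br px xy yq (survivor_segS ax yb Sab').
have [lx' yr'] := survivor_seg_itv xy' Sxy'.
have via_end : [\/ x' = l, x' = r, y' = l | y' = r] -> survivor_seg l r.
  case=> e; move: xy' Sxy'; rewrite e => lt_; first exact: survivor_seg_left lt_.
  - by have := lt_le_trans lt_ yr'; rewrite ltxx.
  - by have := le_lt_trans lx' lt_; rewrite ltxx.
  exact: survivor_seg_right lt_.
have end_case t : t = p \/ t = q -> x' = g t \/ y' = g t -> survivor_seg l r.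
  move=> tE gt; apply: via_end; case: (branch_ends br) => -[gp gq].
    case: tE gt => -> [] ->; rewrite ?gp ?gq;
      [by constructor 1|by constructor 3|by constructor 2|by constructor 4].
  case: tE gt => -> [] ->; rewrite ?gp ?gq;
    [by constructor 2|by constructor 4|by constructor 1|by constructor 3].
have [pa|ap] := leP p a'; last first.
  have xp : x = p by rewrite /x; exact/max_idPr/ltW.
  apply: (end_case p); first by left.
  by move: xyE; rewrite xp => -[] []; [left|right].
have [bq|qb] := leP b' q; last first.
  have yqE : y = q by rewrite /y; exact/min_idPr/ltW.
  apply: (end_case q); first by right.
  by move: xyE; rewrite yqE => -[] []; [right|left].
have [xE yE] : x = a' /\ y = b' by split; [exact/max_idPl|exact/min_idPl].
by have := longest x' y' I xy' Sxy'; rewrite leNgt -xE -yE stretch.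
Qed.

Definition stays_for k : set R := [set x | forall n, (n < k)%N -> stay (iter n g x)].

Lemma cylinder k x : l <= x <= r -> stays_for k x -> exists a b,
  [/\ l <= a, a <= x <= b, b <= r,
      forall y, a <= y <= b -> stays_for k y &
      iter k g @` `[a, b] = `[l, r]%classic].
Proof.
elim: k x => [|k IH] x xI sx.
  by exists l, r; split=> //; exact: image_id.
have stx : stay x by exact: (sx 0%N).
have [_ gxI] := stay_itv stx.
have sgx : stays_for k (g x) by move=> n nk; rewrite -iterSr; exact: sx.
have [c [d [lc cxd dr scd onto]]] := IH _ gxI sgx.
have [p [q [br xpq]]] := branchP stx.
have [a [b [pa xab bq gab]]] := branch_pullback br xpq lc cxd dr.
exists a, b; split=> //.
- exact: le_trans (branch_ge br) pa.
- exact: le_trans bq (branch_le br).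
- move=> y yab [|n] nk.
    apply: (branch_stay br); case/andP: yab => ay yb.
    by rewrite (le_trans pa) ?(le_trans yb).
  rewrite iterSr; apply: scd => //.
  have : (g @` `[a, b]) (g y) by exists y; rewrite //= in_itv.
  by rewrite gab /= in_itv.
have -> : iter k.+1 g = iter k g \o g by apply: funext => y; rewrite iterSr.
by rewrite -image_comp gab.
Qed.

(* Every cylinder contains preimages of both r and e, hence two survivors. *)
Lemma survivors_perfect e : survivors e -> e != r ->
  (forall a b, a < b -> ~ survivor_seg a b) ->
  forall x, survivors x -> forall eps, 0 < eps ->
  exists y, [/\ survivors y, y != x & `|y - x| < eps].
Proof.
move=> Se er noseg x Sx eps eps0.
have hole a b : a < b -> exists t k, a <= t <= b /\ ~ stays_for k t.
  move=> ab; apply: contrapT => nohole; apply: (noseg _ _ ab) => t tab n.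
  apply: contrapT => nst; apply: nohole; exists t, n.+1; split=> //.
  by move=> /(_ n (leqnn _)).
have [u [k [/andP[xu ux] nu]]] : exists t k, x - eps / 2 <= t <= x /\ ~ stays_for k t.
  by apply: hole; lra.
have [v [j [/andP[xv vx] nv]]] : exists t k, x <= t <= x + eps / 2 /\ ~ stays_for k t.
  by apply: hole; lra.
pose m := maxn k j.
have [a [b [_ /andP[ax xb] _ sab onto]]] := @cylinder m x (survivors_itv Sx)
  (fun n _ => Sx n).
have stays_le i t : (i <= m)%N -> a <= t <= b -> stays_for i t.
  by move=> im /sab st n ni; apply: st; exact: leq_trans im.
have ua : u < a.
  rewrite ltNge; apply/negP => au; apply: nu; apply: stays_le; first exact: leq_maxl.
  by rewrite au (le_trans ux).
have bv : b < v.
  rewrite ltNge; apply/negP => vb; apply: nv; apply: stays_le; first exact: leq_maxr.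
  by rewrite vb andbT (le_trans ax).
have pre y : survivors y -> exists s, [/\ survivors s, `|s - x| < eps & iter m g s = y].
  move=> Sy; have : `[l, r]%classic y by rewrite /= in_itv /=; exact: survivors_itv.
  rewrite -onto => -[s /=]; rewrite in_itv /= => sI gs; exists s; split=> //.
    move=> n; have [nm|mn] := ltnP n m; first exact: sab.
    by rewrite -(subnK mn) iterD gs; exact: Sy.
  by case/andP: sI => as_ sb; rewrite ltr_norml; apply/andP; split; lra.
have [s [Ss close_s gs]] := pre _ Se.
have [sx|sx] := eqVneq s x; last by exists s.
have [t [St close_t gt]] := pre _ survivors_r.
exists t; split=> //.
by apply: contraNneq er => tx; rewrite -gs sx -tx gt.
Qed.

End IntervalDynamics.

(** * Ellipses with foci -1 and 1 *)

Section Ellipse.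
Context {R : realType}.
Implicit Types (a b nu u : R[i]).

Definition on_segment nu : Prop :=
  complex.Im nu = 0 /\ -1 <= complex.Re nu <= 1.

Definition ell nu : R := cabs (nu - 1) + cabs (nu + 1).

Definition joukowski u : R[i] := (u + u^-1) / 2.

Lemma ell_ge2 nu : 2 <= ell nu.
Proof.
have := cabsD (1 - nu) (nu + 1); rewrite cabsB -/(ell nu).
have -> : 1 - nu + (nu + 1) = 2 by ring.
by rewrite cabs_nat.
Qed.

Lemma cabs_le_ell nu : 2 * cabs nu <= ell nu.
Proof.
have := cabsD (nu - 1) (nu + 1); rewrite -/(ell nu).
have -> : nu - 1 + (nu + 1) = 2 * nu by ring.
by rewrite cabsM cabs_nat.
Qed.

Lemma ell_le_cabs nu : ell nu <= 2 * cabs nu + 2.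
Proof.
by have := cabsD nu (-1); have := cabsD nu 1; rewrite cabsN cabs1 /ell; lra.
Qed.

Lemma ell_real (x : R) : -1 <= x <= 1 -> ell x%:C = 2.
Proof.
move=> /andP[x1 x2]; rewrite /ell -(rmorph1 (real_complex R)) -rmorphB -rmorphD /=.
by rewrite !cabs_real ler0_norm ?ger0_norm; lra.
Qed.

Lemma ell_joukowski u : u != 0 -> ell (joukowski u) = cabs u + (cabs u)^-1.
Proof.
move=> u0; have cu0 : cabs u != 0 by rewrite cabs_eq0.
have half v : cabs (v ^+ 2 / (2 * u)) = cabs v ^+ 2 / (2 * cabs u).
  by rewrite cabsM cabsV expr2 !cabsM cabs_nat -expr2.
rewrite /ell /joukowski.
have -> : (u + u^-1) / 2 - 1 = (u - 1) ^+ 2 / (2 * u) by field.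
have -> : (u + u^-1) / 2 + 1 = (u + 1) ^+ 2 / (2 * u) by field.
rewrite !half -mulrDl.
have -> : cabs (u - 1) ^+ 2 + cabs (u + 1) ^+ 2 = 2 * (cabs u ^+ 2 + 1).
  by rewrite !sqr_cabs !raddfB !raddfD /=; ring.
by field.
Qed.

Lemma joukowski_surj nu : exists2 u, 1 <= cabs u & nu = joukowski u.
Proof.
pose r := sqrtc (nu ^+ 2 - 1).
have prod1 : (nu + r) * (nu - r) = 1.
  by rewrite mulrC -subr_sqr sqr_sqrtc; ring.
have sol u : u * (2 * nu - u) = 1 -> nu = joukowski u.
  move=> uE; have u0 : u != 0.
    by apply: contra_eq_neq uE => ->; rewrite mul0r eq_sym oner_eq0.
  have uV : u^-1 = 2 * nu - u by apply: (mulfI u0); rewrite divff.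
  by rewrite /joukowski uV; field.
have [big|small] := leP 1 (cabs (nu + r)).
  by exists (nu + r) => //; apply: sol; rewrite -[RHS]prod1; ring.
exists (nu - r); last by apply: sol; rewrite -[RHS]prod1; ring.
have := congr1 (@cabs R) prod1; rewrite cabsM cabs1.
have := cabs_ge0 (nu + r); have := cabs_ge0 (nu - r); nra.
Qed.

Lemma joukowski_unit u : cabs u = 1 -> on_segment (joukowski u).
Proof.
move=> u1; have nuE : joukowski u = (complex.Re u)%:C.
  have ReImV : u^-1 = (complex.Re u) +i* (- complex.Im u).
    by apply/eqP; rewrite eq_complex Re_inv Im_inv u1 expr1n !divr1 !eqxx.
  have sumE : u + u^-1 = 2 * (complex.Re u)%:C.
    rewrite ReImV mulr_natl -rmorphMn; case: (u) => x y.
    by apply/eqP; rewrite eq_complex /= subrr mulr2n !eqxx.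
  by rewrite /joukowski sumE mulrAC divff ?mul1r// pnatr_eq0.
rewrite nuE /on_segment /=; split=> //.
by have := normRe_le_cabs u; rewrite u1 ler_norml.
Qed.

Lemma joukowskiP nu : ~ on_segment nu ->
  exists2 u, 1 < cabs u & nu = joukowski u.
Proof.
have [u u1 ->] := joukowski_surj nu => nseg; exists u => //.
by rewrite lt_neqAle u1 andbT eq_sym; apply/eqP => /joukowski_unit.
Qed.

Lemma ell_joukowski_gt2 u : 1 < cabs u -> 2 < ell (joukowski u).
Proof.
move=> u1; have u0 : 0 < cabs u by exact: lt_trans u1.
rewrite ell_joukowski -?cabs_gt0//.
have -> : cabs u + (cabs u)^-1 = (cabs u ^+ 2 + 1) / cabs u.
  by field; rewrite gt_eqF.
by rewrite ltr_pdivlMr//; nra.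
Qed.

Lemma ell_gt2 nu : ~ on_segment nu -> 2 < ell nu.
Proof. by move=> /joukowskiP[u u1 ->]; exact: ell_joukowski_gt2. Qed.

Lemma ell_on_segment nu : on_segment nu -> ell nu = 2.
Proof.
move=> [Im0 Re1]; rewrite -(ell_real Re1); congr ell.
by apply/eqP; rewrite eq_complex /= Im0 !eqxx.
Qed.

(* [AB |a / A + b / B|^2 = (A + B)^2 - |a - b|^2] for A = |a| and B = |b|. *)
Lemma sqr_cabsB_le a b :
  (complex.Re a * cabs b + complex.Re b * cabs a) ^+ 2 <=
  cabs a * cabs b * ((cabs a + cabs b) ^+ 2 - cabs (a - b) ^+ 2).
Proof.
have sa := sqr_cabs a; have sb := sqr_cabs b.
rewrite [cabs (a - b) ^+ 2]sqr_cabs !raddfB /=.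
move: (cabs a) (cabs b) sa sb => A B.
move: (complex.Re a) (complex.Im a) (complex.Re b) (complex.Im b).
move=> a1 a2 b1 b2 sa sb; rewrite -subr_ge0.
suff -> : A * B * ((A + B) ^+ 2 - ((a1 - b1) ^+ 2 + (a2 - b2) ^+ 2)) -
    (a1 * B + b1 * A) ^+ 2 = (a2 * B + b2 * A) ^+ 2 by exact: sqr_ge0.
apply/eqP; rewrite -subr_eq0; apply/eqP.
transitivity ((A * B + B ^+ 2) * (A ^+ 2 - (a1 ^+ 2 + a2 ^+ 2)) +
  (A * B + A ^+ 2) * (B ^+ 2 - (b1 ^+ 2 + b2 ^+ 2))); first by ring.
by rewrite sa sb !subrr !mulr0 addr0.
Qed.

Lemma disc_dist_lt a b (chi : R) : 0 < chi ->
  cabs a ^+ 2 + 1 < 2 * chi * complex.Re a ->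
  cabs b ^+ 2 + 1 <= 2 * chi * complex.Re b ->
  (cabs a + cabs b) ^+ 2 <
  chi ^+ 2 * ((cabs a + cabs b) ^+ 2 - cabs (a - b) ^+ 2).
Proof.
move=> chi0 ha hb.
have A0 : 0 < cabs a by have := Re_le_cabs a; have := sqr_ge0 (cabs a); nra.
have B0 : 0 < cabs b by have := Re_le_cabs b; have := sqr_ge0 (cabs b); nra.
have := sqr_cabsB_le a b; move: (_ ^+ 2 - cabs (a - b) ^+ 2) => T.
move: (cabs a) (cabs b) (complex.Re a) (complex.Re b) A0 B0 ha hb.
move=> A B p q A0 B0 ha hb hT.
have AB0 : 0 < A * B by exact: mulr_gt0.
have sum_lt : (A + B) * (A * B + 1) < 2 * chi * (p * B + q * A).
  have : (A ^+ 2 + 1) * B < 2 * chi * p * B by rewrite ltr_pM2r.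
  have : (B ^+ 2 + 1) * A <= 2 * chi * q * A by rewrite ler_pM2r.
  nra.
have sqr_lt : ((A + B) * (A * B + 1)) ^+ 2 < 4 * chi ^+ 2 * (A * B * T).
  apply: (@lt_le_trans _ _ ((2 * chi * (p * B + q * A)) ^+ 2)).
    have lhs0 : 0 <= (A + B) * (A * B + 1) by rewrite mulr_ge0; nra.
    by rewrite ltr_pXn2r ?nnegrE// (le_trans lhs0)// ltW.
  by rewrite exprMn (exprMn 2) -natrX ler_wpM2l// mulr_ge0// sqr_ge0.
rewrite -(ltr_pM2l (_ : 0 < 4 * (A * B))) ?mulr_gt0//.
have -> : 4 * (A * B) * (chi ^+ 2 * T) = 4 * chi ^+ 2 * (A * B * T) by ring.
apply: le_lt_trans sqr_lt; rewrite exprMn mulrC ler_wpM2l ?sqr_ge0//.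
by have := sqr_ge0 (A * B - 1); nra.
Qed.

Lemma ell_ratio a b : a != b ->
  ell ((a + b) / (a - b)) = 2 * (cabs a + cabs b) / cabs (a - b).
Proof.
rewrite -subr_eq0 => ab; rewrite /ell.
have -> : (a + b) / (a - b) - 1 = 2 * b / (a - b) by field.
have -> : (a + b) / (a - b) + 1 = 2 * a / (a - b) by field.
by rewrite !cabsM !cabsV cabs_nat -mulrDl -mulrDr [cabs b + _]addrC.
Qed.

End Ellipse.

(** * Stieltjes transforms of measures on [-1, 1] *)

Section WeightedMean.
Context {R : realType} {I : eqType}.
Variables (s : seq I) (w : I -> R).
Hypothesis w_ge0 : forall k, 0 <= w k.
Hypothesis w_sum : \sum_(k <- s) w k = 1.

Lemma weighted_variance (y : I -> R) :
  \sum_(k <- s) w k * (y k - \sum_(k <- s) w k * y k) ^+ 2 =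
  \sum_(k <- s) w k * y k ^+ 2 - (\sum_(k <- s) w k * y k) ^+ 2.
Proof.
set m := \sum_(k <- s) w k * y k.
transitivity (\sum_(k <- s) (w k * y k ^+ 2 - 2 * m * (w k * y k) +
    m ^+ 2 * w k)).
  by apply: eq_bigr => k _; ring.
rewrite !big_split /= sumrN -!mulr_sumr w_sum -/m.
by ring.
Qed.

Lemma sqr_mean_le (y : I -> R) :
  (\sum_(k <- s) w k * y k) ^+ 2 <= \sum_(k <- s) w k * y k ^+ 2.
Proof.
rewrite -subr_ge0 -weighted_variance; apply: sumr_ge0 => k _.
by rewrite mulr_ge0 ?sqr_ge0.
Qed.

Lemma sqr_mean_lt (y : I -> R) j k : j \in s -> k \in s ->
  0 < w j -> 0 < w k -> y j != y k ->
  (\sum_(k <- s) w k * y k) ^+ 2 < \sum_(k <- s) w k * y k ^+ 2.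
Proof.
move=> js ks wj wk yjk; rewrite lt_neqAle sqr_mean_le andbT; apply/eqP => eq_mean.
have /eqP := weighted_variance y; rewrite eq_mean subrr psumr_eq0; last first.
  by move=> i _; rewrite mulr_ge0 ?sqr_ge0.
move=> /allP var0; move: yjk.
have at_mean i : i \in s -> 0 < w i -> y i = \sum_(k <- s) w k * y k.
  move=> /var0 /= + wi; rewrite mulf_eq0 gt_eqF//= sqrf_eq0 subr_eq0.
  by move=> /eqP.
by rewrite (at_mean j)// (at_mean k)// eqxx.
Qed.

Lemma Re_mean (y : I -> R[i]) : complex.Re (\sum_(k <- s) (w k)%:C * y k) =
  \sum_(k <- s) w k * complex.Re (y k).
Proof.
by rewrite raddf_sum /=; apply: eq_bigr => k _; rewrite Re_mul /= mul0r subr0.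
Qed.

Lemma Im_mean (y : I -> R[i]) : complex.Im (\sum_(k <- s) (w k)%:C * y k) =
  \sum_(k <- s) w k * complex.Im (y k).
Proof.
by rewrite raddf_sum /=; apply: eq_bigr => k _; rewrite Im_mul /= mul0r addr0.
Qed.

Let mean_sqr_cabs (y : I -> R[i]) : \sum_(k <- s) w k * cabs (y k) ^+ 2 =
  \sum_(k <- s) w k * complex.Re (y k) ^+ 2 +
  \sum_(k <- s) w k * complex.Im (y k) ^+ 2.
Proof.
by rewrite -big_split; apply: eq_bigr => k _; rewrite sqr_cabs mulrDr.
Qed.

Lemma cabs_mean_le (y : I -> R[i]) :
  cabs (\sum_(k <- s) (w k)%:C * y k) ^+ 2 <= \sum_(k <- s) w k * cabs (y k) ^+ 2.
Proof. by rewrite sqr_cabs Re_mean Im_mean mean_sqr_cabs lerD ?sqr_mean_le. Qed.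

Lemma cabs_mean_lt (y : I -> R[i]) j k : j \in s -> k \in s ->
  0 < w j -> 0 < w k -> y j != y k ->
  cabs (\sum_(k <- s) (w k)%:C * y k) ^+ 2 < \sum_(k <- s) w k * cabs (y k) ^+ 2.
Proof.
move=> js ks wj wk; rewrite eq_complex negb_and sqr_cabs Re_mean Im_mean.
rewrite mean_sqr_cabs => /orP[] yjk.
  by apply: ltr_leD (sqr_mean_le _); exact: sqr_mean_lt yjk.
by apply: ler_ltD (sqr_mean_le _) _; exact: sqr_mean_lt yjk.
Qed.

End WeightedMean.

Section Stieltjes.
Context {R : realType}.
Implicit Types (s : seq R) (w alpha beta : R -> R) (nu u : R[i]) (x k : R).

Definition stieltjes s w x : R := \sum_(k <- s) w k / (x - k).

Definition cstieltjes s w nu : R[i] := \sum_(k <- s) (w k)%:C / (nu - k%:C).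

Record weights s w : Prop := Weights {
  weights_itv : forall k, k \in s -> -1 <= k <= 1;
  weights_ge0 : forall k, 0 <= w k;
  weights_sum : \sum_(k <- s) w k = 1 }.

Lemma off_segment_neq s w nu k : weights s w -> ~ on_segment nu -> k \in s ->
  nu != k%:C.
Proof.
move=> W nseg ks; apply/eqP => nuE; apply: nseg; rewrite nuE; split=> //=.
exact: weights_itv W _ ks.
Qed.

Section CauchyDisc.
Variable u : R[i].
Hypothesis u_gt1 : 1 < cabs u.

Let nu := joukowski u.
Let root : R[i] := (u - u^-1) / 2.
Let chi : R := (cabs u ^+ 2 + 1) / (cabs u ^+ 2 - 1).

Let sqr_gt1 : 1 < cabs u ^+ 2. Proof. by rewrite exprn_egt1. Qed.

Let chi_gt0 : 0 < chi.
Proof. by rewrite divr_gt0 ?subr_gt0//; move: sqr_gt1; lra. Qed.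

Let u_neq0 : u != 0. Proof. by rewrite -cabs_gt0 (lt_trans _ u_gt1). Qed.

Let root_neq0 : root != 0.
Proof.
rewrite mulf_neq0 ?invr_eq0 ?pnatr_eq0// subr_eq0; apply/eqP.
move=> /(congr1 (@cabs R)); rewrite cabsV => uV.
have := invf_lt1 (lt_trans ltr01 u_gt1); rewrite u_gt1 -uV => /lt_trans.
by move=> /(_ _ u_gt1); rewrite ltxx.
Qed.

Let disc_identity k : cabs root ^+ 2 + cabs (nu - k%:C) ^+ 2 + (1 - k ^+ 2) =
  2 * chi * (complex.Re root * complex.Re (nu - k%:C) +
             complex.Im root * complex.Im (nu - k%:C)).
Proof.
have rho0 : cabs u ^+ 2 != 0 by rewrite gt_eqF// (lt_trans _ sqr_gt1).
have rho1 : cabs u ^+ 2 - 1 != 0 by rewrite gt_eqF// subr_gt0.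
have halfE (a : R[i]) : a / 2 = (2^-1 : R)%:C * a.
  by rewrite mulrC fmorphV rmorph_nat.
rewrite !sqr_cabs /nu /root /joukowski !halfE !raddfB /= !Re_mul !Im_mul /=.
rewrite !raddfB !raddfD /= Re_inv Im_inv /chi.
have := sqr_cabs u; move: (cabs u ^+ 2) rho0 rho1 => rho rho0 rho1.
move: (complex.Re u) (complex.Im u) => x y rhoE.
transitivity ((x ^+ 2 + y ^+ 2) * (1 + rho ^- 2) / 2 - k * x * (1 + rho^-1) + 1).
  by field.
transitivity ((rho + 1) / (rho - 1) *
    ((x ^+ 2 + y ^+ 2) * (1 - rho ^- 2) / 2 - k * x * (1 - rho^-1))).
  by rewrite -rhoE; field; rewrite rho0 rho1.
by field; rewrite rho0 rho1.
Qed.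

(* Hence [root / (nu - k)] lies in the closed disc |a|^2 + 1 <= 2 chi Re a for
   every k in [-1, 1]. *)
Lemma cauchy_kernel k : nu != k%:C ->
  cabs (root / (nu - k%:C)) ^+ 2 + 1 + (1 - k ^+ 2) / cabs (nu - k%:C) ^+ 2 =
  2 * chi * complex.Re (root / (nu - k%:C)).
Proof.
rewrite -subr_eq0 -cabs_eq0 => d0.
transitivity ((cabs root ^+ 2 + cabs (nu - k%:C) ^+ 2 + (1 - k ^+ 2)) /
    cabs (nu - k%:C) ^+ 2).
  by rewrite cabsM cabsV; field.
by rewrite disc_identity Re_mul Re_inv Im_inv; field.
Qed.

Let off_segment : ~ on_segment nu.
Proof.
move=> /ell_on_segment nu2; have := ell_joukowski_gt2 u_gt1.
by rewrite -/nu nu2 ltxx.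
Qed.

Let rootM s w : root * cstieltjes s w nu =
  \sum_(k <- s) (w k)%:C * (root / (nu - k%:C)).
Proof. by rewrite mulr_sumr; apply: eq_bigr => k _; rewrite mulrCA. Qed.

Let mean_kernel_le s w : weights s w ->
  \sum_(k <- s) w k * cabs (root / (nu - k%:C)) ^+ 2 + 1 <=
  2 * chi * complex.Re (root * cstieltjes s w nu).
Proof.
move=> W; rewrite rootM Re_mean mulr_sumr -{1}(weights_sum W) -big_split /=.
rewrite big_seq [leRHS]big_seq; apply: ler_sum => k ks.
rewrite [leRHS]mulrCA -cauchy_kernel ?(off_segment_neq W off_segment)//.
rewrite -[X in _ + X]mulr1 -mulrDr ler_wpM2l ?(weights_ge0 W)// lerDl.
rewrite divr_ge0 ?sqr_ge0// subr_ge0.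
by have /andP[? ?] := weights_itv W ks; nra.
Qed.

Let cstieltjes_disc s w : weights s w ->
  cabs (root * cstieltjes s w nu) ^+ 2 + 1 <=
  2 * chi * complex.Re (root * cstieltjes s w nu).
Proof.
move=> W; apply: le_trans (mean_kernel_le W); rewrite lerD2r rootM.
by apply: cabs_mean_le; [exact: weights_ge0 W | exact: weights_sum W].
Qed.

Let cstieltjes_disc_strict s w j k : weights s w -> j \in s -> k \in s ->
  j != k -> 0 < w j -> 0 < w k ->
  cabs (root * cstieltjes s w nu) ^+ 2 + 1 <
  2 * chi * complex.Re (root * cstieltjes s w nu).
Proof.
move=> W js ks jk wj wk; apply: lt_le_trans (mean_kernel_le W).
rewrite ltrD2r rootM.
apply: (cabs_mean_lt (weights_ge0 W) (weights_sum W) js ks wj wk).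
by apply: contra_neq jk => /(mulfI root_neq0)/invr_inj/addrI/oppr_inj/complexI.
Qed.

Let sqr_ell : (chi ^+ 2 - 1) * ell nu ^+ 2 = 4 * chi ^+ 2.
Proof.
rewrite ell_joukowski// /chi; field; rewrite cabs_eq0 u_neq0 gt_eqF//.
by rewrite subr_gt0.
Qed.

Lemma cstieltjes_joukowski_neq0 s w : weights s w -> cstieltjes s w nu != 0.
Proof.
move=> /cstieltjes_disc; apply: contraTneq => ->.
by rewrite mulr0 cabs0 expr0n /= mulr0 add0r -ltNge ltr01.
Qed.

Lemma ell_cstieltjes_joukowski_lt s alpha beta j k :
  weights s alpha -> weights s beta -> j \in s -> k \in s -> j != k ->
  0 < alpha j -> 0 < alpha k ->
  let f := cstieltjes s alpha nu in let h := cstieltjes s beta nu in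
  f != h -> ell nu < ell ((f + h) / (f - h)).
Proof.
move=> Wa Wb js ks jk aj ak f h fh.
have := disc_dist_lt chi_gt0 (cstieltjes_disc_strict Wa js ks jk aj ak)
  (cstieltjes_disc Wb).
have S0 : 0 < cabs f + cabs h.
  by rewrite addr_gt0// cabs_gt0 cstieltjes_joukowski_neq0.
have D0 : 0 < cabs (f - h) by rewrite cabs_gt0 subr_eq0.
have r0 : 0 < cabs root by rewrite cabs_gt0.
rewrite ell_ratio// ltr_pdivlMr// -mulrBr !(cabsM root) -mulrDr -/f -/h.
move: (cabs root) (cabs f + cabs h) (cabs (f - h)) r0 S0 D0 => r S D r0 S0 D0.
rewrite !(exprMn 2 r) -mulrBr [ltRHS]mulrCA ltr_pM2l ?exprn_gt0// => SD.
have ell0 : 0 < ell nu by have := ell_ge2 nu; lra.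
rewrite -(@ltr_pXn2r _ 2) ?nnegrE ?mulr_ge0 ?(ltW ell0) ?(ltW D0) ?(ltW S0)//.
rewrite !exprMn -natrX -(ltr_pM2l (exprn_gt0 2 chi_gt0)).
have -> : chi ^+ 2 * ((2 ^ 2)%:R * S ^+ 2) = (4 * chi ^+ 2) * S ^+ 2 by ring.
rewrite -sqr_ell [ltLHS]mulrCA [(chi ^+ 2 - 1) * _]mulrC -[ltRHS]mulrA.
rewrite ltr_pM2l ?exprn_gt0//.
by move: SD; rewrite mulrBr mulrBl mul1r; lra.
Qed.

End CauchyDisc.

Lemma cstieltjes_neq0 s w nu : weights s w -> ~ on_segment nu ->
  cstieltjes s w nu != 0.
Proof.
by move=> W /joukowskiP[u u1 ->]; exact: cstieltjes_joukowski_neq0.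
Qed.

Record stieltjes_pair s alpha beta : Prop := StieltjesPair {
  pair_alpha : weights s alpha;
  pair_beta : weights s beta;
  pair_uniq : uniq s;
  pair_support : forall k, k \in s -> 0 < alpha k + beta k;
  pair_mean : \sum_(k <- s) alpha k * k = \sum_(k <- s) beta k * k;
  pair_one : 1 \in s;
  pair_alpha1 : 0 < alpha 1;
  pair_beta1 : beta 1 = 0 }.

(* If alpha were the point mass at 1, the common mean would be 1. *)
Lemma pair_alpha_other s alpha beta : stieltjes_pair s alpha beta ->
  exists k, [/\ k \in s, k != 1 & 0 < alpha k].
Proof.
move=> sp; have [sI b0 b1] := pair_beta sp.
apply: contrapT => no_other.
have alpha0 k : k \in s -> k != 1 -> alpha k = 0.
  move=> ks k1; apply/eqP; rewrite eq_le (weights_ge0 (pair_alpha sp)) andbT leNgt.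
  by apply/negP => ak; apply: no_other; exists k.
have : \sum_(k <- s) alpha k * (1 - k) = 0.
  rewrite big_seq big1// => k ks; have [->|k1] := eqVneq k 1.
    by rewrite subrr mulr0.
  by rewrite alpha0// mul0r.
have -> : \sum_(k <- s) alpha k * (1 - k) = \sum_(k <- s) beta k * (1 - k).
  under eq_bigr do rewrite mulrBr mulr1.
  under [RHS]eq_bigr do rewrite mulrBr mulr1.
  by rewrite !sumrB (weights_sum (pair_alpha sp)) b1 (pair_mean sp).
move=> /eqP; rewrite big_seq psumr_eq0; last first.
  by move=> k ks; rewrite mulr_ge0 ?b0// subr_ge0; have /andP[] := sI _ ks.
move=> /allP beta_off1; have : \sum_(k <- s) beta k = 0.
  rewrite big_seq big1// => k ks; have := beta_off1 k ks; rewrite ks /= mulf_eq0.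
  by rewrite subr_eq0 => /orP[/eqP//|/eqP k1]; rewrite -k1 (pair_beta1 sp).
by rewrite b1 => /eqP; rewrite oner_eq0.
Qed.

Lemma ell_pair_lt s alpha beta nu : stieltjes_pair s alpha beta ->
  ~ on_segment nu ->
  let f := cstieltjes s alpha nu in let h := cstieltjes s beta nu in
  f != h -> ell nu < ell ((f + h) / (f - h)).
Proof.
move=> sp /joukowskiP[u u1 ->]; have [k [ks k1 ak]] := pair_alpha_other sp.
by apply: (ell_cstieltjes_joukowski_lt u1 (pair_alpha sp) (pair_beta sp)
  (pair_one sp) ks _ (pair_alpha1 sp) ak); rewrite eq_sym.
Qed.

End Stieltjes.

Section PoleNumerators.
Context {R : realType}.
Implicit Types (s : seq R) (w : R -> R) (x k : R) (nu : R[i]).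

Definition pole_poly s : {poly R} := \prod_(k <- s) ('X - k%:P).

Definition pole_cofactor s k : {poly R} := \prod_(j <- s | j != k) ('X - j%:P).

Definition stieltjes_num s w : {poly R} := \sum_(k <- s) w k *: pole_cofactor s k.

Lemma pole_polyE s k : uniq s -> k \in s ->
  pole_poly s = ('X - k%:P) * pole_cofactor s k.
Proof. by move=> s_uniq ks; rewrite /pole_poly (bigD1_seq k). Qed.

Lemma pole_poly_neq0 s x : x \notin s -> (pole_poly s).[x] != 0.
Proof.
move=> xs; rewrite /pole_poly horner_prod prodf_seq_neq0; apply/allP => k ks.
by rewrite /= hornerXsubC subr_eq0; apply: contraNneq xs => ->.
Qed.

Lemma pole_cofactor_neq0 s k : (pole_cofactor s k).[k] != 0.
Proof.
rewrite /pole_cofactor horner_prod prodf_seq_neq0; apply/allP => j js.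
by apply/implyP => jk; rewrite hornerXsubC subr_eq0 eq_sym.
Qed.

Lemma pole_cofactor_eq0 s j k : j \in s -> j != k -> (pole_cofactor s k).[j] = 0.
Proof.
move=> js jk; rewrite /pole_cofactor horner_prod; apply/eqP.
rewrite prodf_seq_eq0; apply/hasP; exists j => //.
by rewrite jk hornerXsubC subrr eqxx.
Qed.

Lemma size_pole_cofactor s k : uniq s -> k \in s ->
  size (pole_cofactor s k) = size s.
Proof.
move=> s_uniq ks; rewrite /pole_cofactor -big_filter size_prod_XsubC size_filter.
rewrite -(count_predC (predC1 k) s) -addn1; congr (_ + _)%N.
rewrite (eq_count (a2 := pred1 k)) ?count_uniq_mem ?ks// => j /=.
by rewrite negbK.
Qed.

Lemma size_stieltjes_num s w : uniq s -> (size (stieltjes_num s w) <= size s)%N.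
Proof.
move=> s_uniq; apply: leq_trans (size_sum _ _ _) _; apply/bigmax_leqP_seq => k ks _.
by rewrite (leq_trans (size_scale_leq _ _))// size_pole_cofactor.
Qed.

Lemma coef_stieltjes_num s w : uniq s ->
  (stieltjes_num s w)`_(size s).-1 = \sum_(k <- s) w k.
Proof.
move=> s_uniq; rewrite coef_sum big_seq [RHS]big_seq; apply: eq_bigr => k ks.
rewrite coefZ -(size_pole_cofactor s_uniq ks) -[nth _ _ _]/(lead_coef _).
by rewrite /pole_cofactor -big_filter (monicP (monic_prod_XsubC _ _ _)) mulr1.
Qed.

Lemma stieltjes_numB s w w' :
  stieltjes_num s w - stieltjes_num s w' = stieltjes_num s (fun k => w k - w' k).
Proof.
by rewrite /stieltjes_num -sumrB; apply: eq_bigr => k _; rewrite scalerBl.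
Qed.

Lemma mulX_stieltjes_num s w : uniq s -> \sum_(k <- s) w k = 0 ->
  'X * stieltjes_num s w = stieltjes_num s (fun k => w k * k).
Proof.
move=> s_uniq w0; rewrite -[RHS]addr0 -(scale0r (pole_poly s)) -w0 /stieltjes_num.
rewrite scaler_suml mulr_sumr -big_split /= big_seq [RHS]big_seq.
apply: eq_bigr => k ks; rewrite (pole_polyE s_uniq ks) -!mul_polyC polyCM.
by ring.
Qed.

Lemma horner_stieltjes_num s w x : uniq s -> x \notin s ->
  (stieltjes_num s w).[x] = (pole_poly s).[x] * stieltjes s w x.
Proof.
move=> s_uniq xs; rewrite horner_sum mulr_sumr big_seq [RHS]big_seq.
apply: eq_bigr => k ks; rewrite hornerZ (pole_polyE s_uniq ks) hornerM hornerXsubC.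
have xk : x - k != 0 by rewrite subr_eq0; apply: contraNneq xs => ->.
by field.
Qed.

Lemma horner_stieltjes_num_pole s w k : uniq s -> k \in s ->
  (stieltjes_num s w).[k] = w k * (pole_cofactor s k).[k].
Proof.
move=> s_uniq ks; rewrite horner_sum (bigD1_seq k)//= hornerZ big1 ?addr0//.
by move=> j jk; rewrite hornerZ pole_cofactor_eq0 ?mulr0// eq_sym.
Qed.

Lemma horner_map_stieltjes_num s w nu : uniq s ->
  (forall k, k \in s -> nu != k%:C) ->
  (map_poly (real_complex R) (stieltjes_num s w)).[nu] =
  (map_poly (real_complex R) (pole_poly s)).[nu] * cstieltjes s w nu.
Proof.
move=> s_uniq ns; rewrite rmorph_sum /= horner_sum mulr_sumr.
rewrite big_seq [RHS]big_seq; apply: eq_bigr => k ks.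
rewrite map_polyZ hornerZ (pole_polyE s_uniq ks) rmorphM hornerM /=.
rewrite map_polyXsubC hornerXsubC.
have nk : nu - k%:C != 0 by rewrite subr_eq0 ns.
by field.
Qed.

Lemma map_pole_poly_neq0 s nu : (forall k, k \in s -> nu != k%:C) ->
  (map_poly (real_complex R) (pole_poly s)).[nu] != 0.
Proof.
move=> ns; rewrite /pole_poly rmorph_prod /= horner_prod prodf_seq_neq0.
by apply/allP => k ks; rewrite /= map_polyXsubC hornerXsubC subr_eq0 ns.
Qed.

End PoleNumerators.

(** * The map (f + h) / (f - h) off the segment *)

Lemma lyapunov_uniform {R : realType} {T : topologicalType} (G : T -> T)
    (V : T -> R) (v1 v2 : R) :
  compact [set: T] -> continuous G -> continuous V ->
  (forall z, V z <= v1 -> V (G z) <= V z) ->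
  (forall z, v2 <= V z <= v1 -> V (G z) < V z) ->
  exists N, forall n z, (N <= n)%N -> V z <= v1 -> V (iter n G z) < v2.
Proof.
move=> cT cG cV V_le V_lt; pose K := V @^-1` `[v2, v1]%classic.
have iter_le n z : V z <= v1 -> V (iter n G z) <= v1.
  by move=> Vz; elim: n => //= n IH; exact: le_trans (V_le _ IH) IH.
have [K0|/set0P/negP/negPn/eqP K0] := pselect (K !=set0); last first.
  exists 0%N => n z _ /(iter_le n) Vn; rewrite ltNge; apply/negP => vV.
  suff : K (iter n G z) by rewrite K0.
  by rewrite /K /= in_itv /= vV.
have cK : compact K.
  apply: (subclosed_compact _ cT) => //; apply: preimage_closed => [z _|].
    exact: cV.
  exact: interval_closed.
have cdrop : {within K, continuous (fun z => V z - V (G z))}.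
  apply: continuous_subspaceT => z; apply: cvgB; first exact: cV.
  by apply: continuous_comp; [exact: cG | exact: cV].
have [c cK' minc] := compact_EVT_min K0 cK cdrop.
have d0 : 0 < V c - V (G c).
  by rewrite subr_gt0 V_lt//; move: cK'; rewrite inE /K /= in_itv.
set d := V c - V (G c) in minc d0.
have drop n z : V z <= v1 -> V (iter n G z) < v2 \/ V (iter n G z) <= v1 - n%:R * d.
  move=> Vz; elim: n => [|n [IH|IH]]; first by rewrite mul0r subr0; right.
    by left; exact: le_lt_trans (V_le _ (iter_le n z Vz)) IH.
  have [vV|] := leP v2 (V (iter n G z)); last first.
    by left; exact: le_lt_trans (V_le _ (iter_le n z Vz)) _.
  right; have /minc : iter n G z \in K by rewrite inE /K /= in_itv /= vV iter_le.
  by rewrite -natr1 mulrDl mul1r /=; lra.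
exists (Num.bound `|(v1 - v2) / d|).+1 => n z Nn /(drop n)[//|Vn].
apply: le_lt_trans Vn _; rewrite ltrBlDl -ltrBlDr -ltr_pdivrMr//.
apply: le_lt_trans (ler_norm _) _; apply: lt_le_trans (archi_boundP _) _ => //.
by rewrite ler_nat ltnW.
Qed.

Section SegmentPotential.
Context {R : realType}.
Local Notation sphere := (sphere R).
Implicit Types (z : sphere) (nu : R[i]) (v : R).

Definition unit_segment : set sphere :=
  [set z | exists2 y : R, -1 <= y <= 1 & z = Some y%:C].

(* A potential on the sphere, with value 1/2 on the segment and 0 at infinity,
   whose level sets are the ellipses with foci -1 and 1. *)
Definition ellV z : R := if z is Some nu then (ell nu)^-1 else 0.

Lemma continuous_real_point : continuous (fun x : R => Some x%:C : sphere).
Proof. by move=> x A nA; exact: (@continuous_of_real R x (Some @^-1` A) nA). Qed.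

Lemma unit_segmentP nu : unit_segment (Some nu) <-> on_segment nu.
Proof.
split=> [[y yI [->]]//|[Im0 ReI]].
by exists (complex.Re nu) => //; congr Some; apply/eqP; rewrite eq_complex /= Im0 !eqxx.
Qed.

Let ell_gt0 nu : 0 < ell nu.
Proof. exact: lt_le_trans (ell_ge2 nu). Qed.

Lemma ellV_segment z : unit_segment z -> ellV z = 2^-1.
Proof. by move=> [y yI ->] /=; rewrite ell_real. Qed.

Lemma ellV_off_segment z : ~ unit_segment z -> ellV z < 2^-1.
Proof.
case: z => [nu /unit_segmentP/ell_gt2 nu2|_ /=]; last by rewrite invr_gt0.
by rewrite ltf_pV2 ?posrE.
Qed.

Lemma continuous_ellV : continuous ellV.
Proof.
move=> [nu|] A nA.
  have cell : (fun a : R[i]^o => (ell a)^-1) @ (nu : R[i]^o) --> (ell nu)^-1.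
    apply: (@cvgV _ _ (nbhs (nu : R[i]^o)) _ (@ell R)); first by rewrite gt_eqF.
    apply/(@cvgrPdist_lt _ _ _ (nbhs (nu : R[i]^o))) => e e0.
    apply/nbhs_complexP; exists (e / 2) => [|b bnu]; first exact: divr_gt0.
    have dist (c : R[i]) : `|cabs (nu + c) - cabs (b + c)| < e / 2.
      apply: le_lt_trans (cabs_dist _ _) _; rewrite cabsB.
      by rewrite opprD addrACA subrr addr0.
    rewrite /ell opprD addrACA [e]splitr; apply: le_lt_trans (ler_normD _ _) _.
    by rewrite ltrD.
  exact: cell nA.
move: nA => /nbhs_ballP[e /= e0 eA]; apply/nbhs_infty; split.
  exact/eA/ballxx.
exists e^-1 => a ea; apply: eA; rewrite /ball /= sub0r normrN.
have a0 : 0 < cabs a by rewrite (lt_trans _ ea) ?invr_gt0.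
rewrite ger0_norm ?invr_ge0 ?(ltW (ell_gt0 a))// -[e]invrK ltf_pV2 ?posrE ?invr_gt0//.
by apply: lt_le_trans ea _; have := cabs_le_ell a; lra.
Qed.

Lemma unit_segment_closed : closed unit_segment.
Proof.
have -> : unit_segment = ellV @^-1` [set v | 2^-1 <= v].
  apply/seteqP; split=> z /=; first by move=> /ellV_segment ->.
  move=> Vz; apply: contrapT => /ellV_off_segment.
  by rewrite ltNge Vz.
by apply: preimage_closed => [z _|]; [exact: continuous_ellV | exact: closed_ge].
Qed.

End SegmentPotential.

Lemma pair_addB_eq0 (K : numFieldType) (a b : K) :
  ((a + b, a - b) == (0, 0)) = ((a, b) == (0, 0)).
Proof.
rewrite !xpair_eqE; apply/andP/andP => -[/eqP sum0 /eqP diff0]; last first.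
  by rewrite sum0 diff0 addr0 subr0.
have a0 : a == 0.
  have : (a + b) + (a - b) = 2 * a by ring.
  by rewrite sum0 diff0 addr0 => /esym/eqP; rewrite mulf_eq0 pnatr_eq0.
by move: sum0; rewrite a0 (eqP a0) add0r => ->.
Qed.

Section PairMap.
Context {R : realType}.
Local Notation sphere := (sphere R).
Variables (s : seq R) (alpha beta : R -> R).
Implicit Types (x : R) (nu : R[i]) (z : sphere).

Definition pair_num : {poly R[i]} :=
  map_poly (real_complex R) (stieltjes_num s alpha + stieltjes_num s beta).

Definition pair_den : {poly R[i]} :=
  map_poly (real_complex R) (stieltjes_num s alpha - stieltjes_num s beta).

Definition pair_map : sphere -> sphere :=
  ratfun_eval (tofrac pair_num / tofrac pair_den).

Hypothesis pair : stieltjes_pair s alpha beta.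

Let s_uniq := pair_uniq pair.

Lemma horner_pair_num nu : (forall k, k \in s -> nu != k%:C) ->
  pair_num.[nu] = (map_poly (real_complex R) (pole_poly s)).[nu] *
    (cstieltjes s alpha nu + cstieltjes s beta nu).
Proof.
by move=> ns; rewrite /pair_num rmorphD hornerD !horner_map_stieltjes_num// mulrDr.
Qed.

Lemma horner_pair_den nu : (forall k, k \in s -> nu != k%:C) ->
  pair_den.[nu] = (map_poly (real_complex R) (pole_poly s)).[nu] *
    (cstieltjes s alpha nu - cstieltjes s beta nu).
Proof.
move=> ns; rewrite /pair_den rmorphB hornerD hornerN.
by rewrite !horner_map_stieltjes_num// mulrBr.
Qed.

Lemma stieltjes_numB_neq0 : stieltjes_num s alpha - stieltjes_num s beta != 0.
Proof.
apply: contraTneq (pair_alpha1 pair) => /(congr1 (horner^~ 1)).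
rewrite /= hornerD hornerN !horner_stieltjes_num_pole ?(pair_one pair)//.
rewrite (pair_beta1 pair) mul0r subr0 horner0 => /eqP.
by rewrite mulf_eq0 (negbTE (pole_cofactor_neq0 s 1)) orbF => /eqP ->; rewrite ltxx.
Qed.

Lemma pair_den_neq0 : pair_den != 0.
Proof. by rewrite map_poly_eq0 stieltjes_numB_neq0. Qed.

Lemma size_stieltjes_numB :
  (size (stieltjes_num s alpha - stieltjes_num s beta)%R + 2 <= size s)%N.
Proof.
have sum0 : \sum_(k <- s) (alpha k - beta k) = 0.
  by rewrite sumrB (weights_sum (pair_alpha pair)) (weights_sum (pair_beta pair)) subrr.
have mean0 : \sum_(k <- s) (alpha k - beta k) * k = 0.
  by under eq_bigr do rewrite mulrBl; rewrite sumrB (pair_mean pair) subrr.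
have := size_stieltjes_num (fun k => (alpha k - beta k) * k * k) s_uniq.
rewrite -mulX_stieltjes_num// -mulX_stieltjes_num// -stieltjes_numB mulrA -expr2.
by rewrite mulrC size_mulXn ?stieltjes_numB_neq0// addnC.
Qed.

Lemma pair_map_infty : pair_map None = None.
Proof.
apply: (ratfun_eval_infty pair_den_neq0 erefl); rewrite !size_map_poly.
have s0 : (0 < size s)%N by case: (s) (pair_one pair).
apply: (@leq_trans (size s)).
  by apply: leq_trans size_stieltjes_numB; rewrite addn2 ltnW.
rewrite -(prednK s0) ltnNge; apply/negP => /leq_sizeP/(_ _ (leqnn _)).
rewrite coefD !coef_stieltjes_num// (weights_sum (pair_alpha pair)).
by rewrite (weights_sum (pair_beta pair)) => /eqP; rewrite -[1 + 1]/2%:R pnatr_eq0.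
Qed.

Lemma pair_map_hcoord nu : (pair_num.[nu], pair_den.[nu]) != (0, 0) ->
  pair_map (Some nu) = hcoord pair_num.[nu] pair_den.[nu].
Proof. exact: ratfun_eval_hcoord pair_den_neq0 erefl nu. Qed.

Lemma pair_map_cstieltjes nu : (forall k, k \in s -> nu != k%:C) ->
  let f := cstieltjes s alpha nu in let h := cstieltjes s beta nu in
  (f, h) != (0, 0) -> pair_map (Some nu) = hcoord (f + h) (f - h).
Proof.
move=> ns f h fh; have W0 := map_pole_poly_neq0 ns.
rewrite pair_map_hcoord horner_pair_num// horner_pair_den// ?hcoordM//.
by rewrite xpair_eqE !mulf_eq0 !(negbTE W0) /= -xpair_eqE pair_addB_eq0.
Qed.

Lemma pair_map_off_segment nu : ~ on_segment nu ->
  let f := cstieltjes s alpha nu in let h := cstieltjes s beta nu in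
  pair_map (Some nu) = hcoord (f + h) (f - h).
Proof.
move=> nseg f h; apply: pair_map_cstieltjes => [k|].
  exact: off_segment_neq (pair_alpha pair) nseg.
by rewrite xpair_eqE (negbTE (cstieltjes_neq0 (pair_alpha pair) nseg)).
Qed.

Lemma continuous_pair_map : continuous pair_map.
Proof. exact: continuous_ratfun_eval. Qed.

Lemma continuous_iter_pair_map n : continuous (iter n pair_map).
Proof.
elim: n => [|n IH] z; first by move=> A.
by apply: continuous_comp; [exact: IH | exact: continuous_pair_map].
Qed.

Lemma ellV_pair_map_lt z : 0 < ellV z < 2^-1 -> ellV (pair_map z) < ellV z.
Proof.
case: z => [nu|]; last by rewrite ltxx.
move=> /andP[Vnu0 Vnu]; have nseg : ~ on_segment nu.
  by move=> /unit_segmentP/ellV_segment V2; move: Vnu; rewrite V2 ltxx.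
rewrite pair_map_off_segment// /hcoord subr_eq0; case: eqVneq => [_//|fh /=].
have ell2 := ell_gt2 nseg; have ell_lt := ell_pair_lt pair nseg fh.
by rewrite ltf_pV2// posrE; lra.
Qed.

Lemma ellV_pair_map_le z : ellV z < 2^-1 -> ellV (pair_map z) <= ellV z.
Proof.
case: z => [nu|_]; last by rewrite pair_map_infty.
move=> Vnu; apply/ltW/ellV_pair_map_lt; rewrite Vnu andbT /= invr_gt0.
exact: lt_le_trans (ell_ge2 nu).
Qed.

Lemma pair_map_escape (v1 v2 : R) : v1 < 2^-1 -> 0 < v2 -> exists N, forall n z,
  (N <= n)%N -> ellV z <= v1 -> ellV (iter n pair_map z) < v2.
Proof.
move=> v1_lt v2_gt0; apply: lyapunov_uniform.
- exact: compact_sphere.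
- exact: continuous_pair_map.
- exact: continuous_ellV.
- by move=> z Vz; apply: ellV_pair_map_le; exact: le_lt_trans v1_lt.
move=> z /andP[Vz1 Vz2]; apply: ellV_pair_map_lt.
by rewrite (lt_le_trans v2_gt0 Vz1) (le_lt_trans Vz2 v1_lt).
Qed.

Lemma unit_segment_preimage z : unit_segment (pair_map z) -> unit_segment z.
Proof.
move=> /ellV_segment Vz; apply: contrapT => /ellV_off_segment Vlt.
by have := le_lt_trans (ellV_pair_map_le Vlt) Vlt; rewrite Vz ltxx.
Qed.

End PairMap.

(** * The map (f + h) / (f - h) on the segment *)

Section RealStieltjes.
Context {R : realType}.
Implicit Types (s : seq R) (w : R -> R) (x y k t : R).

(* minus the derivative of [stieltjes s w] *)
Definition stieltjes2 s w x : R := \sum_(k <- s) w k / (x - k) ^+ 2.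

Lemma stieltjes_num_expand s w x : uniq s -> x \notin s ->
  stieltjes_num s w = stieltjes s w x *: pole_poly s -
                      ('X - x%:P) * stieltjes_num s (fun k => w k / (x - k)).
Proof.
move=> s_uniq xs; rewrite /stieltjes_num /stieltjes scaler_suml mulr_sumr -sumrB.
rewrite big_seq [RHS]big_seq; apply: eq_bigr => k ks.
have xk : x - k != 0 by rewrite subr_eq0; apply: contraNneq xs => ->.
rewrite (pole_polyE s_uniq ks) -scalerAr -scalerBr -mulrBl.
have -> : 'X - k%:P - ('X - x%:P) = (x - k)%:P by rewrite polyCB; ring.
by rewrite mul_polyC scalerA divfK.
Qed.

Lemma deriv_stieltjes_num s w x : uniq s -> x \notin s ->
  (stieltjes_num s w)^`().[x] = (pole_poly s)^`().[x] * stieltjes s w x -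
                                (pole_poly s).[x] * stieltjes2 s w x.
Proof.
move=> s_uniq xs; rewrite (stieltjes_num_expand w s_uniq xs).
rewrite derivB derivZ derivM derivXsubC.
rewrite mul1r hornerD hornerN hornerZ hornerD hornerM hornerXsubC subrr mul0r addr0.
rewrite (horner_stieltjes_num _ s_uniq xs) mulrC; congr (_ - _ * _).
by apply: eq_bigr => k _; rewrite -mulrA -invfM -expr2.
Qed.

Lemma stieltjes2_gt0 s w x : weights s w -> x \notin s -> 0 < stieltjes2 s w x.
Proof.
move=> W xs; have term_ge0 k : 0 <= w k / (x - k) ^+ 2.
  by rewrite divr_ge0 ?sqr_ge0 ?(weights_ge0 W).
rewrite lt_neqAle sumr_ge0 ?andbT//; apply/eqP => /esym/eqP.
rewrite psumr_eq0// => /allP all0; have /eqP := weights_sum W; apply/negP.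
rewrite big_seq big1 ?[0 == 1]eq_sym ?oner_eq0// => k ks.
have := all0 k ks; rewrite /= mulf_eq0 invr_eq0 sqrf_eq0 subr_eq0.
by move=> /orP[/eqP//|/eqP xk]; move: xs; rewrite xk ks.
Qed.

Lemma stieltjes_decr s w x y : weights s w -> x < y ->
  (forall k, k \in s -> 0 < w k -> ~~ (x <= k <= y)) ->
  stieltjes s w y < stieltjes s w x.
Proof.
move=> W xy no_pole; rewrite -subr_gt0 /stieltjes -sumrB.
have term_gt0 k : k \in s -> 0 < w k -> 0 < w k / (x - k) - w k / (y - k).
  move=> ks wk; rewrite -mulrBr mulr_gt0// subr_gt0.
  have := no_pole k ks wk; rewrite negb_and -!ltNge => /orP[kx|yk].
    by rewrite ltf_pV2 ?posrE ?subr_gt0 ?ltrD2r// (lt_trans kx xy).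
  rewrite -ltrN2 -!invrN !opprB ltf_pV2 ?posrE ?subr_gt0 ?ltrD2l ?ltrN2//.
  exact: lt_trans xy yk.
have term_ge0 k : k \in s -> 0 <= w k / (x - k) - w k / (y - k).
  move=> ks; have := weights_ge0 W k; rewrite le_eqVlt => /orP[/eqP <-|wk].
    by rewrite !mul0r subr0.
  exact/ltW/term_gt0.
rewrite big_seq lt_neqAle sumr_ge0// andbT; apply/eqP => /esym/eqP.
rewrite psumr_eq0// => /allP all0; have /eqP := weights_sum W; apply/negP.
rewrite big_seq big1 ?[0 == 1]eq_sym ?oner_eq0// => k ks; apply/eqP.
rewrite eq_le (weights_ge0 W) andbT leNgt; apply/negP => wk.
by have := all0 k ks; rewrite ks gt_eqF// term_gt0.
Qed.

Lemma weighted_isolated s w x : (x \in s -> w x = 0) ->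
  exists2 e : R, 0 < e & forall k, k \in s -> 0 < w k -> e <= `|k - x|.
Proof.
move=> wx; have /nbhs_ballP[e /= e0 eP] :=
  @dnbhs_notin_seq R x s (hausdorff_accessible (@Rhausdorff R)).
exists e => // k ks wk; rewrite leNgt distrC; apply/negP => ke.
have [kx|kx] := eqVneq k x; first by move: wk; rewrite kx wx ?ltxx// -kx.
by have := eP k ke kx; rewrite ks.
Qed.

Lemma stieltjes_decr_right s w x : weights s w -> (x \in s -> w x = 0) ->
  \forall t \near x^'+, stieltjes s w t < stieltjes s w x.
Proof.
move=> W /weighted_isolated[e e0 iso]; near=> t.
have xt : x < t by near: t; exact: nbhs_right_gt.
have te : t < x + e by near: t; apply: nbhs_right_lt; rewrite ltrDl.
apply: stieltjes_decr => // k ks /(iso k ks); rewrite leNgt.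
by apply: contraNN => /andP[xk kt]; rewrite ltr_norml; apply/andP; split; lra.
Unshelve. all: by end_near. Qed.

Lemma stieltjes_decr_left s w x : weights s w -> (x \in s -> w x = 0) ->
  \forall t \near x^'-, stieltjes s w x < stieltjes s w t.
Proof.
move=> W /weighted_isolated[e e0 iso]; near=> t.
have tx : t < x by near: t; exact: nbhs_left_lt.
have te : x - e < t by near: t; apply: nbhs_left_gt; rewrite ltrBlDr ltrDl.
apply: stieltjes_decr => // k ks /(iso k ks); rewrite leNgt.
by apply: contraNN => /andP[tk kx]; rewrite ltr_norml; apply/andP; split; lra.
Unshelve. all: by end_near. Qed.

Lemma dnbhs_sides (A : set R) x : x^' A -> x^'+ A /\ x^'- A.
Proof.
move=> xA; split; apply: filterS (xA : nbhs x _) => t At tx; apply: At.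
  by rewrite gt_eqF.
by rewrite lt_eqF.
Qed.

Lemma stieltjes_num_neg_pole s w1 w2 x : uniq s -> weights s w2 -> x \in s ->
  w2 x = 0 -> 0 < w1 x ->
  (\forall t \near x^'+, (stieltjes_num s w1 * stieltjes_num s w2).[t] < 0) \/
  (\forall t \near x^'-, (stieltjes_num s w1 * stieltjes_num s w2).[t] < 0).
Proof.
move=> s_uniq W2 xs w2x w1x; pose p := stieltjes_num s w1 * pole_cofactor s x.
have px : 0 < p.[x].
  rewrite hornerM horner_stieltjes_num_pole// -mulrA mulr_gt0// -expr2.
  by rewrite exprn_even_gt0 ?pole_cofactor_neq0.
have prodE t : t \notin s -> (stieltjes_num s w1 * stieltjes_num s w2).[t] =
    p.[t] * ((t - x) * stieltjes s w2 t).
  move=> ts; rewrite hornerM (horner_stieltjes_num w2 s_uniq ts) (pole_polyE s_uniq xs).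
  by rewrite !hornerM hornerXsubC; ring.
have [notin_right notin_left] := dnbhs_sides
  (@dnbhs_notin_seq R x s (hausdorff_accessible (@Rhausdorff R))).
have near_p : \forall t \near x, 0 < p.[t].
  by exact: cvgr_gt (@continuous_horner R p x) _ px.
have wx0 : x \in s -> w2 x = 0 by [].
have [h0|h0] := leP 0 (stieltjes s w2 x); [right|left]; near=> t.
  have tx : t < x by near: t; exact: nbhs_left_lt.
  have ts : t \notin s by near: t.
  have pt : 0 < p.[t] by near: t; exact: cvg_within.
  rewrite prodE// pmulr_rlt0// nmulr_rlt0 ?subr_lt0//.
  by apply: le_lt_trans h0 _; near: t; exact: stieltjes_decr_left.
have xt : x < t by near: t; exact: nbhs_right_gt.
have ts : t \notin s by near: t.
have pt : 0 < p.[t] by near: t; exact: cvg_within.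
rewrite prodE// pmulr_rlt0// pmulr_rlt0 ?subr_gt0//.
by apply: lt_trans h0; near: t; exact: stieltjes_decr_right.
Unshelve. all: by end_near. Qed.

Lemma stieltjes_num_neg_regular s w1 w2 x : uniq s -> weights s w2 ->
  x \notin s -> stieltjes s w2 x = 0 -> (stieltjes_num s w1).[x] != 0 ->
  (\forall t \near x^'+, (stieltjes_num s w1 * stieltjes_num s w2).[t] < 0) \/
  (\forall t \near x^'-, (stieltjes_num s w1 * stieltjes_num s w2).[t] < 0).
Proof.
move=> s_uniq W2 xs h0 num0; pose p := stieltjes_num s w1 * pole_poly s.
have px : p.[x] != 0 by rewrite hornerM mulf_neq0 ?pole_poly_neq0.
have prodE t : t \notin s -> (stieltjes_num s w1 * stieltjes_num s w2).[t] =
    p.[t] * stieltjes s w2 t.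
  by move=> ts; rewrite !hornerM (horner_stieltjes_num w2 s_uniq ts); ring.
have [notin_right notin_left] := dnbhs_sides
  (@dnbhs_notin_seq R x s (hausdorff_accessible (@Rhausdorff R))).
have wx0 : x \in s -> w2 x = 0 by rewrite (negbTE xs).
have [p_gt0|p_lt0|pE] := ltrgtP 0 p.[x]; last by rewrite -pE eqxx in px.
  left; near=> t.
  have ts : t \notin s by near: t.
  have pt : 0 < p.[t].
    by near: t; apply: cvg_within; exact: cvgr_gt (@continuous_horner R p x) _ p_gt0.
  rewrite prodE// pmulr_rlt0// -h0.
  by near: t; exact: stieltjes_decr_right.
right; near=> t.
have ts : t \notin s by near: t.
have pt : p.[t] < 0.
  by near: t; apply: cvg_within; exact: cvgr_lt (@continuous_horner R p x) _ p_lt0.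
rewrite prodE// nmulr_rlt0// -h0.
by near: t; exact: stieltjes_decr_left.
Unshelve. all: by end_near. Qed.

Lemma stieltjes_num_neg_side s w1 w2 x : uniq s -> weights s w1 -> weights s w2 ->
  (stieltjes_num s w2).[x] = 0 -> (stieltjes_num s w1).[x] != 0 ->
  (\forall t \near x^'+, (stieltjes_num s w1 * stieltjes_num s w2).[t] < 0) \/
  (\forall t \near x^'-, (stieltjes_num s w1 * stieltjes_num s w2).[t] < 0).
Proof.
move=> s_uniq W1 W2 num2 num1; have [xs|xs] := boolP (x \in s).
  move: num1 num2; rewrite !horner_stieltjes_num_pole// mulf_eq0 negb_or.
  move=> /andP[w1x _] /eqP; rewrite mulf_eq0 (negbTE (pole_cofactor_neq0 s x)) orbF.
  move=> /eqP w2x; apply: stieltjes_num_neg_pole => //.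
  by rewrite lt_neqAle eq_sym w1x (weights_ge0 W1).
apply: stieltjes_num_neg_regular => //; move: num2.
rewrite horner_stieltjes_num// => /eqP.
by rewrite mulf_eq0 (negbTE (pole_poly_neq0 xs)) => /eqP.
Qed.

(* [1 - k^2 >= 0] for each pole k, weighted by [w k / (x - k)^2]. *)
Lemma stieltjes_disc s w x : weights s w -> x \notin s ->
  1 <= (1 - x ^+ 2) * stieltjes2 s w x + 2 * x * stieltjes s w x.
Proof.
move=> W xs; rewrite -[leLHS](weights_sum W) /stieltjes2 /stieltjes !mulr_sumr.
rewrite -big_split -subr_ge0 -sumrB big_seq /=; apply: sumr_ge0 => k ks.
have xk : x - k != 0 by rewrite subr_eq0; apply: contraNneq xs => ->.
have -> : (1 - x ^+ 2) * (w k / (x - k) ^+ 2) + 2 * x * (w k / (x - k)) - w k =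
    w k * (1 - k ^+ 2) / (x - k) ^+ 2 by field.
rewrite divr_ge0 ?sqr_ge0// mulr_ge0 ?(weights_ge0 W)// subr_ge0.
by have /andP[? ?] := weights_itv W ks; nra.
Qed.

Let stieltjes2E s w x :
  stieltjes2 s w x = \sum_(k <- s) w k * (x - k)^-1 ^+ 2.
Proof. by apply: eq_bigr => k _; rewrite exprVn. Qed.

Lemma sqr_stieltjes_le s w x : weights s w ->
  stieltjes s w x ^+ 2 <= stieltjes2 s w x.
Proof.
by move=> W; rewrite stieltjes2E; exact: (sqr_mean_le (weights_ge0 W) (weights_sum W)).
Qed.

Lemma sqr_stieltjes_lt s w x j k : weights s w -> j \in s -> k \in s -> j != k ->
  0 < w j -> 0 < w k -> stieltjes s w x ^+ 2 < stieltjes2 s w x.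
Proof.
move=> W js ks jk wj wk; rewrite stieltjes2E.
apply: (sqr_mean_lt (weights_ge0 W) (weights_sum W) js ks wj wk).
by apply: contra_neq jk => /invr_inj/addrI/oppr_inj.
Qed.

Lemma opposite_sign_expand (q x f h f2 h2 : R) : 0 < q -> f * h < 0 ->
  1 + q * f ^+ 2 < 2 * q * f2 + 2 * x * f ->
  1 + q * h ^+ 2 <= 2 * q * h2 + 2 * x * h ->
  - (f * h) * (f - h) ^+ 2 < q * (f * h2 - h * f2) ^+ 2.
Proof.
move=> q0; wlog f0 : x f h / 0 < f => [wlog_pos fh hf hh|fh hf hh].
  have [f0|f0|f0] := ltrgtP 0 f; first exact: (wlog_pos x); last first.
    by move: fh; rewrite -f0 mul0r ltxx.
  have -> : - (f * h) * (f - h) ^+ 2 = - (- f * - h) * (- f - - h) ^+ 2 by ring.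
  have -> : q * (f * h2 - h * f2) ^+ 2 = q * (- f * h2 - - h * f2) ^+ 2 by ring.
  have xN t : 2 * - x * - t = 2 * x * t by ring.
  by apply: (wlog_pos (- x)); rewrite ?oppr_gt0 ?mulrNN ?sqrrN ?xN.
have h0 : h < 0 by rewrite -(pmulr_rlt0 h f0).
have lin : (f - h) * (1 - q * (f * h)) < 2 * q * (f * h2 - h * f2).
  have : - h * (1 + q * f ^+ 2) < - h * (2 * q * f2 + 2 * x * f).
    by rewrite ltr_pM2l// oppr_gt0.
  have : f * (1 + q * h ^+ 2) <= f * (2 * q * h2 + 2 * x * h) by rewrite ler_pM2l.
  by move=> ? ?; lra.
have lhs0 : 0 <= (f - h) * (1 - q * (f * h)) by rewrite mulr_ge0//; nra.
have sqr : ((f - h) * (1 - q * (f * h))) ^+ 2 < (2 * q * (f * h2 - h * f2)) ^+ 2.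
  by rewrite ltr_pXn2r ?nnegrE// (le_trans lhs0)// ltW.
rewrite -(ltr_pM2l (_ : 0 < 4 * q)) ?mulr_gt0//.
have -> : 4 * q * (q * (f * h2 - h * f2) ^+ 2) = (2 * q * (f * h2 - h * f2)) ^+ 2.
  by ring.
apply: le_lt_trans sqr; rewrite exprMn [leRHS]mulrC.
have -> : 4 * q * (- (f * h) * (f - h) ^+ 2) = - (4 * q * (f * h)) * (f - h) ^+ 2.
  by ring.
by rewrite ler_wpM2r ?sqr_ge0//; have := sqr_ge0 (1 + q * (f * h)); lra.
Qed.

(* The invariant form (1 - x^2) G'^2 > 1 - G^2 of the expansion, where
   G = (f + h) / (f - h). *)
Lemma stieltjes_pair_expand s alpha beta x : stieltjes_pair s alpha beta ->
  -1 < x < 1 -> x \notin s ->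
  let f := stieltjes s alpha x in let h := stieltjes s beta x in f * h < 0 ->
  - (f * h) * (f - h) ^+ 2 <
  (1 - x ^+ 2) * (f * stieltjes2 s beta x - h * stieltjes2 s alpha x) ^+ 2.
Proof.
move=> pair xI xs; have [k [ks k1 ak]] := pair_alpha_other pair.
have q0 : 0 < 1 - x ^+ 2 by case/andP: xI => ? ?; nra.
have := sqr_stieltjes_lt x (pair_alpha pair) ks (pair_one pair) k1 ak
  (pair_alpha1 pair).
have := sqr_stieltjes_le x (pair_beta pair).
have := stieltjes_disc (pair_beta pair) xs.
have := stieltjes_disc (pair_alpha pair) xs.
move: (stieltjes s alpha x) (stieltjes s beta x) => f h.
move: (stieltjes2 s alpha x) (stieltjes2 s beta x) => f2 h2 disc_f disc_h /=.
rewrite -(ler_pM2l q0) -(ltr_pM2l q0) => h_le f_lt fh.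
by apply: (@opposite_sign_expand _ x); lra.
Qed.

End RealStieltjes.

Section SignIntervals.
Context {R : realType}.
Implicit Types (p : {poly R}) (x t : R).

Lemma poly_next_zero p x r : x < r -> p.[x] < 0 -> 0 <= p.[r] ->
  exists b, [/\ x < b, b <= r, p.[b] = 0 & forall t, x <= t -> t < b -> p.[t] < 0].
Proof.
move=> xr px pr.
have neg_before b : {in `]x, b[, forall t, ~~ root p t} ->
    forall t, x <= t -> t < b -> p.[t] < 0.
  move=> noroot t; rewrite le_eqVlt => /predU1P[<-//|xt] tb.
  rewrite ltNge; apply/negP => pt.
  have [|c] := polyrcf.poly_ivt (ltW xt) (p := p); first by rewrite nmulr_rle0.
  rewrite in_itv /= => /andP[xc ct] pc.
  have [cx|cx] := eqVneq c x; first by move: px; rewrite -cx (rootP pc) ltxx.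
  have := noroot c; rewrite in_itv /= (le_lt_trans ct tb) lt_neqAle xc eq_sym cx.
  by rewrite pc => /(_ isT).
case: (polyrcf.next_rootP p x r) => [p0|b _ pb|_ _ _ noroot].
- by move: px; rewrite p0 horner0 ltxx.
- rewrite in_itv /= => /andP[xb br] noroot; exists b; split=> //; first exact: ltW.
  exact: neg_before.
exists r; split=> //; last exact: neg_before.
have [|c] := polyrcf.poly_ivt (ltW xr) (p := p); first by rewrite nmulr_rle0.
rewrite in_itv /= => /andP[xc]; rewrite le_eqVlt => /predU1P[->/rootP//|cr] pc.
by have := neg_before r noroot c xc cr; rewrite (rootP pc) ltxx.
Qed.

Lemma poly_prev_zero p l x : l < x -> p.[x] < 0 -> 0 <= p.[l] ->
  exists a, [/\ a < x, l <= a, p.[a] = 0 & forall t, t <= x -> a < t -> p.[t] < 0].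
Proof.
move=> lx px pl; pose q := p \Po (- 'X).
have qE t : q.[t] = p.[- t] by rewrite horner_comp hornerN hornerX.
have [|||b [xb bl qb nq]] := @poly_next_zero q (- x) (- l).
- by rewrite ltrN2.
- by rewrite qE opprK.
- by rewrite qE opprK.
exists (- b); split; rewrite -?qE//; [by rewrite ltrNl|by rewrite lerNr|].
move=> t tx bt; rewrite -(opprK t) -qE; apply: nq; first by rewrite lerN2.
by rewrite ltrNl.
Qed.

Lemma poly_neg_interval p l x r : l < x -> x < r -> p.[x] < 0 ->
  0 <= p.[l] -> 0 <= p.[r] -> exists a b,
  [/\ l <= a, a < x < b, b <= r, p.[a] = 0 /\ p.[b] = 0 &
      forall t, a < t < b -> p.[t] < 0].
Proof.
move=> lx xr px pl pr.
have [b [xb br pb neg_right]] := poly_next_zero xr px pr.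
have [a [ax la pa neg_left]] := poly_prev_zero lx px pl.
exists a, b; split=> //; first by rewrite ax.
move=> t /andP[at_ tb]; have [tx|xt] := leP t x; first exact: neg_left.
by apply: neg_right => //; exact: ltW.
Qed.

End SignIntervals.

Lemma asin_lt {R : realType} : {in `[-1, 1] &, {homo @asin R : x y / x < y}}.
Proof.
move=> x y; rewrite !in_itv /= => xI yI xy.
have [/andP[x1 x2] sx] := asin_def xI; have [/andP[y1 y2] sy] := asin_def yI.
by rewrite -ltr_sin ?in_itv /= ?x1 ?y1// sx sy.
Qed.

Lemma asin_within {R : realType} : {within `[-1, 1], continuous (@asin R)}.
Proof.
have pi2 : - (pi / 2) <= pi / 2 :> R by have := pi_gt0 R; lra.
have := @segment_can_le_continuous R (- (pi / 2)) (pi / 2) sin asin pi2.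
rewrite sinN sin_pihalf; apply; last exact: sinK.
by apply: continuous_subspaceT => x; exact: continuous_sin.
Qed.

Lemma within_comp_itv {R : realType} (phi q : R -> R) a b c d :
  {within `[c, d], continuous phi} ->
  (forall x, a <= x <= b -> {for x, continuous q}) ->
  (forall x, a <= x <= b -> c <= q x <= d) ->
  {within `[a, b], continuous (phi \o q)}.
Proof.
move=> cphi cq qI; apply/subspace_continuousP => x /=; rewrite in_itv /= => xI.
have /subspace_continuousP/(_ (q x)) := cphi.
rewrite /= in_itv /= => /(_ (qI _ xI)) cqx U /cqx [e /= e0 eU].
have /cvgrPdist_lt/(_ e e0) := cq x xI; apply: filterS => t /= qt.
by rewrite in_itv /= => tI; apply: eU => //=; rewrite in_itv; exact: qI.
Qed.

Lemma MVT_expand {R : realType} (theta psi dtheta dpsi : R -> R) (x y : R) :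
  x < y -> {within `[x, y], continuous theta} -> {within `[x, y], continuous psi} ->
  (forall t, t \in `]x, y[ -> is_derive t 1 theta (dtheta t)) ->
  (forall t, t \in `]x, y[ -> is_derive t 1 psi (dpsi t)) ->
  (forall t, t \in `]x, y[ -> 0 < dtheta t < `|dpsi t|) ->
  theta y - theta x < `|psi y - psi x|.
Proof.
move=> xy ctheta cpsi dth dps speed.
have dtheta0 t : t \in `]x, y[ -> dtheta t != 0.
  by move=> /speed/andP[/lt0r_neq0].
have [c cI ratio] := cauchy_MVT xy cpsi ctheta dps dth dtheta0.
have /andP[dc0 dc_lt] := speed c cI.
have [c' c'I incr] := MVT xy dth ctheta.
have /andP[dc'0 _] := speed c' c'I.
have diff0 : 0 < theta y - theta x by rewrite incr mulr_gt0// subr_gt0.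
have : 1 < `|psi y - psi x| / (theta y - theta x).
  rewrite -[X in _ / X]gtr0_norm// -normf_div -ratio normf_div (gtr0_norm dc0).
  by rewrite ltr_pdivlMr// mul1r.
by rewrite ltr_pdivlMr// mul1r.
Qed.

Section RealMap.
Context {R : realType}.
Variables (s : seq R) (alpha beta : R -> R).
Hypothesis pair : stieltjes_pair s alpha beta.
Implicit Types (x y t k : R).

Local Notation f := (stieltjes s alpha).
Local Notation h := (stieltjes s beta).
Local Notation f2 := (stieltjes2 s alpha).
Local Notation h2 := (stieltjes2 s beta).
Local Notation fnum := (stieltjes_num s alpha).
Local Notation hnum := (stieltjes_num s beta).

Let s_uniq := pair_uniq pair.

Definition real_map x : R := (fnum.[x] + hnum.[x]) / (fnum.[x] - hnum.[x]).

Definition stays x : Prop := unit_segment (pair_map s alpha beta (Some x%:C)).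

Let horner_num_real x : (pair_num s alpha beta).[x%:C] = (fnum.[x] + hnum.[x])%:C.
Proof. by rewrite /pair_num horner_map hornerD. Qed.

Let horner_den_real x : (pair_den s alpha beta).[x%:C] = (fnum.[x] - hnum.[x])%:C.
Proof. by rewrite /pair_den horner_map hornerD hornerN. Qed.

Let pair_real_eq0 (a b : R) : (((a + b)%:C, (a - b)%:C) == (0, 0)) = ((a, b) == (0, 0)).
Proof. by rewrite xpair_eqE !fmorph_eq0 -xpair_eqE pair_addB_eq0. Qed.

Lemma subr_neq0_opposite (a b : R) : (a, b) != (0, 0) -> a * b <= 0 -> a - b != 0.
Proof.
rewrite subr_eq0 => ab0 ab_le0; apply: contraNneq ab0 => ab; move: ab_le0.
rewrite ab -expr2 => b2; have : b ^+ 2 == 0 by rewrite eq_le b2 sqr_ge0.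
by rewrite sqrf_eq0 => /eqP ->.
Qed.

Lemma normr_ratio_le1 (a b : R) : a - b != 0 ->
  (-1 <= (a + b) / (a - b) <= 1) = (a * b <= 0).
Proof.
move=> d0; rewrite -ler_norml normf_div ler_pdivrMr ?normr_gt0// mul1r.
rewrite -ler_sqr ?nnegrE// !real_normK ?num_real//.
by apply/idP/idP => ?; nra.
Qed.

Lemma unit_segment_hcoord (a b : R) : (a, b) != (0, 0) ->
  unit_segment (hcoord (a + b)%:C (a - b)%:C) <-> a * b <= 0.
Proof.
move=> ab0; rewrite /hcoord fmorph_eq0; split.
  move=> [y]; case: eqP => // /eqP d0 /[swap] /Some_inj.
  by rewrite -fmorph_div => /complexI <-; rewrite normr_ratio_le1.
move=> ab_le0; have d0 := subr_neq0_opposite ab0 ab_le0.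
rewrite (negbTE d0); exists ((a + b) / (a - b)); last by rewrite fmorph_div.
by rewrite normr_ratio_le1.
Qed.

Lemma pair_map_real x : (fnum.[x], hnum.[x]) != (0, 0) ->
  pair_map s alpha beta (Some x%:C) =
  hcoord (fnum.[x] + hnum.[x])%:C (fnum.[x] - hnum.[x])%:C.
Proof.
move=> num0; rewrite (pair_map_hcoord pair) horner_num_real horner_den_real//.
by rewrite pair_real_eq0.
Qed.

Lemma common_zero x : fnum.[x] = 0 -> hnum.[x] = 0 ->
  [/\ x \notin s, f x = 0 & h x = 0].
Proof.
move=> fx hx; have xs : x \notin s.
  apply/negP => xs; have := pair_support pair xs; have cof0 := pole_cofactor_neq0 s x.
  move: fx hx; rewrite !horner_stieltjes_num_pole// => /eqP + /eqP.
  rewrite !mulf_eq0 (negbTE cof0) !orbF => /eqP -> /eqP ->.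
  by rewrite addr0 ltxx.
have W0 := pole_poly_neq0 xs; move: fx hx; rewrite !horner_stieltjes_num//.
by move=> /eqP + /eqP; rewrite !mulf_eq0 (negbTE W0) /= => /eqP ? /eqP ?.
Qed.

(* The value at a common zero is given by the derivatives of the numerators,
   which there have the same sign. *)
Lemma common_zero_not_stays x : fnum.[x] = 0 -> hnum.[x] = 0 -> ~ stays x.
Proof.
move=> fx hx; have [xs f0 h0] := common_zero fx hx.
have deriv_gt0 : 0 < fnum^`().[x] * hnum^`().[x].
  rewrite !deriv_stieltjes_num// f0 h0 !mulr0 !sub0r mulrNN mulrACA -expr2.
  rewrite mulr_gt0 ?exprn_even_gt0 ?pole_poly_neq0// mulr_gt0//.
    exact: stieltjes2_gt0 (pair_alpha pair) xs.
  exact: stieltjes2_gt0 (pair_beta pair) xs.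
have deriv0 : (fnum^`().[x], hnum^`().[x]) != (0, 0).
  by apply: contraTneq deriv_gt0 => -[-> _]; rewrite mul0r ltxx.
have num'E : (pair_num s alpha beta)^`().[x%:C] = (fnum^`().[x] + hnum^`().[x])%:C.
  by rewrite /pair_num deriv_map horner_map derivD hornerD.
have den'E : (pair_den s alpha beta)^`().[x%:C] = (fnum^`().[x] - hnum^`().[x])%:C.
  by rewrite /pair_den deriv_map horner_map derivB hornerD hornerN.
rewrite /stays /pair_map (ratfun_eval_hcoord_deriv (pair_den_neq0 pair) erefl).
- by rewrite num'E den'E => /(unit_segment_hcoord deriv0); rewrite leNgt deriv_gt0.
- by rewrite horner_num_real fx hx addr0.
- by rewrite horner_den_real fx hx subr0.
by rewrite num'E den'E pair_real_eq0.
Qed.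

Lemma staysP x : stays x <->
  (fnum.[x], hnum.[x]) != (0, 0) /\ fnum.[x] * hnum.[x] <= 0.
Proof.
split=> [sx|[num0 num_le0]].
  have num0 : (fnum.[x], hnum.[x]) != (0, 0).
    by apply/eqP => -[fx hx]; exact: (common_zero_not_stays fx hx sx).
  by split=> //; move: sx; rewrite /stays pair_map_real// unit_segment_hcoord.
by rewrite /stays pair_map_real// unit_segment_hcoord.
Qed.

Lemma stays_neg x : fnum.[x] * hnum.[x] < 0 -> stays x.
Proof.
move=> num_lt0; apply/staysP; split; last exact: ltW.
by apply: contraTneq num_lt0 => -[-> _]; rewrite mul0r ltxx.
Qed.

Lemma stays_den x : stays x -> fnum.[x] - hnum.[x] != 0.
Proof. by move=> /staysP[]; exact: subr_neq0_opposite. Qed.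

Lemma stays_map x : stays x ->
  pair_map s alpha beta (Some x%:C) = Some (real_map x)%:C.
Proof.
move=> sx; have d0 := stays_den sx; have [num0 _] := (staysP x).1 sx.
by rewrite pair_map_real// /hcoord fmorph_eq0 (negbTE d0) fmorph_div.
Qed.

Lemma stays_itv x : stays x -> -1 <= x <= 1 /\ -1 <= real_map x <= 1.
Proof.
move=> sx; split.
  by have [y yI /Some_inj/complexI ->] := unit_segment_preimage pair sx.
by move: (sx); rewrite /stays stays_map// => -[y yI /Some_inj/complexI ->].
Qed.

Lemma stays_zero x : stays x -> fnum.[x] * hnum.[x] = 0 ->
  real_map x = 1 \/ real_map x = -1.
Proof.
move=> /stays_den; rewrite /real_map => d0 /eqP; rewrite mulf_eq0.
move=> /orP[]/eqP num0; move: d0; rewrite num0.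
  by rewrite !add0r oppr_eq0 => d0; right; rewrite invrN mulrN divff.
by rewrite addr0 subr0 => d0; left; rewrite divff.
Qed.

Lemma continuous_real_map x : fnum.[x] - hnum.[x] != 0 ->
  {for x, continuous real_map}.
Proof.
move=> d0; apply: cvgM; first by apply: cvgD; exact: continuous_horner.
by apply: cvgV => //; apply: cvgB; exact: continuous_horner.
Qed.

Definition real_map_deriv t : R :=
  2 * (h t * f2 t - f t * h2 t) / (f t - h t) ^+ 2.

Lemma is_derive_real_map t : t \notin s -> f t - h t != 0 ->
  is_derive t 1 real_map (real_map_deriv t).
Proof.
move=> ts d0; pose N := fnum + hnum; pose D := fnum - hnum.
have W0 := pole_poly_neq0 ts.
have -> : real_map = horner N * (fun x => (D.[x])^-1).
  by apply: funext => x; rewrite /real_map -hornerN -!hornerD.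
have D0 : D.[t] != 0.
  by rewrite hornerD hornerN !horner_stieltjes_num// -mulrBr mulf_neq0.
have := @is_deriveM R _ _ _ t 1 _ _ (is_derive_poly N t)
  (@is_deriveV R (horner D) t _ 1 D0 (is_derive_poly D t)).
move=> /is_derive_eq; apply; rewrite -[_ *: _]/(_ * _) -[X in _ + X]/(_ * _).
rewrite -![_ *: _]/(_ * _) /N /D !derivD !derivN !hornerD !hornerN.
rewrite !deriv_stieltjes_num// !horner_stieltjes_num// /real_map_deriv.
by field; rewrite d0 -mulrBr mulf_neq0.
Qed.

End RealMap.

Section Zone.
Context {R : realType}.
Variables (s : seq R) (alpha beta : R -> R) (a b : R).
Hypothesis pair : stieltjes_pair s alpha beta.
Implicit Types (x y t k : R).

Local Notation f := (stieltjes s alpha).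
Local Notation h := (stieltjes s beta).
Local Notation fnum := (stieltjes_num s alpha).
Local Notation hnum := (stieltjes_num s beta).
Local Notation g := (real_map s alpha beta).
Local Notation dg := (real_map_deriv s alpha beta).
Local Notation stay := (stays s alpha beta).

Hypothesis a_ge : -1 <= a.
Hypothesis ab : a < b.
Hypothesis b_le : b <= 1.
Hypothesis zero_a : fnum.[a] * hnum.[a] = 0.
Hypothesis zero_b : fnum.[b] * hnum.[b] = 0.
Hypothesis zone_neg : forall t, a < t < b -> fnum.[t] * hnum.[t] < 0.

Let s_uniq := pair_uniq pair.

Let zone_itv t : a < t < b -> -1 < t < 1.
Proof. by move=> /andP[at_ tb]; rewrite (le_lt_trans a_ge) ?(lt_le_trans tb). Qed.

Lemma zone_notin t : a < t < b -> t \notin s.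
Proof.
move=> /zone_neg; apply: contraTN => ts; rewrite -leNgt.
rewrite !horner_stieltjes_num_pole// mulrACA -expr2 mulr_ge0 ?sqr_ge0//.
by rewrite mulr_ge0 ?(weights_ge0 (pair_alpha pair)) ?(weights_ge0 (pair_beta pair)).
Qed.

Lemma zone_stieltjes_lt0 t : a < t < b -> f t * h t < 0.
Proof.
move=> tI; have ts := zone_notin tI; have := zone_neg tI.
rewrite !horner_stieltjes_num// mulrACA -expr2 pmulr_rlt0//.
by rewrite exprn_even_gt0 ?pole_poly_neq0.
Qed.

(* At a common zero both transforms decrease, hence have the same sign nearby. *)
Lemma zone_left_end : (fnum.[a], hnum.[a]) != (0, 0).
Proof.
apply/eqP => -[fa ha]; have [as_ f0 h0] := common_zero pair fa ha.
have weight0 (w : R -> R) : a \in s -> w a = 0 by rewrite (negbTE as_).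
have near_a : \forall t \near a^'+, [/\ a < t < b, f t < 0 & h t < 0].
  near=> t; split.
  - by apply/andP; split; near: t; [exact: nbhs_right_gt | exact: nbhs_right_lt].
  - by rewrite -f0; near: t; exact: stieltjes_decr_right (pair_alpha pair) (weight0 _).
  - by rewrite -h0; near: t; exact: stieltjes_decr_right (pair_beta pair) (weight0 _).
have [t [tI ft ht]] := filter_ex near_a.
by have := zone_stieltjes_lt0 tI; rewrite ltNge mulr_le0 ?ltW.
Unshelve. all: by end_near. Qed.

Lemma zone_right_end : (fnum.[b], hnum.[b]) != (0, 0).
Proof.
apply/eqP => -[fb hb]; have [bs f0 h0] := common_zero pair fb hb.
have weight0 (w : R -> R) : b \in s -> w b = 0 by rewrite (negbTE bs).
have near_b : \forall t \near b^'-, [/\ a < t < b, 0 < f t & 0 < h t].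
  near=> t; split.
  - by apply/andP; split; near: t; [exact: nbhs_left_gt | exact: nbhs_left_lt].
  - by rewrite -f0; near: t; exact: stieltjes_decr_left (pair_alpha pair) (weight0 _).
  - by rewrite -h0; near: t; exact: stieltjes_decr_left (pair_beta pair) (weight0 _).
have [t [tI ft ht]] := filter_ex near_b.
by have := zone_stieltjes_lt0 tI; rewrite ltNge mulr_ge0 ?ltW.
Unshelve. all: by end_near. Qed.

Lemma zone_stays t : a <= t <= b -> stay t.
Proof.
move=> /andP[]; rewrite le_eqVlt => /predU1P[<- _|at_].
  by apply/(staysP pair); rewrite zone_left_end zero_a.
rewrite le_eqVlt => /predU1P[->|tb].
  by apply/(staysP pair); rewrite zone_right_end zero_b.
by apply: (stays_neg pair); apply: zone_neg; rewrite at_.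
Qed.

Lemma zone_stieltjes_neq t : a < t < b -> f t - h t != 0.
Proof.
move=> tI; have fh := zone_stieltjes_lt0 tI; rewrite subr_eq0.
by apply: contraTneq fh => ->; rewrite -expr2 -leNgt sqr_ge0.
Qed.

Lemma zone_real_map t : a < t < b -> g t = (f t + h t) / (f t - h t).
Proof.
move=> tI; have ts := zone_notin tI.
rewrite /real_map !horner_stieltjes_num// -mulrBr -mulrDr -mulf_div divff ?mul1r//.
exact: pole_poly_neq0.
Qed.

Lemma zone_deriv_gt t : a < t < b ->
  0 < 1 - g t ^+ 2 < (1 - t ^+ 2) * dg t ^+ 2.
Proof.
move=> tI; have := zone_stieltjes_neq tI; have := zone_stieltjes_lt0 tI.
have := stieltjes_pair_expand pair (zone_itv tI) (zone_notin tI).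
rewrite (zone_real_map tI) /real_map_deriv.
move: (f t) (h t) (stieltjes2 s alpha t) (stieltjes2 s beta t).
move=> ft ht f2 h2 /[swap] fh /(_ fh) expand d0.
have d2 : 0 < (ft - ht) ^+ 2 by rewrite exprn_even_gt0.
have -> : 1 - ((ft + ht) / (ft - ht)) ^+ 2 = 4 * - (ft * ht) / (ft - ht) ^+ 2.
  by field.
apply/andP; split; first by rewrite divr_gt0// mulr_gt0// oppr_gt0.
rewrite ltr_pdivrMr//.
have -> : (1 - t ^+ 2) * (2 * (ht * f2 - ft * h2) / (ft - ht) ^+ 2) ^+ 2 *
    (ft - ht) ^+ 2 = 4 * ((1 - t ^+ 2) * (ft * h2 - ht * f2) ^+ 2) / (ft - ht) ^+ 2.
  by field.
by rewrite ltr_pdivlMr// -mulrA ltr_pM2l.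
Qed.

Lemma zone_asin_speed t : a < t < b ->
  0 < (Num.sqrt (1 - t ^+ 2))^-1 <
  `|(Num.sqrt (1 - g t ^+ 2))^-1 * dg t|.
Proof.
move=> tI; have /andP[g2 speed] := zone_deriv_gt tI.
have t2 : 0 < 1 - t ^+ 2 by have /andP[? ?] := zone_itv tI; nra.
rewrite invr_gt0 sqrtr_gt0 t2/= normrM ger0_norm ?invr_ge0 ?sqrtr_ge0//.
rewrite mulrC ltr_pdivlMr ?sqrtr_gt0// mulrC ltr_pdivrMr ?sqrtr_gt0//.
rewrite -sqrtr_sqr -sqrtrM ?sqr_ge0// ltr_sqrt; first by rewrite mulrC.
by rewrite mulrC (lt_trans g2).
Qed.

Let real_map_cont t : a <= t <= b -> {for t, continuous g}.
Proof. by move=> /zone_stays st; apply/continuous_real_map/(stays_den pair). Qed.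

Lemma zone_asin_expand x y : a <= x -> x < y -> y <= b ->
  asin y - asin x < `|asin (g y) - asin (g x)|.
Proof.
move=> ax xy yb.
have sub t : x <= t <= y -> a <= t <= b.
  by move=> /andP[xt ty]; rewrite (le_trans ax) ?(le_trans ty).
have inside t : t \in `]x, y[ -> a < t < b.
  by rewrite in_itv => /andP[xt ty]; rewrite (le_lt_trans ax) ?(lt_le_trans ty).
apply: (@MVT_expand _ asin (asin \o g) (fun t => (Num.sqrt (1 - t ^+ 2))^-1)
  (fun t => (Num.sqrt (1 - g t ^+ 2))^-1 * dg t)) => //.
- apply: continuous_subspaceW asin_within => t /=.
  rewrite !in_itv /= => /sub/andP[at_ tb].
  by rewrite (le_trans a_ge) ?(le_trans tb).
- apply: within_comp_itv asin_within _ _ => t /sub tI; first exact: real_map_cont.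
  by have [] := stays_itv pair (zone_stays tI).
- by move=> t /inside /zone_itv; exact: is_derive1_asin.
- move=> t /inside tI; have /andP[g2 _] := zone_deriv_gt tI.
  have gI : -1 < g t < 1.
    by rewrite -ltr_norml -ltr_sqr ?nnegrE// real_normK ?num_real// expr1n -subr_gt0.
  have dasin := is_derive1_asin gI.
  have dg_t := is_derive_real_map pair (zone_notin tI) (zone_stieltjes_neq tI).
  exact: is_derive1_comp dasin dg_t.
by move=> t /inside; exact: zone_asin_speed.
Qed.

Lemma zone_branch : branch (-1) 1 asin g stay a b.
Proof.
have stay_a : stay a by apply: zone_stays; rewrite lexx ltW.
have stay_b : stay b by apply: zone_stays; rewrite lexx ltW.
have ends_neq : g a <> g b.
  move=> gE; have := zone_asin_expand (lexx a) ab (lexx b).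
  rewrite gE subrr normr0 subr_lt0 ltNge ltW// asin_lt ?in_itv//=.
    by rewrite a_ge (le_trans (ltW ab)).
  by rewrite b_le (le_trans a_ge) ?ltW.
split=> //; first exact: zone_stays.
- apply: continuous_in_subspaceT => t; rewrite inE /= in_itv /=.
  exact: real_map_cont.
- have [ga|ga] := stays_zero pair stay_a zero_a;
    have [gb|gb] := stays_zero pair stay_b zero_b;
    by [left|right|case: ends_neq; rewrite ga gb].
exact: zone_asin_expand.
Qed.

End Zone.

Section Branches.
Context {R : realType}.
Variables (s : seq R) (alpha beta : R -> R).
Hypothesis pair : stieltjes_pair s alpha beta.
Implicit Types (x t : R).

Local Notation fnum := (stieltjes_num s alpha).
Local Notation hnum := (stieltjes_num s beta).
Local Notation zone_branch_at :=
  (branch (-1) 1 asin (real_map s alpha beta) (stays s alpha beta)).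

Let s_uniq := pair_uniq pair.

Lemma stieltjes_numM_pole_ge0 k : k \in s -> 0 <= (fnum * hnum).[k].
Proof.
move=> ks; rewrite hornerM !horner_stieltjes_num_pole// mulrACA -expr2.
rewrite mulr_ge0 ?sqr_ge0// mulr_ge0//.
  exact: weights_ge0 (pair_alpha pair) k.
exact: weights_ge0 (pair_beta pair) k.
Qed.

Lemma stieltjes_numM_N1_ge0 : 0 <= (fnum * hnum).[-1].
Proof.
have [|N1s] := boolP (-1 \in s); first exact: stieltjes_numM_pole_ge0.
have le0 w : weights s w -> stieltjes s w (-1) <= 0.
  move=> W; rewrite /stieltjes big_seq; apply: sumr_le0 => k ks.
  rewrite mulr_ge0_le0 ?(weights_ge0 W)// invr_le0 subr_le0.
  by have /andP[] := weights_itv W ks.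
rewrite hornerM !horner_stieltjes_num// mulrACA -expr2 mulr_ge0 ?sqr_ge0//.
by rewrite mulr_le0// le0//; [exact: pair_alpha pair | exact: pair_beta pair].
Qed.

Lemma neg_zone x : (fnum * hnum).[x] < 0 -> exists a b,
  [/\ zone_branch_at a b, a < x < b, (fnum * hnum).[a] = 0 &
      (fnum * hnum).[b] = 0].
Proof.
move=> neg_x.
have /(stays_itv pair)[/andP[x1 x2] _] : stays s alpha beta x.
  by apply: (stays_neg pair); rewrite -hornerM.
have ge0_1 := stieltjes_numM_pole_ge0 (pair_one pair).
have N1x : -1 < x.
  rewrite lt_neqAle x1 andbT; apply: contraTneq neg_x => <-.
  by rewrite -leNgt stieltjes_numM_N1_ge0.
have x1' : x < 1.
  by rewrite lt_neqAle x2 andbT; apply: contraTneq neg_x => ->; rewrite -leNgt.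
have [a [b [a1 /andP[ax xb] b1 [pa pb] neg]]] :=
  poly_neg_interval N1x x1' neg_x stieltjes_numM_N1_ge0 ge0_1.
exists a, b; split=> //; last by rewrite ax.
apply: zone_branch => //; rewrite -?hornerM//; first exact: lt_trans ax xb.
by move=> t /neg; rewrite hornerM.
Qed.

Lemma stays_neg_side x : stays s alpha beta x -> (fnum * hnum).[x] = 0 ->
  (\forall t \near x^'+, (fnum * hnum).[t] < 0) \/
  (\forall t \near x^'-, (fnum * hnum).[t] < 0).
Proof.
move=> /(staysP pair)[num0 _]; rewrite hornerM => /eqP; rewrite mulf_eq0.
move: num0; rewrite xpair_eqE negb_and.
have [f0 /= h0 _|f0 _ /= /eqP h0] := eqVneq fnum.[x] 0.
  rewrite mulrC.
  exact: stieltjes_num_neg_side s_uniq (pair_beta pair) (pair_alpha pair) f0 h0.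
exact: stieltjes_num_neg_side s_uniq (pair_alpha pair) (pair_beta pair) h0 f0.
Qed.

Lemma stays_branch x : stays s alpha beta x ->
  exists a b, zone_branch_at a b /\ a <= x <= b.
Proof.
move=> sx; have [_] := (staysP pair x).1 sx; rewrite -hornerM le_eqVlt.
move=> /predU1P[zero|neg]; last first.
  by have [a [b [br /andP[ax xb] _ _]]] := neg_zone neg; exists a, b; rewrite !ltW.
have [] := stays_neg_side sx zero => near_neg.
  have : \forall y \near x^'+, x < y /\ forall t, x < t <= y -> (fnum * hnum).[t] < 0.
    have /nbhs_ballP[e /= e0 eP] := near_neg.
    near=> y; split; first by near: y; exact: nbhs_right_gt.
    move=> t /andP[xt ty]; apply: eP => //; rewrite /ball /= ltr_norml.
    have : y < x + e by near: y; apply: nbhs_right_lt; rewrite ltrDl.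
    by move=> ye; apply/andP; split; lra.
  move=> /filter_ex[y [xy neg]].
  have [|a [b [br /andP[ay yb] pa _]]] := @neg_zone y; first by rewrite neg ?xy ?lexx.
  exists a, b; split=> //; rewrite (le_trans (ltW xy) (ltW yb)) andbT leNgt.
  by apply/negP => xa; have := neg a; rewrite pa ltxx xa ltW// => /(_ isT).
have : \forall y \near x^'-, y < x /\ forall t, y <= t < x -> (fnum * hnum).[t] < 0.
  have /nbhs_ballP[e /= e0 eP] := near_neg.
  near=> y; split; first by near: y; exact: nbhs_left_lt.
  move=> t /andP[yt tx]; apply: eP => //; rewrite /ball /= ltr_norml.
  have : x - e < y by near: y; apply: nbhs_left_gt; rewrite ltrBlDr ltrDl.
  by move=> ey; apply/andP; split; lra.
move=> /filter_ex[y [yx neg]].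
have [|a [b [br /andP[ay yb] _ pb]]] := @neg_zone y; first by rewrite neg ?yx ?lexx.
exists a, b; split=> //; rewrite (le_trans (ltW ay) (ltW yx)) leNgt.
by apply/negP => bx; have := neg b; rewrite pb ltxx bx ltW// => /(_ isT).
Unshelve. all: by end_near. Qed.

End Branches.

Lemma separable_root_dvdp (K : closedFieldType) (p q : {poly K}) :
  separable_poly p -> (forall x, root p x -> root q x) -> p %| q.
Proof.
have [rs pE] := closed_field_poly_normal p => sep roots.
have p0 := separable_poly_neq0 sep.
have lead0 : lead_coef p != 0 by rewrite lead_coef_eq0.
rewrite pE dvdpZl//; apply: uniq_roots_dvdp; last first.
  rewrite uniq_rootsE -separable_prod_XsubC.
  by rewrite -(eqp_separable (eqp_scale _ lead0)) -pE.
apply/allP => x xrs; apply: roots.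
by rewrite pE rootZ// root_prod_XsubC.
Qed.

Section SeparableNumerator.
Context {R : realType}.
Implicit Types (s : seq R) (w : R -> R) (x k t : R) (nu : R[i]).

Lemma stieltjes_num_rem s w x : uniq s -> x \in s -> w x = 0 ->
  stieltjes_num s w = ('X - x%:P) * stieltjes_num (rem x s) w.
Proof.
move=> s_uniq xs wx; rewrite /stieltjes_num (big_rem x)//= wx scale0r add0r mulr_sumr.
rewrite big_seq [RHS]big_seq; apply: eq_bigr => k.
rewrite mem_rem_uniq// inE => /andP[kx ks].
by rewrite -scalerAr /pole_cofactor (big_rem x xs) /= eq_sym kx.
Qed.

Lemma weights_rem s w x : weights s w -> x \in s -> w x = 0 ->
  weights (rem x s) w.
Proof.
move=> W xs wx; split; first by move=> k /mem_rem; exact: weights_itv W k.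
  exact: weights_ge0 W.
by rewrite -(weights_sum W) (big_rem x xs) /= wx add0r.
Qed.

Lemma size_stieltjes_num_weights s w : uniq s -> weights s w ->
  size (stieltjes_num s w) = size s.
Proof.
move=> s_uniq W; apply/eqP; rewrite eqn_leq size_stieltjes_num//=.
have s0 : (0 < size s)%N.
  case: s W {s_uniq} => // W; have := weights_sum W.
  by rewrite big_nil => /esym/eqP; rewrite oner_eq0.
rewrite -(prednK s0) ltnNge; apply/negP => /leq_sizeP/(_ _ (leqnn _)).
by rewrite coef_stieltjes_num// (weights_sum W) => /eqP; rewrite oner_eq0.
Qed.

Section PositiveWeights.
Variables (s : seq R) (w : R -> R).
Hypotheses (s_uniq : uniq s) (W : weights s w).
Hypothesis w_gt0 : forall k, k \in s -> 0 < w k.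

Local Notation num := (stieltjes_num s w).

(* A Stieltjes transform has no zero off the segment. *)
Lemma stieltjes_num_real_root nu : root (map_poly (real_complex R) num) nu ->
  exists t, [/\ nu = t%:C, t \notin s & num.[t] = 0].
Proof.
have pole_neq0 k : k \in s -> num.[k] != 0.
  move=> ks; rewrite horner_stieltjes_num_pole//.
  by rewrite mulf_neq0 ?pole_cofactor_neq0 ?gt_eqF ?w_gt0.
move=> root_nu; have [[t nuE]|nreal] := pselect (exists t, nu = t%:C).
  move: root_nu; rewrite nuE fmorph_root => /rootP num0; exists t; split=> //.
  by apply/negP => /pole_neq0; rewrite num0 eqxx.
exfalso; have off_poles k : k \in s -> nu != k%:C.
  by move=> _; apply/eqP => nuE; apply: nreal; exists k.
move: root_nu; rewrite rootE horner_map_stieltjes_num// mulf_eq0.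
rewrite (negbTE (map_pole_poly_neq0 off_poles)) /= (negbTE (cstieltjes_neq0 W _))//.
move=> [Im0 _]; apply: nreal; exists (complex.Re nu).
by apply/eqP; rewrite eq_complex /= Im0 !eqxx.
Qed.

Lemma separable_stieltjes_num : separable_poly num.
Proof.
rewrite -(separable_map (real_complex R)) unlock.
apply/Pdiv.ClosedField.coprimepP => nu /stieltjes_num_real_root[t [-> ts num0]].
rewrite deriv_map horner_map fmorph_eq0 deriv_stieltjes_num//.
have h0 : stieltjes s w t = 0.
  move: num0; rewrite horner_stieltjes_num// => /eqP.
  by rewrite mulf_eq0 (negbTE (pole_poly_neq0 ts)) => /eqP.
by rewrite h0 mulr0 sub0r oppr_eq0 mulf_neq0 ?pole_poly_neq0// gt_eqF ?stieltjes2_gt0.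
Qed.

Lemma stieltjes_num_size_le (p : {poly R}) : p != 0 ->
  (forall t, t \notin s -> num.[t] = 0 -> p.[t] = 0) -> (size s <= size p)%N.
Proof.
move=> p0 zeros; rewrite -(size_stieltjes_num_weights s_uniq W).
apply: dvdp_leq => //; rewrite -(dvdp_map (real_complex R)).
apply: separable_root_dvdp; first by rewrite separable_map separable_stieltjes_num.
move=> nu /stieltjes_num_real_root[t [-> ts num0]].
by rewrite fmorph_root; apply/rootP/zeros.
Qed.

End PositiveWeights.

Lemma stieltjes1_gt0 s w : weights s w -> 1 \notin s -> 0 < stieltjes s w 1.
Proof.
move=> W s1; apply: (@lt_le_trans _ _ 2^-1); first by rewrite invr_gt0.
rewrite -[leLHS]mul1r -{1}(weights_sum W) mulr_suml /stieltjes.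
rewrite big_seq [leRHS]big_seq; apply: ler_sum => k ks.
have /andP[k1 k2] := weights_itv W ks.
have k_lt1 : k < 1 by rewrite lt_neqAle k2 andbT; apply: contraNneq s1 => <-.
by rewrite ler_wpM2l ?(weights_ge0 W)// lef_pV2 ?posrE ?subr_gt0//; lra.
Qed.

End SeparableNumerator.

Section Trapped.
Context {R : realType}.
Local Notation sphere := (sphere R).
Variables (s : seq R) (alpha beta : R -> R).
Hypothesis pair : stieltjes_pair s alpha beta.
Implicit Types (x t : R).

Local Notation fnum := (stieltjes_num s alpha).
Local Notation hnum := (stieltjes_num s beta).
Local Notation G := (pair_map s alpha beta).
Local Notation g := (real_map s alpha beta).
Local Notation stay := (stays s alpha beta).

Let s_uniq := pair_uniq pair.

Lemma stays_hnum0 x : hnum.[x] = 0 -> fnum.[x] != 0 -> stay x /\ g x = 1.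
Proof.
move=> h0 f0; split; last by rewrite /real_map h0 addr0 subr0 divff.
by apply/(staysP pair); rewrite h0 mulr0 xpair_eqE negb_and f0.
Qed.

Lemma stays_one : stay 1 /\ g 1 = 1.
Proof.
apply: stays_hnum0.
  by rewrite horner_stieltjes_num_pole ?(pair_one pair)// (pair_beta1 pair) mul0r.
rewrite horner_stieltjes_num_pole ?(pair_one pair)//.
by rewrite mulf_neq0 ?pole_cofactor_neq0// gt_eqF// (pair_alpha1 pair).
Qed.

(* Otherwise all the zeros of h would be zeros of f - h, whose numerator has
   too small a degree. *)
Lemma second_preimage : exists e, [/\ stay e, g e = 1 & e != 1].
Proof.
apply: contrapT => none.
have common x : hnum.[x] = 0 -> x != 1 -> fnum.[x] = 0.
  move=> h0 x1; apply: contrapT => /eqP f0; apply: none; exists x.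
  by have [sx gx] := stays_hnum0 h0 f0.
pose s1 := rem 1 s.
have us1 : uniq s1 by exact: rem_uniq.
have W1 := weights_rem (pair_beta pair) (pair_one pair) (pair_beta1 pair).
have hnumE := stieltjes_num_rem s_uniq (pair_one pair) (pair_beta1 pair).
have beta_gt0 k : k \in s1 -> 0 < beta k.
  rewrite mem_rem_uniq// inE => /andP[k1 ks].
  rewrite lt_neqAle (weights_ge0 (pair_beta pair)) andbT eq_sym; apply/eqP => bk.
  have h0 : hnum.[k] = 0 by rewrite horner_stieltjes_num_pole// bk mul0r.
  have := common k h0 k1; rewrite horner_stieltjes_num_pole// => /eqP.
  rewrite mulf_eq0 (negbTE (pole_cofactor_neq0 s k)) orbF => /eqP ak.
  by have := pair_support pair ks; rewrite ak bk addr0 ltxx.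
have one_notin : 1 \notin s1 by rewrite mem_rem_uniq// inE eqxx.
have := stieltjes_num_size_le us1 W1 beta_gt0 (stieltjes_numB_neq0 pair).
have size_s : size s = (size s1).+1.
  by rewrite size_rem ?(pair_one pair)// prednK//; case: (s) (pair_one pair).
have := size_stieltjes_numB pair; rewrite size_s addn2 ltnS => small big.
suff : (size s1 < size s1)%N by rewrite ltnn.
apply: leq_ltn_trans small; apply: big => t ts num0.
have h0 : hnum.[t] = 0 by rewrite hnumE hornerM num0 mulr0.
rewrite hornerD hornerN h0 common ?subr0//.
apply: contra_eq_neq num0 => ->; rewrite horner_stieltjes_num//.
by rewrite mulf_neq0 ?pole_poly_neq0// gt_eqF// stieltjes1_gt0.
Qed.

Definition trapped : set R := [set x | forall n, unit_segment (iter n G (Some x%:C))].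

Lemma iter_stays x n : (forall m, (m < n)%N -> stay (iter m g x)) ->
  iter n G (Some x%:C) = Some (iter n g x)%:C.
Proof.
elim: n => //= n IH st; rewrite IH; last by move=> m mn; apply: st; exact: ltnW.
by apply: (stays_map pair); exact: st.
Qed.

Lemma trappedE : trapped = survivors g stay.
Proof.
apply/seteqP; split => x tx.
  move=> n; have [m] := ubnP n; elim: m n => // m IH n nm.
  have := tx n.+1; rewrite iterS iter_stays// => l ln; apply: IH.
  by rewrite (leq_trans ln).
case=> [|n]; last by rewrite iterS iter_stays//; exact: tx.
by have [xI _] := stays_itv pair (tx 0%N); exists x.
Qed.

Lemma trapped_itv x : trapped x -> -1 <= x <= 1.
Proof. by move=> /(_ 0%N) [y yI /= /Some_inj/complexI ->]. Qed.

Lemma trapped_closed : closed trapped.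
Proof.
have -> : trapped = \bigcap_(n in setT)
    ((fun x : R => iter n G (Some x%:C)) @^-1` unit_segment).
  by apply/seteqP; split => x tx n *; exact: tx.
apply: closed_bigI => n _; apply: preimage_closed; last exact: unit_segment_closed.
move=> x _; apply: (@continuous_comp _ _ _ (fun x : R => Some x%:C : sphere)).
  exact: continuous_real_point.
exact: continuous_iter_pair_map.
Qed.

Lemma trapped_one : trapped 1.
Proof.
have [st1 g1] := stays_one; rewrite trappedE => n.
by have -> : iter n g 1 = 1 by elim: n => //= n ->.
Qed.

Lemma trapped_dichotomy :
  (forall x, -1 <= x <= 1 -> trapped x) \/
  ((forall a b, a < b -> ~ (forall x, a <= x <= b -> trapped x)) /\
   (forall x, trapped x -> forall eps, 0 < eps ->
      exists y, [/\ trapped y, y != x & `|y - x| < eps])).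
Proof.
have cl := trapped_closed; have one := trapped_one; rewrite trappedE in cl one *.
have N11 : -1 < 1 :> R by lra.
have [st1 g1] := stays_one.
have branches := stays_branch pair; have itv := stays_itv pair.
have [[a [b [ab Sab]]]|noseg] := pselect (exists a b, a < b /\
    forall x, a <= x <= b -> survivors g stay x).
  left; exact: (survivors_segment N11 asin_lt asin_within itv branches cl g1 one ab Sab).
right; split; first by move=> a b ab Sab; apply: noseg; exists a, b.
have [e [se ge e1]] := second_preimage.
have Se : survivors g stay e by apply: survivors_preimage; rewrite // ge.
apply: (survivors_perfect N11 asin_lt itv branches one Se e1).
by move=> a b ab Sab; apply: noseg; exists a, b.
Qed.

End Trapped.

(** * The Julia set *)

Section EmbeddedCompact.
Context {R : realType} {T : topologicalType}.
Variables (j : R -> T) (coord : T -> R) (K : set R).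
Hypothesis jK : cancel j coord.

Lemma perfect_set_image : continuous j -> closed (j @` K) ->
  (forall x, K x -> forall eps, 0 < eps ->
     exists y, [/\ K y, y != x & `|y - x| < eps]) -> perfect_set (j @` K).
Proof.
move=> cj clJ perf; split=> //; apply/seteqP; split=> z.
  by move=> lz; apply: clJ => B /lz[y [_ Jy By]]; exists y.
move=> [x Kx <-] A nA; have := cj x A nA => /nbhs_normP[e /= e0 eA].
have [y [Ky yx ye]] := perf x Kx e e0.
exists (j y); split; [by rewrite (can_eq jK) | by exists y |].
by apply: eA; rewrite /ball_ /= distrC.
Qed.

Lemma totally_disconnected_image :
  (forall x, K x -> {for j x, continuous coord}) ->
  (forall a b, a < b -> ~ (forall x, a <= x <= b -> K x)) ->
  totally_disconnected (j @` K).
Proof.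
move=> ccoord noseg z Jz; apply/seteqP; split => [w|_ ->]; last first.
  exact: connected_component_refl.
move=> [B [Bz BJ cB] Bw].
have BK t : (coord @` B) t -> K t by move=> [b /BJ[u Ku <-] <-]; rewrite jK.
have cBR : connected (coord @` B).
  apply: connected_continuous_connected => //.
  apply: continuous_in_subspaceT => y; rewrite inE => /BJ[x Kx <-].
  exact: ccoord.
have itv := (connected_intervalP _).1 cBR.
have no_lt u v : (coord @` B) u -> (coord @` B) v -> ~ u < v.
  move=> Bu Bv uv; apply: (noseg _ _ uv) => t tI; apply: BK.
  exact: (itv u v).
have [x Kx xE] := BJ _ Bz; have [y Ky yE] := BJ _ Bw.
have Bx : (coord @` B) x by exists z => //; rewrite -xE jK.
have By : (coord @` B) y by exists w => //; rewrite -yE jK.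
have [xy|yx|xy] := ltgtP x y; first by case: (no_lt _ _ Bx By).
  by case: (no_lt _ _ By Bx).
by rewrite -yE -xE xy.
Qed.

End EmbeddedCompact.

Section Chordal.
Context {R : realType}.
Local Notation sphere := (sphere R).
Implicit Types (a c : R[i]) (z w : sphere).

Lemma chordalC z w : chordal z w = chordal w z.
Proof.
case: z => [a|]; case: w => [c|] //=; rewrite cabsB; congr (_ / _); exact: mulrC.
Qed.

Lemma chordal_refl z : chordal z z = 0.
Proof. by case: z => //= a; rewrite subrr cabs0 mulr0 mul0r. Qed.

Lemma sqrt1Dsqr_ge1 (x : R) : 1 <= Num.sqrt (1 + x ^+ 2).
Proof. by rewrite -[leLHS]sqrtr1 ler_wsqrtr// lerDl sqr_ge0. Qed.

Lemma sqrt1Dsqr_le (x : R) : 0 <= x -> Num.sqrt (1 + x ^+ 2) <= 1 + x.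
Proof.
move=> x0; rewrite -[leRHS]ger0_norm ?addr_ge0// -sqrtr_sqr ler_wsqrtr//.
by rewrite sqrrD !expr1n mul1r lerD2r lerDl mulrn_wge0.
Qed.

Lemma chordal_zero a : chordal (Some a) (Some 0) <= 2 * cabs a.
Proof.
rewrite /chordal subr0 cabs0 expr0n /= addr0 sqrtr1 mulr1.
have sqrt1 := sqrt1Dsqr_ge1 (cabs a).
rewrite ler_pdivrMr; last exact: lt_le_trans sqrt1.
by rewrite ler_peMr// mulr_ge0// cabs_ge0.
Qed.

Lemma chordal_small (r : R) z c : 0 < r -> r <= 1 -> cabs c <= r ->
  chordal z (Some c) < r / 4 -> exists2 a, z = Some a & cabs a <= 2 * r.
Proof.
move=> r0 r1 cr.
have sqrt_gt0 (x : R) : 0 < Num.sqrt (1 + x ^+ 2).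
  exact: lt_le_trans (sqrt1Dsqr_ge1 x).
have c2 : Num.sqrt (1 + cabs c ^+ 2) <= 2.
  by apply: le_trans (sqrt1Dsqr_le (cabs_ge0 c)) _; lra.
case: z => [a|] /=; last by rewrite ltNge ler_pdivlMr//; nra.
rewrite ltr_pdivrMr ?mulr_gt0// => close; exists a => //.
rewrite leNgt; apply/negP => ar; move: close; rewrite ltNge => /negP; apply.
have a_le := sqrt1Dsqr_le (cabs_ge0 a).
have dist : cabs a - r <= cabs (a - c).
  by have := cabsD (a - c) c; rewrite subrK; lra.
apply: (@le_trans _ _ (r / 4 * ((1 + cabs a) * 2))); last by nra.
by rewrite ler_wpM2l ?divr_ge0 ?(ltW r0)// ler_pM ?(ltW (sqrt_gt0 _)).
Qed.

End Chordal.

Section Normality.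
Context {R : realType}.
Local Notation sphere := (sphere R).

Lemma subsequence_often_or_diverges (n : nat -> nat) :
  (exists (phi : nat -> nat) j, {homo phi : a b / (a < b)%N} /\
     forall k, n (phi k) = j) \/
  (forall N, exists K, forall k, (K <= k)%N -> (N <= n k)%N).
Proof.
have [often|rare] := pselect (exists j, forall K, exists2 k, (K <= k)%N & n k = j).
  left; have [j jP] := often; pose next K := projT1 (cid2 (jP K)).
  have nextP K : (K <= next K)%N /\ n (next K) = j by rewrite /next; case: cid2.
  pose phi := fix phi m := if m is m'.+1 then next (phi m').+1 else next 0%N.
  exists phi, j; split; last by case=> [|m] /=; exact: (nextP _).2.
  apply: homo_ltn; first exact: ltn_trans.
  by move=> m; exact: (nextP _).1.
right; elim=> [|N [K KP]]; first by exists 0%N.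
have [K' K'P] : exists K', forall k, (K' <= k)%N -> n k != N.
  apply: contrapT => never; apply: rare; exists N => K'.
  apply: contrapT => none; apply: never; exists K' => k K'k.
  by apply/eqP => nk; apply: none; exists k.
exists (maxn K K') => k; rewrite geq_max => /andP[Kk K'k].
by rewrite ltn_neqAle eq_sym K'P// KP.
Qed.

Lemma iterates_normal (f : sphere -> sphere) (U : set sphere) (l : sphere) :
  (forall e : R, 0 < e -> exists N, forall n, (N <= n)%N -> forall z, U z ->
     chordal (iter n f z) l < e) ->
  normal_on U [set h | exists n : nat, h = iter n f].
Proof.
move=> ul u uP; pose n k := projT1 (cid (uP k)).
have nE k : u k = iter (n k) f by exact: projT2 (cid (uP k)).
have [[phi [j [phi_lt phin]]]|diverges] := subsequence_often_or_diverges n.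
  exists phi, (iter j f); split=> // A cA AU e e0.
  by exists 0%N => k _ z Az; rewrite nE phin chordal_refl.
exists id, (fun=> l); split => // A cA AU e e0.
have [N NP] := ul e e0; have [K KP] := diverges N.
by exists K => k Kk z Az; rewrite nE; apply: NP; [exact: KP | exact: AU].
Qed.

End Normality.

Section Moebius.
Context {R : realType}.
Local Notation sphere := (sphere R).
Implicit Types (z : sphere) (x : R) (c : R[i]).

Definition sphere_affine (m k : R[i]) z : sphere :=
  if z is Some a then Some (m * a + k) else None.

Lemma continuous_sphere_affine (m k : R[i]) : m != 0 ->
  continuous (sphere_affine m k).
Proof.
move=> m0; have -> : sphere_affine m k = ratmap (m *: 'X + k%:P) 1.
  apply: funext => -[a|] /=.
    by rewrite hornerC /hcoord oner_eq0 divr1 hornerD hornerZ hornerX hornerC.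
  by rewrite size_polyC oner_eq0 -mul_polyC size_MXaddC polyC_eq0 (negbTE m0) /=
    size_polyC m0.
by apply: continuous_ratmap; rewrite ?coprimep1 ?oner_eq0.
Qed.

Variables (m k : R).
Hypothesis m_gt0 : 0 < m.

Let m_neq0 : m%:C != 0. Proof. by rewrite fmorph_eq0 gt_eqF. Qed.

Definition moebius z : sphere := sphere_inv (sphere_affine m%:C k%:C z).

Definition moebius_inv z : sphere :=
  sphere_affine (m%:C)^-1 (- k%:C / m%:C) (sphere_inv z).

Lemma moebiusK : cancel moebius moebius_inv.
Proof.
move=> z; rewrite /moebius_inv /moebius sphere_invK; case: z => [a|] //=.
by congr Some; field.
Qed.

Lemma moebius_invK : cancel moebius_inv moebius.
Proof.
move=> z; rewrite /moebius_inv /moebius -[RHS]sphere_invK; congr sphere_inv.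
by case: (sphere_inv z) => [a|] //=; congr Some; field.
Qed.

Lemma continuous_moebius : continuous moebius.
Proof.
move=> z; apply: continuous_comp; first exact: continuous_sphere_affine.
exact: continuous_sphere_inv.
Qed.

Lemma continuous_moebius_inv : continuous moebius_inv.
Proof.
move=> z; apply: continuous_comp; first exact: continuous_sphere_inv.
by apply: continuous_sphere_affine; rewrite invr_eq0.
Qed.

Definition moebius_real x : sphere := moebius (Some x%:C).

Definition moebius_coord z : R :=
  if moebius_inv z is Some a then complex.Re a else 0.

Lemma continuous_moebius_real : continuous moebius_real.
Proof.
move=> x; apply: (@continuous_comp _ _ _ (fun x : R => Some x%:C : sphere)).
  exact: continuous_real_point.
exact: continuous_moebius.
Qed.

Lemma moebius_realK : cancel moebius_real moebius_coord.
Proof. by move=> x; rewrite /moebius_coord moebiusK. Qed.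

Lemma moebius_real_circle x : real_circle (moebius_real x).
Proof.
rewrite /moebius_real /moebius /= -rmorphM -rmorphD /= fmorph_eq0.
by case: eqP => // _; rewrite -fmorphV.
Qed.

Lemma continuous_moebius_coord x : {for moebius_real x, continuous moebius_coord}.
Proof.
have cRe : {for (Some x%:C : sphere), continuous
    (fun w : sphere => if w is Some a then complex.Re a else 0 : R)}.
  by move=> A /= nA; exact: (@continuous_Re R (x%:C : R[i]^o) A nA).
apply: (@continuous_comp _ _ _ moebius_inv
  (fun w : sphere => if w is Some a then complex.Re a else 0 : R)).
  exact: continuous_moebius_inv.
by rewrite /moebius_real moebiusK.
Qed.

Lemma moebius_segment_large z c : m + `|k| <= 1 -> unit_segment z ->
  moebius z = Some c -> 1 <= cabs c.
Proof.
move=> mk1 [y /andP[y1 y2] ->]; rewrite /moebius /=.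
rewrite -rmorphM -rmorphD /= fmorph_eq0; case: eqP => // /eqP n0 [<-].
rewrite cabsV cabs_real invf_ge1 ?normr_gt0//.
apply: le_trans mk1; apply: le_trans (ler_normD _ _) _.
rewrite lerD2r normrM (gtr0_norm m_gt0) ler_piMr ?(ltW m_gt0)//.
by rewrite ler_norml y1.
Qed.

Lemma moebius_small (r : R) : 0 < r -> exists2 v : R, 0 < v & forall z,
  ellV z < v -> exists2 c, moebius z = Some c & cabs c <= r.
Proof.
move=> r0; pose M := (r^-1 + `|k|) / m.
have V0 : 0 < r^-1 by rewrite invr_gt0.
have M0 : 0 < M by rewrite divr_gt0// ltr_wpDr.
have v0 : 0 < 2 * M + 2 by lra.
exists (2 * M + 2)^-1; first by rewrite invr_gt0.
move=> [a|_]; last by exists 0 => //; rewrite cabs0 ltW.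
have ell0 : 0 < ell a by exact: lt_le_trans (ell_ge2 a).
rewrite /= ltf_pV2 ?posrE// => la.
have aM : M < cabs a by have := ell_le_cabs a; lra.
have low : r^-1 <= cabs (m%:C * a + k%:C).
  have := cabsD (m%:C * a + k%:C) (- k%:C); rewrite addrK cabsM cabsN !cabs_real.
  rewrite (gtr0_norm m_gt0); move: aM; rewrite /M ltr_pdivrMr//; lra.
have n0 : m%:C * a + k%:C != 0 by rewrite -cabs_gt0 (lt_le_trans V0).
exists (m%:C * a + k%:C)^-1; first by rewrite /moebius /= (negbTE n0).
by rewrite cabsV -[leRHS]invrK lef_pV2 // posrE (lt_le_trans V0).
Qed.

End Moebius.

Section JuliaPair.
Context {R : realType}.
Local Notation sphere := (sphere R).
Implicit Types (z w : sphere) (x t : R).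

Variables (s : seq R) (alpha beta : R -> R) (D : sphere -> sphere) (m k : R).
Hypothesis pair : stieltjes_pair s alpha beta.
Hypothesis D_cont : continuous D.
Hypothesis m_gt0 : 0 < m.
Hypothesis mk1 : m + `|k| <= 1.

Local Notation G := (pair_map s alpha beta).
Local Notation phi := (moebius m k).
Local Notation phi_inv := (moebius_inv m k).
Local Notation point := (moebius_real m k).
Local Notation trap := (trapped s alpha beta).

Hypothesis conj_DG : forall z, D (phi z) = phi (G z).

Let phiK : cancel phi phi_inv := moebiusK k m_gt0.
Let phi_invK : cancel phi_inv phi := moebius_invK k m_gt0.

Lemma iter_conj n z : iter n D (phi z) = phi (iter n G z).
Proof. by elim: n => //= n ->. Qed.

Lemma continuous_iter_conj n : continuous (iter n D).
Proof.
elim: n => [|n IH] w; first by move=> A.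
by apply: continuous_comp; [exact: IH | exact: D_cont].
Qed.

Lemma escape_to_zero (v r : R) : v < 2^-1 -> 0 < r -> exists N, forall n z,
  (N <= n)%N -> ellV z <= v ->
  exists2 c, iter n D (phi z) = Some c & cabs c <= r.
Proof.
move=> v_lt r0; have [v0 v0_gt0 smallP] := moebius_small k m_gt0 r0.
have [N NP] := pair_map_escape pair v_lt v0_gt0.
by exists N => n z Nn Vz; rewrite iter_conj; apply: smallP; exact: NP.
Qed.

Lemma escape_fatou z : ~ (point @` trap) z -> fatou_set D z.
Proof.
move=> nz; have [n nseg] : exists n, ~ unit_segment (iter n G (phi_inv z)).
  apply: contrapT => all_in; apply: nz.
  have seg n : unit_segment (iter n G (phi_inv z)).
    by apply: contrapT => ns; apply: all_in; exists n.
  have [x _ xE] := seg 0%N; exists x; first by move=> n; rewrite -xE.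
  by rewrite /moebius_real -xE phi_invK.
have Vz := ellV_off_segment nseg.
set V := ellV _ in Vz; pose v := (V + 2^-1) / 2.
have [Vv v2] : V < v /\ v < 2^-1 by rewrite /v; split; lra.
exists ((fun w => ellV (iter n G (phi_inv w))) @^-1` [set u | u < v]); split=> //.
- apply: open_comp; last exact: open_lt.
  move=> w _; apply: (@continuous_comp _ _ _ (fun w => iter n G (phi_inv w)) (@ellV R)).
    2: exact: continuous_ellV.
  apply: (@continuous_comp _ _ _ phi_inv); first exact: continuous_moebius_inv.
  exact: continuous_iter_pair_map.
apply: (@iterates_normal _ _ _ (Some 0)) => e e0.
have e4 : 0 < e / 4 by rewrite divr_gt0.
have [N NP] := escape_to_zero v2 e4.
exists (N + n)%N => j Nj w Ww; rewrite -(phi_invK w).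
have nj : (n <= j)%N by rewrite (leq_trans _ Nj)// leq_addl.
rewrite -(subnK nj) iterD iter_conj.
have [|c -> cr] := NP (j - n)%N _ _ (ltW Ww); first by rewrite leq_subRL// addnC.
by apply: le_lt_trans (chordal_zero _) _; lra.
Qed.

(* The iterates of a non-real point tend to 0, so a limit function is small
   there, and so is any late iterate. *)
Lemma near_limit_small (phi_n : nat -> nat) (lim : sphere -> sphere) N y :
  {homo phi_n : a b / (a < b)%N} ->
  (forall n, (N <= n)%N -> chordal (iter (phi_n n) D y) (lim y) < 1 / 8 / 4) ->
  ~ unit_segment (phi_inv y) ->
  exists2 c, iter (phi_n N) D y = Some c & cabs c <= 1 / 2.
Proof.
move=> phi_n_lt close nseg; have r8 : 0 < 1 / 8 :> R by lra.
have [M MP] := escape_to_zero (ellV_off_segment nseg) r8.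
have phi_n_ge n : (n <= phi_n n)%N.
  by elim: n => // n IH; exact: leq_ltn_trans IH (phi_n_lt _ _ (ltnSn n)).
have [b bE br] := MP (phi_n (maxn N M)) _
  (leq_trans (leq_maxr N M) (phi_n_ge _)) (lexx _).
rewrite phi_invK in bE.
have := close _ (leq_maxl N M); rewrite bE chordalC => lim_close.
have [|c limE cr] := chordal_small r8 _ br lim_close; first by lra.
have := close _ (leqnn N); rewrite limE => close_N.
have [||||a aE ar] := @chordal_small R (1 / 4) (iter (phi_n N) D y) c.
- by lra.
- by lra.
- by lra.
- by apply: lt_le_trans close_N _; lra.
by exists a => //; lra.
Qed.

Lemma nbhs_outside_disc (r : R) z :
  (forall c, z = Some c -> r < cabs c) ->
  nbhs z [set w : sphere | forall c, w = Some c -> r < cabs c].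
Proof.
case: z => [a /(_ a erefl) ra|_].
  apply/nbhs_finite; exists (cabs a - r); first by rewrite subr_gt0.
  by move=> b ba c [<-]; have := cabs_dist a b; rewrite ler_norml cabsB => /andP[]; lra.
by apply/nbhs_infty; split=> //; exists r => a ra c [<-].
Qed.

Lemma trapped_julia x : trap x -> julia_set D (point x).
Proof.
move=> tx [U [oU Ux normalU]].
have [phi_n [lim [phi_n_lt conv]]] :=
  normalU (fun n => iter n D) (fun n => ex_intro _ n erefl).
have reg : {for point x, regular_space sphere}.
  apply: (compact_regular hausdorff_sphere compact_sphere).
  exact: filterT.
have [B nB BU] := reg U (open_nbhs_nbhs (conj oU Ux)).
have cB : compact (closure B).
  by apply: closed_sphere_compact; exact: closed_closure.
have e0 : 0 < (1 / 8 / 4 : R) by lra.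
have [N NP] := conv _ cB BU _ e0.
have large : nbhs (iter (phi_n N) D (point x))
    [set w | forall c, w = Some c -> 1 / 2 < cabs c].
  apply: nbhs_outside_disc => c; rewrite iter_conj.
  by move=> /(moebius_segment_large m_gt0 mk1 (tx (phi_n N))); lra.
have /nbhs_finite[d d0 dP] : nbhs (Some x%:C : sphere)
    ([set w | forall c, iter (phi_n N) D (phi w) = Some c -> 1 / 2 < cabs c] `&`
     [set w | B (phi w)]).
  have cphi := @continuous_moebius R m k m_gt0 (Some x%:C).
  apply: filterI; last exact: cphi.
  exact: (continuous_comp cphi (@continuous_iter_conj _ _)) large.
pose b : R[i] := x +i* (d / 2).
have [|Vb Bb] := dP b.
  rewrite cabsE !raddfB /= subrr expr0n add0r subr0 sqrtr_sqr gtr0_norm; lra.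
have [|c cE cr] := near_limit_small phi_n_lt
    (fun n Nn => NP n Nn _ (subset_closure Bb)).
  rewrite phiK => /unit_segmentP[/= Im0 _].
  by move: d0; rewrite (_ : d = 0) ?ltxx//; lra.
by have := Vb c cE; lra.
Qed.

Lemma julia_pairE : julia_set D = point @` trap.
Proof.
apply/seteqP; split => z; last by move=> [x tx <-]; exact: trapped_julia.
by move=> Jz; apply: contrapT => /escape_fatou.
Qed.

Theorem julia_pair_dichotomy :
  real_interval (julia_set D) \/ cantor_set (julia_set D).
Proof.
have cpoint := @continuous_moebius_real R m k m_gt0.
have pointK := moebius_realK k m_gt0.
have J0 : point @` trap !=set0.
  by exists (point 1); exists 1 => //; exact: trapped_one.
have ctrap : compact trap.
  apply: (subclosed_compact (@trapped_closed _ s alpha beta) (@segment_compact R (-1) 1)).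
  by move=> x /trapped_itv; rewrite /= in_itv.
have cJ : compact (point @` trap).
  by apply: continuous_compact ctrap; exact: continuous_subspaceT.
rewrite julia_pairE; have [full|[noseg perf]] := trapped_dichotomy pair; [left|right].
  split => //; first by move=> _ [x _ <-]; exact: moebius_real_circle.
  have -> : trap = `[-1, 1]%classic.
    apply/seteqP; split => x; rewrite /= in_itv; last exact: full.
    exact: trapped_itv.
  apply: connected_continuous_connected; first exact: segment_connected.
  exact: continuous_subspaceT.
split => //.
  by apply: (perfect_set_image pointK) => //; exact: compact_closed hausdorff_sphere cJ.
apply: (totally_disconnected_image pointK) => // x _.
exact: continuous_moebius_coord.
Qed.

End JuliaPair.

(** * Spectral decomposition of the transition function *)

Section SpectralData.
Context {R : realType} {I : finType}.
Variables (kappa a b : I -> R) (c : R) (d : {fraction {poly R[i]}}).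
Implicit Types (u : I -> R) (i j : I) (t : R) (nu : R[i]).

Definition spectral_poly u : {poly R[i]} :=
  \sum_i (u i)%:C *: \prod_(j | j != i) (1 - (kappa j)%:C *: 'X).

Lemma spectral_poly_at0 u : (spectral_poly u).[0] = (\sum_i u i)%:C.
Proof.
rewrite horner_sum rmorph_sum /=; apply: eq_bigr => i _.
rewrite hornerZ horner_prod big1 ?mulr1// => j _.
by rewrite hornerD hornerN hornerZ hornerX mulr0 subr0 hornerC.
Qed.

Hypothesis c_gt0 : 0 < c.
Hypothesis c_le1 : c <= 1.
Hypothesis kappa_itv : forall i, - c <= kappa i <= 1.
Hypothesis a_ge0 : forall i, 0 <= a i.
Hypothesis b_ge0 : forall i, 0 <= b i.
Hypothesis a_sum : \sum_i a i = 1.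
Hypothesis b_sum : \sum_i b i = 1.
Hypothesis mean_eq : \sum_i a i * kappa i = \sum_i b i * kappa i.
Hypothesis a_one : exists2 i, kappa i = 1 & 0 < a i.
Hypothesis b_one : forall i, kappa i = 1 -> b i = 0.
Hypothesis dE : d = tofrac (spectral_poly (fun i => a i - b i)) /
                    tofrac (spectral_poly (fun i => a i + c * b i)).

(* The affine map t |-> m t + k sends [-1, 1] onto [-c, 1]. *)
Let m : R := (1 + c) / 2.
Let k : R := (1 - c) / 2.
Let node i : R := (kappa i - k) / m.

Let m_gt0 : 0 < m. Proof. by rewrite divr_gt0// addr_gt0. Qed.
Let mDk : m + k = 1. Proof. by rewrite /m /k; field. Qed.
Let mBk : m - k = c. Proof. by rewrite /m /k; field. Qed.

Let node_itv i : -1 <= node i <= 1.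
Proof.
have /andP[kappa_ge kappa_le] := kappa_itv i.
rewrite /node ler_pdivlMr// ler_pdivrMr//.
by have := mDk; have := mBk; move=> *; apply/andP; split; lra.
Qed.

Let node_eq1 i : (node i == 1) = (kappa i == 1).
Proof.
rewrite /node -[LHS](inj_eq (mulIf (lt0r_neq0 m_gt0))) divfK ?lt0r_neq0// mul1r.
by rewrite subr_eq mDk.
Qed.

Definition spectral_support : seq R :=
  undup [seq node i | i <- enum I & 0 < a i + b i].

(* Distinct indices may have the same eigenvalue. *)
Definition grouped u t : R := \sum_(i | node i == t) u i.

Let charged u := (forall i, 0 <= u i) /\ (forall i, u i != 0 -> 0 < a i + b i).

Let charged_a : charged a.
Proof.
split=> // i ai; apply: ltr_pwDl (b_ge0 i).
by rewrite lt_neqAle eq_sym ai a_ge0.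
Qed.

Let charged_b : charged b.
Proof.
split=> // i bi; apply: ltr_wpDl (a_ge0 i) _.
by rewrite lt_neqAle eq_sym bi b_ge0.
Qed.

Let grouped_ge0 u t : charged u -> 0 <= grouped u t.
Proof. by move=> [u0 _]; apply: sumr_ge0. Qed.

Let sum_grouped (V : zmodType) u (g : R -> R -> V) : charged u ->
  (forall t x y, g t (x + y) = g t x + g t y) -> (forall t, g t 0 = 0) ->
  \sum_(t <- spectral_support) g t (grouped u t) = \sum_i g (node i) (u i).
Proof.
move=> [_ uS] gD g0.
have g_sum t (P : pred I) : g t (\sum_(i | P i) u i) = \sum_(i | P i) g t (u i).
  by apply: (big_morph (g t)).
under eq_bigr do rewrite g_sum.
rewrite (exchange_big_dep xpredT)//=; apply: eq_bigr => i _.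
have [ui|ui] := eqVneq (u i) 0.
  by rewrite ui g0 big1// => t _; rewrite g0.
have iS : node i \in spectral_support.
  by rewrite mem_undup; apply/mapP; exists i; rewrite // mem_filter uS// mem_enum.
rewrite -big_filter (eq_filter (a2 := pred1 (node i))) => [|t]; last exact: eq_sym.
by rewrite filter_pred1_uniq ?undup_uniq// big_seq1.
Qed.

Let sum_grouped_weights u : charged u ->
  \sum_(t <- spectral_support) grouped u t = \sum_i u i.
Proof. by move=> cu; exact: (sum_grouped (g := fun _ x => x)). Qed.

Let grouped_mean u : charged u -> \sum_i u i = 1 ->
  \sum_(t <- spectral_support) grouped u t * t = (\sum_i u i * kappa i - k) / m.
Proof.
move=> cu u1; rewrite (sum_grouped (g := fun t x => x * t))//; first last.
- by move=> t; rewrite mul0r.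
- by move=> t x y; rewrite mulrDl.
rewrite mulrBl -[k in RHS]mulr1 -u1 mulr_sumr !mulr_suml -sumrB.
by apply: eq_bigr => i _; rewrite /node; ring.
Qed.

Lemma cstieltjes_grouped u nu : charged u ->
  cstieltjes spectral_support (grouped u) nu = \sum_i (u i)%:C / (nu - (node i)%:C).
Proof.
move=> cu; apply: (sum_grouped (g := fun t x => x%:C / (nu - t%:C))) => // t.
  by move=> x y; rewrite rmorphD mulrDl.
by rewrite rmorph0 mul0r.
Qed.

Let weights_grouped u : charged u -> \sum_i u i = 1 ->
  weights spectral_support (grouped u).
Proof.
move=> cu u1; split=> [t|t|].
- by rewrite mem_undup => /mapP[i _ ->].
- exact: grouped_ge0.
- by rewrite sum_grouped_weights.
Qed.

Lemma spectral_pair : stieltjes_pair spectral_support (grouped a) (grouped b).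
Proof.
have [i1 kappa1 a1] := a_one.
split.
- exact: weights_grouped.
- exact: weights_grouped.
- exact: undup_uniq.
- move=> t; rewrite mem_undup => /mapP[j]; rewrite mem_filter => /andP[abj _] ->.
  rewrite /grouped -big_split /= (bigD1 j)//= ltr_wpDr//.
  by apply: sumr_ge0 => l _; rewrite addr_ge0.
- by rewrite !grouped_mean// mean_eq.
- rewrite mem_undup; apply/mapP; exists i1.
    by rewrite mem_filter mem_enum andbT ltr_pwDl.
  by apply/esym/eqP; rewrite node_eq1 kappa1.
- rewrite /grouped (bigD1 i1)/=; last by rewrite node_eq1 kappa1.
  by rewrite ltr_pwDl// sumr_ge0.
- by rewrite /grouped big1// => i; rewrite node_eq1 => /eqP; exact: b_one.
Qed.

Let den := spectral_poly (fun i => a i + c * b i).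

Let den_neq0 : den != 0.
Proof.
apply/eqP => /(congr1 (horner^~ 0)).
rewrite /= spectral_poly_at0 horner0 big_split /= -mulr_sumr a_sum b_sum mulr1.
by move=> /complexI c1; move: c_gt0; lra.
Qed.

Let m_neq0 : m%:C != 0. Proof. by rewrite fmorph_eq0 gt_eqF. Qed.

Let spectral_scale (x : R[i]) : R[i] :=
  x / m%:C * \prod_j (1 - (kappa j)%:C * x^-1).

Let spectral_factor j nu : m%:C * nu + k%:C != 0 ->
  1 - (kappa j)%:C * (m%:C * nu + k%:C)^-1 =
  m%:C * (nu - (node j)%:C) / (m%:C * nu + k%:C).
Proof.
move=> x0; have -> : (node j)%:C = ((kappa j)%:C - k%:C) / m%:C.
  by rewrite -rmorphB -fmorph_div.
by field; rewrite x0 m_neq0.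
Qed.

Let spectral_scale_neq0 nu : m%:C * nu + k%:C != 0 ->
  (forall i, nu != (node i)%:C) -> spectral_scale (m%:C * nu + k%:C) != 0.
Proof.
move=> x0 off; rewrite !mulf_neq0 ?invr_eq0//; apply/prodf_neq0 => j _.
by rewrite spectral_factor// !mulf_neq0 ?invr_eq0// subr_eq0.
Qed.

Let horner_spectral_poly u nu : m%:C * nu + k%:C != 0 ->
  (forall i, nu != (node i)%:C) ->
  (spectral_poly u).[(m%:C * nu + k%:C)^-1] =
  spectral_scale (m%:C * nu + k%:C) * \sum_i (u i)%:C / (nu - (node i)%:C).
Proof.
move=> x0 off; rewrite /spectral_poly horner_sum mulr_sumr; apply: eq_bigr => i _.
rewrite hornerZ horner_prod /spectral_scale [in RHS](bigD1 i)//= spectral_factor//.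
under eq_bigr do rewrite hornerD hornerN hornerZ hornerX hornerC.
move: (\prod_(_ | _) _) => rest.
have nu_i : nu - (node i)%:C != 0 by rewrite subr_eq0.
by field; rewrite x0 m_neq0 nu_i.
Qed.

Local Notation G := (pair_map spectral_support (grouped a) (grouped b)).
Local Notation phi := (moebius m k).

Let spectral_conj_at nu : m%:C * nu + k%:C != 0 -> (forall i, nu != (node i)%:C) ->
  ~~ root (pair_den spectral_support (grouped a) (grouped b)) nu ->
  ratfun_eval d (phi (Some nu)) = phi (G (Some nu)).
Proof.
move=> x0 off den_nu; have S_off t : t \in spectral_support -> nu != t%:C.
  by rewrite mem_undup => /mapP[i _ ->].
set f := cstieltjes spectral_support (grouped a) nu.
set h := cstieltjes spectral_support (grouped b) nu.
have fh : f - h != 0.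
  move: den_nu; rewrite rootE (horner_pair_den spectral_pair)//.
  by rewrite mulf_eq0 negb_or => /andP[].
have fh0 : (f, h) != (0, 0).
  by apply: contraNneq fh => -[-> ->]; rewrite subr0.
have scale0 := spectral_scale_neq0 x0 off; set C := spectral_scale _ in scale0.
have num_at : (spectral_poly (fun i => a i - b i)).[(m%:C * nu + k%:C)^-1] =
    C * (f - h).
  rewrite horner_spectral_poly// /f /h !cstieltjes_grouped// -sumrB.
  by congr (_ * _); apply: eq_bigr => i _; rewrite rmorphB mulrBl.
have den_at : den.[(m%:C * nu + k%:C)^-1] = C * (f + c%:C * h).
  rewrite horner_spectral_poly// /f /h !cstieltjes_grouped//.
  rewrite [c%:C * _]mulr_sumr -big_split.
  congr (_ * _); apply: eq_bigr => i _.
  by rewrite rmorphD rmorphM /= mulrDl mulrA.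
rewrite (pair_map_cstieltjes spectral_pair)// -/f -/h.
rewrite {1}/moebius /= (negbTE x0) (ratfun_eval_hcoord den_neq0 dE); last first.
  by rewrite num_at xpair_eqE negb_and mulf_neq0.
rewrite num_at den_at hcoordM// /moebius [in RHS]/hcoord (negbTE fh) /=.
have -> : m%:C * ((f + h) / (f - h)) + k%:C = (f + c%:C * h) / (f - h).
  have -> : c%:C = m%:C - k%:C by rewrite -rmorphB mBk.
  have -> : k%:C = 1 - m%:C.
    by rewrite -[1]/(1%:C) -rmorphB; congr _%:C; rewrite -mDk addrAC subrr add0r.
  by field.
rewrite -[LHS]sphere_inv_hcoord; last by rewrite xpair_eqE negb_and fh orbT.
by rewrite /hcoord (negbTE fh).
Qed.

Lemma spectral_conj z : ratfun_eval d (phi z) = phi (G z).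
Proof.
have [rs denE] := closed_field_poly_normal
  (pair_den spectral_support (grouped a) (grouped b)).
pose bad := - k%:C / m%:C :: [seq (node i)%:C | i <- enum I] ++ rs.
have cphi : continuous phi by exact: continuous_moebius.
apply: (@eq_continuous_cofinite _ (ratfun_eval d \o phi) (phi \o G) bad).
- by move=> w; apply: continuous_comp; [exact: cphi | exact: continuous_ratfun_eval].
- by move=> w; apply: continuous_comp; [exact: continuous_pair_map | exact: cphi].
move=> nu; rewrite inE mem_cat !negb_or => /and3P[nu0 nu_node nu_rs].
apply: spectral_conj_at.
- apply: contraNneq nu0 => x0; apply/eqP/(mulfI m_neq0).
  by rewrite mulrCA divff// mulr1; apply/eqP; rewrite -subr_eq0 opprK x0.
- by move=> i; apply: contraNneq nu_node => ->; apply: map_f; rewrite mem_enum.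
rewrite denE rootZ ?root_prod_XsubC// lead_coef_eq0.
exact: pair_den_neq0 spectral_pair.
Qed.

Theorem spectral_julia : real_interval (julia_set (ratfun_eval d)) \/
  cantor_set (julia_set (ratfun_eval d)).
Proof.
apply: (julia_pair_dichotomy spectral_pair _ m_gt0 _ spectral_conj).
  exact: continuous_ratfun_eval.
by rewrite ger0_norm ?mDk// divr_ge0// subr_ge0.
Qed.

End SpectralData.

(** * Random walk on a finite graph *)

Section MatrixOfFunction.
Context {K : fieldType} {T : finType}.
Implicit Types (F Q : T -> T -> K) (x y z : T).

Definition mxfun F : 'M[K]_#|T| := \matrix_(i, j) F (enum_val i) (enum_val j).

Lemma mxfunE F x y : mxfun F (enum_rank x) (enum_rank y) = F x y.
Proof. by rewrite mxE !enum_rankK. Qed.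

Lemma sum_enum_val (V : nmodType) (E : T -> V) :
  \sum_(i < #|T|) E (enum_val i) = \sum_x E x.
Proof. by rewrite -(big_enum_val (A := T)). Qed.

Lemma sum_pred1l (E : T -> K) x : \sum_y (x == y)%:R * E y = E x.
Proof.
rewrite (bigD1 x)//= eqxx mul1r big1 ?addr0// => y yx.
by rewrite eq_sym (negbTE yx) mul0r.
Qed.

Lemma sum_pred1r (E : T -> K) z : \sum_x E x * (x == z)%:R = E z.
Proof.
rewrite (bigD1 z)//= eqxx mulr1 big1 ?addr0// => x xz.
by rewrite (negbTE xz) mulr0.
Qed.

Lemma sum_pred1_in (B : {pred T}) z : \sum_(x in B) (x == z)%:R = (z \in B)%:R :> K.
Proof.
have [zB|zB] := boolP (z \in B).
  rewrite (bigD1 z)//= eqxx big1 ?addr0// => x /andP[_ xz].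
  by rewrite (negbTE xz).
by rewrite big1// => x xB; case: eqP => // xz; rewrite -xz xB in zB.
Qed.

Lemma mxfunM F F' : mxfun F *m mxfun F' = mxfun (fun x z => \sum_y F x y * F' y z).
Proof.
apply/matrixP => i j; rewrite !mxE -sum_enum_val.
by apply: eq_bigr => l _; rewrite !mxE.
Qed.

Lemma mxfun1 : mxfun (fun x y => (x == y)%:R) = 1%:M.
Proof. by apply/matrixP => i j; rewrite !mxE (inj_eq enum_val_inj). Qed.

Lemma mxfun_eq F F' : F =2 F' -> mxfun F = mxfun F'.
Proof. by move=> FF; apply/matrixP => i j; rewrite !mxE FF. Qed.

Lemma mxfun_resolvent Q (Z : K) :
  1%:M - Z *: mxfun Q = mxfun (fun x y => (x == y)%:R - Z * Q x y).
Proof. by rewrite -mxfun1; apply/matrixP => i j; rewrite !mxE. Qed.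

Lemma left_inverse_perm F G (f : T -> T) : injective f ->
  (forall x z, \sum_y G x y * F y z = (x == z)%:R) ->
  (forall x y, F (f x) (f y) = F x y) -> forall x y, G (f x) (f y) = G x y.
Proof.
move=> fi GF Ff x y.
have GF1 : mxfun G *m mxfun F = 1%:M.
  by rewrite mxfunM -mxfun1; apply: mxfun_eq.
have GfF1 : mxfun (fun x y => G (f x) (f y)) *m mxfun F = 1%:M.
  rewrite mxfunM -mxfun1; apply: mxfun_eq => a b.
  rewrite -(inj_eq fi) -GF [RHS](reindex_inj fi) /=.
  by apply: eq_bigr => t _; rewrite Ff.
have FG1 := mulmx1C GF1.
have : mxfun (fun x y => G (f x) (f y)) = mxfun G.
  by rewrite -[LHS]mulmx1 -FG1 mulmxA GfF1 mul1mx.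
by move=> /matrixP/(_ (enum_rank x) (enum_rank y)); rewrite !mxfunE.
Qed.

Lemma invmx_mxfun F (y : T -> K) v w : mxfun F \in unitmx ->
  (forall z, \sum_x y x * F x z = (v == z)%:R) ->
  invmx (mxfun F) (enum_rank v) (enum_rank w) = y w.
Proof.
move=> uF yF; pose yv : 'rV[K]_#|T| := \row_j y (enum_val j).
have yvF : yv *m mxfun F = delta_mx 0 (enum_rank v).
  apply/rowP => j; rewrite !mxE eqxx /=.
  under eq_bigr do rewrite !mxE.
  rewrite (sum_enum_val (fun x => y x * F x (enum_val j))) yF.
  by rewrite -(inj_eq enum_val_inj) enum_rankK eq_sym.
have -> : invmx (mxfun F) (enum_rank v) (enum_rank w) =
    (delta_mx 0 (enum_rank v) *m invmx (mxfun F)) (0 : 'I_1) (enum_rank w).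
  by rewrite -rowE mxE.
by rewrite -yvF mulmxK// mxE enum_rankK.
Qed.

Definition absorb (B : {pred T}) Q x y : K := if x \in B then 0 else Q x y.

(* g / sigma is the probability generating function of being absorbed at w. *)
Lemma absorbed_inverse Q (G : T -> T -> K) (Z : K) (B : {pred T}) v w (g sigma : K) :
  (forall x z, \sum_y G x y * ((y == z)%:R - Z * Q y z) = (x == z)%:R) ->
  v \notin B -> w \in B -> sigma != 0 ->
  (forall b, b \in B -> G v b = g) ->
  (forall b, b \in B -> \sum_(x in B) G x b = sigma) ->
  1%:M - Z *: mxfun (absorb B Q) \in unitmx ->
  invmx (1%:M - Z *: mxfun (absorb B Q)) (enum_rank v) (enum_rank w) = g / sigma.
Proof.
move=> GQ vB wB s0 Gv GB; set rho := g / sigma.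
pose killed x := G v x - rho * \sum_(b in B) G b x.
have killedB x : x \in B -> killed x = 0.
  by move=> xB; rewrite /killed Gv// GB// /rho divfK// subrr.
have killedQ z : \sum_x killed x * ((x == z)%:R - Z * Q x z) =
    (v == z)%:R - rho * (z \in B)%:R.
  rewrite /killed; under eq_bigr do rewrite mulrBl -mulrA.
  rewrite sumrB GQ -mulr_sumr -sum_pred1_in; congr (_ - _ * _).
  under eq_bigr do rewrite mulr_suml.
  by rewrite exchange_big; apply: eq_bigr => b _; rewrite GQ.
rewrite mxfun_resolvent => uN.
rewrite (invmx_mxfun (y := fun x => (x \in B)%:R * rho + killed x))//.
  by rewrite wB mul1r killedB// addr0.
move=> z; have termE x : ((x \in B)%:R * rho + killed x) *
      ((x == z)%:R - Z * absorb B Q x z) =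
    (x \in B)%:R * rho * (x == z)%:R + killed x * ((x == z)%:R - Z * Q x z).
  rewrite /absorb; case: ifP => xB; first by rewrite killedB//; ring.
  by rewrite !mul0r !add0r.
under eq_bigr do rewrite termE.
by rewrite big_split /= killedQ sum_pred1r; ring.
Qed.

End MatrixOfFunction.

Section FiniteGraph.
Context {R : realType} {T : finType}.
Variables (e : rel T) (bd : {set T}) (v w : T).
Local Notation C := R[i].

Definition vdegree (x : T) : nat := (\sum_(y | e x y) 1)%N.

Definition walk_kernel (K : fieldType) x y : K :=
  if e x y then (vdegree x)%:R^-1 else 0.

Hypothesis e_sym : symmetric e.
Hypothesis vdegree_gt0 : forall x, (0 < vdegree x)%N.
Hypothesis bd_indep : forall x y, x \in bd -> y \in bd -> ~~ e x y.
Hypothesis e_connected : forall x y, connect e x y.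
Hypothesis v_bd : v \in bd.
Hypothesis w_bd : w \in bd.
Hypothesis vw : v != w.
Hypothesis bd_homog : forall x1 x2 y1 y2, x1 \in bd -> x2 \in bd -> x1 != x2 ->
  y1 \in bd -> y2 \in bd -> y1 != y2 -> exists f : T -> T,
  [/\ injective f, forall x y, e (f x) (f y) = e x y, f x1 = y1 & f x2 = y2].

Hypothesis e_lower : forall phi : T -> C,
  0 <= \sum_x \sum_(y | e x y) phi x * (phi y)^* +
       ((#|bd|%:R - 1)^-1)%:C * \sum_x (vdegree x)%:R * (phi x * (phi x)^*).

Let theta : nat := #|bd|.
Let c : R := (theta%:R - 1)^-1.

Let theta_gt1 : (1 < theta)%N.
Proof. by rewrite /theta (cardD1 v) v_bd (cardD1 w) !inE w_bd eq_sym vw. Qed.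

Let thetaB1_gt0 : 0 < theta%:R - 1 :> R.
Proof. by rewrite subr_gt0 ltr1n. Qed.

Let c_gt0 : 0 < c. Proof. by rewrite invr_gt0. Qed.

Let c_le1 : c <= 1.
Proof. by rewrite invf_le1// lerBrDr -[1 + 1]/(2%:R) ler_nat. Qed.

Let root_deg x : R := Num.sqrt (vdegree x)%:R.

Let root_deg_gt0 x : 0 < root_deg x.
Proof. by rewrite sqrtr_gt0 ltr0n. Qed.

Let root_deg_neq0 x : (root_deg x)%:C != 0.
Proof. by rewrite fmorph_eq0 gt_eqF. Qed.

Let sqr_root_deg x : (root_deg x)%:C ^+ 2 = (vdegree x)%:R :> C.
Proof. by rewrite -rmorphXn /= sqr_sqrtr ?ler0n// rmorph_nat. Qed.

Let normalized_adj x y : C :=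
  if e x y then ((root_deg x * root_deg y)^-1)%:C else 0.

Let A : 'M[C]_#|T| := mxfun normalized_adj.

Let A_herm : A \is hermsymmx.
Proof.
apply: realsym_hermsym.
  apply/is_hermitianmxP; apply/matrixP => i j.
  rewrite !mxE expr0 mul1r /normalized_adj e_sym.
  by case: ifP => // _; rewrite mulrC.
apply/mxOverP => i j; rewrite mxE /normalized_adj; case: ifP => _; last exact: real0.
by apply/complex_realP; eexists.
Qed.

Definition eigen i : R := complex.Re (spectral_diag A 0 i).

Let evec i x : C := spectralmx A i (enum_rank x).

Let evec_eigen i z : \sum_x evec i x * normalized_adj x z = (eigen i)%:C * evec i z.
Proof.
have diagE : spectralmx A *m A = diag_mx (spectral_diag A) *m spectralmx A.
  have /orthomx_spectralP AE := hermitian_normalmx A_herm.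
  by rewrite {2}AE !mulmxA mulmxV ?mul1mx// spectral_unit.
have /matrixP/(_ i (enum_rank z)) := diagE; rewrite mul_diag_mx !mxE.
have /mxOverP/(_ 0 i)/RRe_real -> := hermitian_spectral_diag_real A_herm.
rewrite -/(eigen i) => <-.
rewrite -(sum_enum_val (fun x => evec i x * normalized_adj x z)).
by apply: eq_bigr => j _; rewrite /evec enum_valK !mxE enum_rankK.
Qed.

Let evec_complete x z : \sum_i (evec i x)^* * evec i z = (x == z)%:R.
Proof.
have := spectral_unitarymx A => /unitarymxP/mulmx1C/matrixP.
move=> /(_ (enum_rank x) (enum_rank z)); rewrite !mxE (inj_eq enum_rank_inj) => <-.
by apply: eq_bigr => i _; rewrite !mxE.
Qed.

Let evec_norm i : \sum_x evec i x * (evec i x)^* = 1.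
Proof.
have := spectral_unitarymx A => /unitarymxP/matrixP/(_ i i).
rewrite !mxE eqxx mulr1n => <-.
rewrite -sum_enum_val; apply: eq_bigr => j _.
by rewrite /evec enum_valK !mxE.
Qed.

(* The eigenfunctions of the random walk itself. *)
Let efun i x : C := evec i x / (root_deg x)%:C.

Let conj_efun i x : ((efun i x)^*)%R = (evec i x)^*%R / (root_deg x)%:C.
Proof.
rewrite /efun -fmorphV /=; case: (evec i x) => p q; apply/eqP; rewrite eq_complex /=.
by apply/andP; split; apply/eqP; ring.
Qed.

Let efun_energy i :
  \sum_x \sum_(y | e x y) efun i x * (efun i y)^* = (eigen i)%:C.
Proof.
under eq_bigr do under eq_bigr do rewrite conj_efun /efun.
rewrite -[RHS]mulr1 -(evec_norm i) mulr_sumr (exchange_big_dep xpredT) //.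
apply: eq_bigr => y _; rewrite mulrA -evec_eigen mulr_suml big_mkcond.
apply: eq_bigr => x _; rewrite /normalized_adj.
have [exy|/negbTE exy] := boolP (e x y); rewrite ?exy /=; last by rewrite mulr0 mul0r.
rewrite invfM rmorphM !fmorphV.
by move: (root_deg x)%:C^-1 (root_deg y)%:C^-1 (evec i x) (evec i y)^*%R => *; ring.
Qed.

Let efun_norm i : \sum_x (vdegree x)%:R * (efun i x * (efun i x)^*) = 1.
Proof.
rewrite -[RHS](evec_norm i); apply: eq_bigr => x _.
rewrite -sqr_root_deg conj_efun /efun.
move: (evec i x) (evec i x)^*%R (root_deg x)%:C (root_deg_neq0 x) => p q r r0.
by field.
Qed.

Let eigen_lower i : - c <= eigen i.
Proof.
have := e_lower (efun i); rewrite efun_energy efun_norm mulr1 -rmorphD /= ler0c.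
by rewrite -lerBlDr sub0r.
Qed.

Let swap_edges (F : T -> T -> C) :
  \sum_x \sum_(y | e x y) F y x = \sum_x \sum_(y | e x y) F x y.
Proof.
rewrite (exchange_big_dep xpredT) //=; apply: eq_bigr => x _; apply: eq_bigl => y.
by rewrite e_sym.
Qed.

Let efun_dirichlet i : \sum_x \sum_(y | e x y)
  (efun i x - efun i y) * (efun i x - efun i y)^* = (2 - 2 * eigen i)%:C.
Proof.
transitivity (\sum_x \sum_(y | e x y) (efun i x * (efun i x)^* +
    efun i y * (efun i y)^* - efun i x * (efun i y)^* - efun i y * (efun i x)^*)).
  apply: eq_bigr => x _; apply: eq_bigr => y _; rewrite rmorphB /=.
  by move: (efun i x) (efun i y) (efun i x)^*%R (efun i y)^*%R => *; ring.
have diag : \sum_x \sum_(y | e x y) efun i x * (efun i x)^* = 1.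
  rewrite -[RHS](efun_norm i); apply: eq_bigr => x _.
  rewrite /vdegree natr_sum mulr_suml; apply: eq_bigr => y _.
  by rewrite mul1r.
under eq_bigr do rewrite !sumrB big_split /=.
rewrite !sumrB big_split /= (swap_edges (fun x y => efun i x * (efun i x)^*)).
rewrite (swap_edges (fun x y => efun i x * (efun i y)^*)) diag efun_energy.
by rewrite rmorphB rmorphM /= !rmorph_nat; ring.
Qed.

Let eigen_le1 i : eigen i <= 1.
Proof.
have : 0 <= (2 - 2 * eigen i)%:C.
  rewrite -efun_dirichlet; apply: sumr_ge0 => x _; apply: sumr_ge0 => y _.
  exact: mul_conjC_ge0.
by rewrite ler0c; lra.
Qed.

Let eigen1_const i : eigen i = 1 -> forall x y, efun i x = efun i y.
Proof.
move=> eigen1.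
have edge x y : e x y -> efun i x = efun i y.
  move=> exy.
  have dirichlet0 :
      \sum_x \sum_(y | e x y) (efun i x - efun i y) * (efun i x - efun i y)^* = 0.
    by rewrite efun_dirichlet eigen1 mulr1 subrr.
  have row0 := psumr_eq0P
    (fun x' _ => sumr_ge0 _ (fun y' _ => mul_conjC_ge0 _)) dirichlet0.
  have /eqP := psumr_eq0P (fun y' _ => mul_conjC_ge0 _) (row0 x isT) exy.
  by rewrite mulf_eq0 conjC_eq0 orbb subr_eq0 => /eqP.
move=> x y; have /connectP[p pp ->] := e_connected x y.
elim: p x pp => //= z p IH x /andP[xz zp]; rewrite (edge _ _ xz); exact: IH.
Qed.

Let vdegree_perm (f : T -> T) x : injective f ->
  (forall x y, e (f x) (f y) = e x y) -> vdegree (f x) = vdegree x.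
Proof.
move=> fi fe; rewrite /vdegree [LHS](reindex_inj fi) /=.
by apply: eq_bigl => y; rewrite fe.
Qed.

Let root_deg_bd x y : x \in bd -> y \in bd -> root_deg x = root_deg y.
Proof.
move=> xb yb; have [->//|xy] := eqVneq x y.
have yx : y != x by rewrite eq_sym.
have [f [fi fe <- _]] := bd_homog xb yb xy yb xb yx.
by rewrite /root_deg vdegree_perm.
Qed.

Let evec_eigen1 i : eigen i = 1 -> evec i v = evec i w.
Proof.
move=> eigen1; have := eigen1_const eigen1 v w.
rewrite /efun (root_deg_bd v_bd w_bd).
by move/(mulIf (invr_neq0 (root_deg_neq0 w))).
Qed.

(* The spectral measures of the indicator of bd and of v - w, normalised. *)
Let bd_weight i : R := cabs (\sum_(x in bd) evec i x) ^+ 2 / theta%:R.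
Let diff_weight i : R := cabs (evec i v - evec i w) ^+ 2 / 2.

Let bd_weightE i : (bd_weight i)%:C =
  theta%:R^-1 * \sum_(x in bd) \sum_(y in bd) (evec i x)^* * evec i y.
Proof.
have -> : (bd_weight i)%:C =
    theta%:R^-1 * (cabs (\sum_(x in bd) evec i x) ^+ 2)%:C.
  by rewrite /bd_weight rmorphM fmorphV rmorph_nat mulrC.
rewrite -mul_conjC_cabs; congr (_ * _).
rewrite mulrC rmorph_sum mulr_suml; apply: eq_bigr => x _.
by rewrite mulr_sumr.
Qed.

Let diff_weightE i : (diff_weight i)%:C =
  2^-1 * ((evec i v)^* * evec i v + (evec i w)^* * evec i w -
  (evec i v)^* * evec i w - (evec i w)^* * evec i v)%R.
Proof.
have -> : (diff_weight i)%:C = 2^-1 * (cabs (evec i v - evec i w) ^+ 2)%:C.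
  by rewrite /diff_weight rmorphM fmorphV rmorph_nat mulrC.
rewrite -mul_conjC_cabs; congr (_ * _).
rewrite rmorphB /=.
by move: (evec i v) (evec i w) (evec i v)^*%R (evec i w)^*%R => *; ring.
Qed.

(* The kernel of the function of A with value [g i] on the i-th eigenvector. *)
Let spectral_kernel (K : fieldType) (io : {rmorphism C -> K}) (g : 'I_#|T| -> K)
    x y : K := \sum_i io ((evec i x)^* * evec i y) * g i.

Let sum_bd_weight (K : fieldType) (io : {rmorphism C -> K}) (g : 'I_#|T| -> K) :
  \sum_i io (bd_weight i)%:C * g i =
  theta%:R^-1 * \sum_(x in bd) \sum_(y in bd) spectral_kernel io g x y.
Proof.
under eq_bigr do rewrite bd_weightE rmorphM fmorphV rmorph_nat -mulrA.
rewrite -mulr_sumr; congr (_ * _).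
under eq_bigr do rewrite rmorph_sum mulr_suml.
rewrite exchange_big; apply: eq_bigr => x _.
under eq_bigr do rewrite rmorph_sum mulr_suml.
by rewrite exchange_big.
Qed.

Let sum_diff_weight (K : fieldType) (io : {rmorphism C -> K}) (g : 'I_#|T| -> K) :
  \sum_i io (diff_weight i)%:C * g i =
  2^-1 * (spectral_kernel io g v v + spectral_kernel io g w w -
          spectral_kernel io g v w - spectral_kernel io g w v).
Proof.
under eq_bigr do rewrite diff_weightE rmorphM fmorphV rmorph_nat -mulrA.
rewrite -mulr_sumr; congr (_ * _).
rewrite /spectral_kernel -big_split -!sumrB; apply: eq_bigr => i _.
by rewrite !rmorphB rmorphD !mulrBl mulrDl.
Qed.

Let idC : {rmorphism C -> C} := idfun.

Let spectral_kernel_eigen x z :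
  spectral_kernel idC (fun i => (eigen i)%:C) x z = normalized_adj x z.
Proof.
transitivity (\sum_i \sum_y ((evec i x)^* * evec i y) * normalized_adj y z).
  apply: eq_bigr => i _ /=; rewrite -mulrA [evec i z * _]mulrC -evec_eigen mulr_sumr.
  by apply: eq_bigr => y _; rewrite mulrA.
rewrite exchange_big -[RHS](sum_pred1l (fun y => normalized_adj y z)).
by apply: eq_bigr => y _; rewrite -mulr_suml evec_complete.
Qed.

Let spectral_kernel1 x z : spectral_kernel idC (fun=> 1) x z = (x == z)%:R.
Proof. by rewrite -evec_complete; apply: eq_bigr => i _; rewrite mulr1. Qed.

Let bd_weight_sum : \sum_i bd_weight i = 1.
Proof.
apply: (@complexI R); rewrite rmorph_sum rmorph1.
transitivity (\sum_i idC (bd_weight i)%:C * 1).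
  by apply: eq_bigr => i _; rewrite mulr1.
rewrite sum_bd_weight exchange_big; under eq_bigr => y yb.
  under eq_bigr do rewrite spectral_kernel1.
  rewrite sum_pred1_in yb.
  over.
by rewrite sumr_const mulVf// pnatr_eq0 -lt0n; exact: ltnW.
Qed.

Let diff_weight_sum : \sum_i diff_weight i = 1.
Proof.
apply: (@complexI R); rewrite rmorph_sum rmorph1.
transitivity (\sum_i idC (diff_weight i)%:C * 1).
  by apply: eq_bigr => i _; rewrite mulr1.
rewrite sum_diff_weight !spectral_kernel1 !eqxx (eq_sym w v) (negbTE vw) !subr0.
by rewrite mulVf// pnatr_eq0.
Qed.

Let normalized_adj_bd x y : x \in bd -> y \in bd -> normalized_adj x y = 0.
Proof. by move=> xb yb; rewrite /normalized_adj (negbTE (bd_indep xb yb)). Qed.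

Let bd_weight_mean : \sum_i bd_weight i * eigen i = 0.
Proof.
apply: (@complexI R); rewrite rmorph_sum rmorph0.
transitivity (\sum_i idC (bd_weight i)%:C * (eigen i)%:C).
  by apply: eq_bigr => i _; rewrite rmorphM.
rewrite sum_bd_weight big1 ?mulr0// => x xb; rewrite big1// => y yb.
by rewrite spectral_kernel_eigen normalized_adj_bd.
Qed.

Let diff_weight_mean : \sum_i diff_weight i * eigen i = 0.
Proof.
apply: (@complexI R); rewrite rmorph_sum rmorph0.
transitivity (\sum_i idC (diff_weight i)%:C * (eigen i)%:C).
  by apply: eq_bigr => i _; rewrite rmorphM.
rewrite sum_diff_weight !spectral_kernel_eigen !normalized_adj_bd//.
by rewrite !subr0 addr0 mulr0.
Qed.

Let bd_weight_ge0 i : 0 <= bd_weight i.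
Proof. by rewrite divr_ge0// sqr_ge0. Qed.

Let diff_weight_ge0 i : 0 <= diff_weight i.
Proof. by rewrite divr_ge0// sqr_ge0. Qed.

Let diff_weight_eigen1 i : eigen i = 1 -> diff_weight i = 0.
Proof. by move/evec_eigen1 => vwE; rewrite /diff_weight vwE subrr cabs0 expr0n mul0r. Qed.

Let root_deg_stationary i : (eigen i)%:C * (\sum_x evec i x * (root_deg x)%:C) =
  \sum_x evec i x * (root_deg x)%:C.
Proof.
rewrite mulr_sumr.
transitivity (\sum_z \sum_x evec i x * (normalized_adj x z * (root_deg z)%:C)).
  apply: eq_bigr => z _; rewrite mulrA -evec_eigen mulr_suml.
  by apply: eq_bigr => x _; rewrite mulrA.
rewrite exchange_big; apply: eq_bigr => x _; rewrite -mulr_sumr; congr (_ * _).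
transitivity (\sum_(z | e x z) (root_deg x)%:C^-1).
  rewrite [RHS]big_mkcond; apply: eq_bigr => z _; rewrite /normalized_adj.
  case: (e x z); last by rewrite mul0r.
  by rewrite -fmorphV -rmorphM invfM mulfVK// gt_eqF.
transitivity ((vdegree x)%:R * (root_deg x)%:C^-1).
  by rewrite /vdegree natr_sum mulr_suml; apply: eq_bigr => z _; rewrite mul1r.
by rewrite -sqr_root_deg expr2 mulfK.
Qed.

Let root_deg_expansion b : (root_deg b)%:C =
  \sum_i (evec i b)^* * \sum_x evec i x * (root_deg x)%:C.
Proof.
under eq_bigr do rewrite mulr_sumr.
rewrite exchange_big -[LHS](sum_pred1l (fun x => (root_deg x)%:C)).
apply: eq_bigr => x _; under eq_bigr do rewrite mulrA.
by rewrite -mulr_suml evec_complete.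
Qed.

(* The vector of square roots of the degrees is fixed by A, so only the
   eigenvectors of eigenvalue 1 contribute to its expansion. *)
Let bd_weight_eigen1 : exists2 i, eigen i = 1 & 0 < bd_weight i.
Proof.
apply: contrapT => none.
have bd_sum0 i : eigen i = 1 -> \sum_(x in bd) evec i x = 0.
  move=> eigen1; have : ~~ (0 < bd_weight i) by apply/negP => ?; apply: none; exists i.
  rewrite lt_def bd_weight_ge0 andbT negbK mulf_eq0 invr_eq0 pnatr_eq0.
  by rewrite -leqn0 leqNgt (ltnW theta_gt1) orbF sqrf_eq0 cabs_eq0 => /eqP.
have : \sum_(b in bd) (root_deg b)%:C = 0 :> C.
  under eq_bigr do rewrite root_deg_expansion.
  rewrite exchange_big big1// => i _; rewrite -mulr_suml -rmorph_sum.
  have [eigen1|eigen1] := eqVneq (eigen i) 1; first by rewrite bd_sum0// rmorph0 mul0r.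
  have eigenB1 : (eigen i)%:C - 1 != 0.
    by rewrite -[1]/(1%:C) -rmorphB fmorph_eq0 subr_eq0.
  have /eqP := root_deg_stationary i; rewrite -subr_eq0 -[X in _ - X]mul1r -mulrBl.
  by rewrite mulf_eq0 (negbTE eigenB1) => /eqP ->; rewrite mulr0.
rewrite -rmorph_sum => /eqP; rewrite fmorph_eq0 psumr_eq0; last by move=> x _; exact: ltW.
by move/allP/(_ v); rewrite mem_index_enum v_bd gt_eqF// => /(_ isT).
Qed.

Section Resolvent.
Variables (K : fieldType) (emb : {rmorphism {poly C} -> K}).
Hypothesis emb_eq0 : forall p, (emb p == 0) = (p == 0).
Let embC : {rmorphism C -> K} := (emb \o polyC)%FUN.
Let Z : K := emb 'X.
Let factor i : K := 1 - embC (eigen i)%:C * Z.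

Let natr_neq0 n : (0 < n)%N -> n%:R != 0 :> K.
Proof. by move=> n0; rewrite -(rmorph_nat embC) fmorph_eq0 pnatr_eq0 -lt0n. Qed.

Let theta_neq0 : theta%:R != 0 :> K.
Proof. by rewrite natr_neq0// ltnW. Qed.

Let thetaB1_neq0 : theta%:R - 1 != 0 :> K.
Proof. by rewrite -[1]/(1%:R) -natrB 1?ltnW// natr_neq0// subn_gt0. Qed.

Let emb_factor i : emb (1 - (eigen i)%:C *: 'X) = factor i.
Proof. by rewrite rmorphB rmorph1 -mul_polyC rmorphM. Qed.

Let factor_neq0 i : factor i != 0.
Proof.
rewrite -emb_factor emb_eq0; apply/eqP => /(congr1 (horner^~ 0))/eqP.
by rewrite hornerD hornerN hornerZ hornerX mulr0 subr0 hornerC horner0 oner_eq0.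
Qed.

Let prod_factor_neq0 : \prod_i factor i != 0.
Proof. by apply/prodf_neq0 => i _; exact: factor_neq0. Qed.

(* The entries of (1 - Z A)^-1. *)
Let sym_resolvent x y := spectral_kernel embC (fun i => (factor i)^-1) x y.

Let evec_factor i z :
  \sum_y embC (evec i y) * ((y == z)%:R - Z * embC (normalized_adj y z)) =
  factor i * embC (evec i z).
Proof.
under eq_bigr do rewrite mulrBr mulrCA -rmorphM.
rewrite sumrB sum_pred1r -mulr_sumr -rmorph_sum evec_eigen rmorphM /factor.
by move: (embC _) (embC _) => p q; ring.
Qed.

Let sym_resolventK x z :
  \sum_y sym_resolvent x y * ((y == z)%:R - Z * embC (normalized_adj y z)) =
  (x == z)%:R.
Proof.
under eq_bigr do rewrite mulr_suml.
rewrite exchange_big -(rmorph_nat embC) -evec_complete rmorph_sum.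
apply: eq_bigr => i _.
transitivity (embC (evec i x)^*%R / factor i * \sum_y embC (evec i y) *
    ((y == z)%:R - Z * embC (normalized_adj y z))).
  rewrite mulr_sumr; apply: eq_bigr => y _; rewrite rmorphM !mulrA.
  by congr (_ * _); rewrite mulrAC.
by rewrite evec_factor mulrA mulfVK// -rmorphM.
Qed.

Let root_deg_ratio x y : K := embC ((root_deg x)%:C / (root_deg y)%:C).

Let root_deg_ratio_id x : root_deg_ratio x x = 1.
Proof. by rewrite /root_deg_ratio divff// rmorph1. Qed.

Let embC_normalized_adj y z :
  embC (normalized_adj y z) = root_deg_ratio y z * walk_kernel K y z.
Proof.
rewrite /normalized_adj /walk_kernel; case: (e y z); last by rewrite rmorph0 mulr0.
rewrite -(rmorph_nat embC) -fmorphV -(rmorphM embC); congr (embC _).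
rewrite -sqr_root_deg fmorphV rmorphM /=; move: (root_deg_neq0 y) (root_deg_neq0 z).
by move: (root_deg y)%:C (root_deg z)%:C => p q p0 q0; field; rewrite p0 q0.
Qed.

(* The Green function of the walk, conjugate to the symmetric resolvent. *)
Let green x y := root_deg_ratio y x * sym_resolvent x y.

Let greenK x z : \sum_y green x y * ((y == z)%:R - Z * walk_kernel K y z) = (x == z)%:R.
Proof.
transitivity (\sum_y root_deg_ratio z x *
    (sym_resolvent x y * ((y == z)%:R - Z * embC (normalized_adj y z)))).
  apply: eq_bigr => y _; rewrite embC_normalized_adj /green.
  have -> : root_deg_ratio y x = root_deg_ratio z x * root_deg_ratio y z.
    rewrite /root_deg_ratio -rmorphM; congr (embC _).
    move: (root_deg_neq0 x) (root_deg_neq0 y) (root_deg_neq0 z).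
    move: (root_deg x)%:C (root_deg y)%:C (root_deg z)%:C => p q r p0 q0 r0.
    by field; rewrite p0 r0.
  have [->|yz] := eqVneq y z; first by rewrite root_deg_ratio_id mulr1 mul1r mulrA.
  move: (root_deg_ratio z x) (root_deg_ratio y z) (sym_resolvent x y) => p q r.
  by rewrite !sub0r; ring.
rewrite -mulr_sumr sym_resolventK; have [->|_] := eqVneq x z; last by rewrite mulr0.
by rewrite root_deg_ratio_id mul1r.
Qed.

Let green_bd x y : x \in bd -> y \in bd -> sym_resolvent x y = green x y.
Proof.
by move=> xb yb; rewrite /green /root_deg_ratio (root_deg_bd xb yb) divff// rmorph1 mul1r.
Qed.

Let green_perm (f : T -> T) x y : injective f ->
  (forall x y, e (f x) (f y) = e x y) -> green (f x) (f y) = green x y.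
Proof.
move=> fi fe; apply: (left_inverse_perm fi greenK) => x' y'.
by rewrite (inj_eq fi) /walk_kernel fe vdegree_perm.
Qed.

Let green_bdE x y : x \in bd -> y \in bd ->
  green x y = green v w + (x == y)%:R * (green v v - green v w).
Proof.
move=> xb yb; have [<-|xy] := eqVneq x y; last first.
  have [f [fi fe <- <-]] := bd_homog v_bd w_bd vw xb yb xy.
  by rewrite green_perm// mul0r addr0.
rewrite mul1r addrC subrK; have [->//|xv] := eqVneq x v.
have vx : v != x by rewrite eq_sym.
have [f [fi fe <- _]] := bd_homog v_bd xb vx xb v_bd xv.
by rewrite green_perm.
Qed.

Let sum_green_bd y : y \in bd ->
  \sum_(x in bd) green x y = green v v + (theta%:R - 1) * green v w.
Proof.
move=> yb; under eq_bigr => x xb do rewrite green_bdE//.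
move: (green v v) (green v w) => p q.
rewrite big_split -mulr_suml sum_pred1_in yb mul1r sumr_const -/theta /=.
by rewrite -[q *+ _]mulr_natl; ring.
Qed.

Let sum_bd_weight_factor : \sum_i embC (bd_weight i)%:C / factor i =
  green v v + (theta%:R - 1) * green v w.
Proof.
rewrite (sum_bd_weight embC (fun i => (factor i)^-1)) exchange_big /=.
under eq_bigr => y yb.
  under eq_bigr => x xb do rewrite [spectral_kernel _ _ _ _]green_bd//.
  rewrite sum_green_bd//.
  over.
move: (green v v + _) => s.
by rewrite sumr_const -/theta -[s *+ _]mulr_natl mulrA mulVf// mul1r.
Qed.

Let sum_diff_weight_factor : \sum_i embC (diff_weight i)%:C / factor i =
  green v v - green v w.
Proof.
rewrite (sum_diff_weight embC (fun i => (factor i)^-1)).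
rewrite -![spectral_kernel _ _ _ _]/(sym_resolvent _ _) !green_bd//.
rewrite (green_bdE w_bd w_bd) (green_bdE w_bd v_bd) eqxx eq_sym (negbTE vw).
have n2 : 2 != 0 :> K by exact: natr_neq0.
by move: (green v v) (green v w) => p q; rewrite mul1r mul0r; field.
Qed.

Let emb_spectral_poly (u : 'I_#|T| -> R) : emb (spectral_poly eigen u) =
  (\prod_i factor i) * \sum_i embC (u i)%:C / factor i.
Proof.
rewrite /spectral_poly rmorph_sum mulr_sumr; apply: eq_bigr => i _.
rewrite -mul_polyC rmorphM rmorph_prod [in RHS](bigD1 i)//=.
under eq_bigr do rewrite emb_factor.
move: (\prod_(_ | _) _) (factor_neq0 i) => p; move: (factor i) => r r0.
by rewrite -/(embC _) [r * p]mulrC mulrACA mulfV// mulr1 mulrC.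
Qed.

Let spectral_numE : emb (spectral_poly eigen (fun i => bd_weight i - diff_weight i)) =
  (\prod_i factor i) * (theta%:R * green v w).
Proof.
rewrite emb_spectral_poly; congr (_ * _).
under eq_bigr do rewrite !rmorphB mulrBl.
rewrite sumrB sum_bd_weight_factor sum_diff_weight_factor.
by move: (green v v) (green v w) => p q; ring.
Qed.

Let spectral_den := spectral_poly eigen (fun i => bd_weight i + c * diff_weight i).

Let spectral_denE : emb spectral_den = (\prod_i factor i) *
  (theta%:R / (theta%:R - 1) * (green v v + (theta%:R - 2) * green v w)).
Proof.
rewrite emb_spectral_poly; congr (_ * _).
have embCD (x y z : R) (r : K) : embC (x + y * z)%:C * r =
    embC x%:C * r + embC y%:C * (embC z%:C * r).
  by rewrite !rmorphD !rmorphM mulrDl mulrA.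
under eq_bigr do rewrite embCD.
have embC_c : embC c%:C = (theta%:R - 1)^-1.
  by rewrite /c !fmorphV !rmorphB !rmorph_nat !rmorph1.
rewrite big_split -mulr_sumr sum_bd_weight_factor sum_diff_weight_factor embC_c /=.
by move: (green v v) (green v w) => p q; field.
Qed.

Let spectral_den_neq0 : spectral_den != 0.
Proof.
apply/eqP => /(congr1 (horner^~ 0)); rewrite /= spectral_poly_at0 horner0.
rewrite big_split -mulr_sumr bd_weight_sum diff_weight_sum mulr1 /= => /complexI c1.
by move: c_gt0; lra.
Qed.

Let sum_green_interior_neq0 : green v v + (theta%:R - 2) * green v w != 0.
Proof.
have := spectral_den_neq0; apply: contraNneq => s0.
by rewrite -emb_eq0 spectral_denE s0 !mulr0.
Qed.

Let resolvent_unit n (M : 'M[C]_n) : 1%:M - Z *: map_mx embC M \in unitmx.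
Proof.
pose charM : 'M[{poly C}]_n := 1%:M - 'X *: map_mx polyC M.
have -> : 1%:M - Z *: map_mx embC M = map_mx emb charM.
  by apply/matrixP => i j; rewrite !mxE rmorphB rmorphM rmorph_nat.
rewrite unitmxE det_map_mx unitfE emb_eq0; apply/eqP => det0.
have : (\det charM).[0] = 1.
  rewrite -[LHS]/(horner_eval 0 (\det charM)) -det_map_mx -[RHS](det1 C n).
  congr (\det _); apply/matrixP => i j; rewrite !mxE /= /horner_eval.
  by rewrite hornerD hornerN hornerM hornerX mul0r oppr0 addr0 -polyC_natr hornerC.
by rewrite det0 horner0 => /esym/eqP; rewrite oner_eq0.
Qed.

Lemma resolvent_spectral : (#|bd|%:R - 1) *
    invmx (1%:M - emb 'X *: mxfun (absorb [pred x in bd | x != v] (walk_kernel K)))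
      (enum_rank v) (enum_rank w) =
  emb (spectral_poly eigen (fun i => bd_weight i - diff_weight i)) /
  emb (spectral_poly eigen (fun i => bd_weight i + c * diff_weight i)).
Proof.
rewrite spectral_numE spectral_denE.
rewrite (absorbed_inverse (Q := walk_kernel K) (g := green v w)
  (sigma := green v v + (theta%:R - 2) * green v w) greenK)//.
- rewrite -/theta; move: sum_green_interior_neq0 theta_neq0 thetaB1_neq0.
  move: (\prod_i _) (green v v) (green v w) prod_factor_neq0 => D p q D0 s0 t0 t1.
  by field; rewrite t1 s0 t0 D0.
- by rewrite !inE eqxx andbF.
- by rewrite !inE w_bd eq_sym vw.
- move=> b; rewrite !inE => /andP[bb bv].
  by rewrite green_bdE// eq_sym (negbTE bv) mul0r addr0.
- move=> b; rewrite !inE => /andP[bb bv].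
  have := sum_green_bd bb; rewrite (bigD1 v)//= (green_bdE v_bd bb) eq_sym (negbTE bv).
  rewrite mul0r addr0 => sumE.
  under eq_bigl do rewrite !inE.
  by apply: (addrI (green v w)); rewrite sumE; ring.
have -> : mxfun (absorb [pred x in bd | x != v] (walk_kernel K)) =
    map_mx embC (mxfun (absorb [pred x in bd | x != v] (walk_kernel C))).
  apply/matrixP => i j; rewrite !mxE /absorb /walk_kernel.
  by do 2![case: ifP => _; rewrite ?rmorph0//]; rewrite fmorphV rmorph_nat.
exact: resolvent_unit.
Qed.

End Resolvent.

Theorem finite_graph_julia (d : {fraction {poly C}}) :
  d = (#|bd|%:R - 1) * invmx (1%:M - tofrac 'X *: mxfun (absorb
        [pred x in bd | x != v] (walk_kernel _)))
      (enum_rank v) (enum_rank w) ->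
  real_interval (julia_set (ratfun_eval d)) \/ cantor_set (julia_set (ratfun_eval d)).
Proof.
move=> dE; apply: (@spectral_julia R _ eigen bd_weight diff_weight c) => //.
- by move=> i; rewrite eigen_lower eigen_le1.
- by rewrite bd_weight_mean diff_weight_mean.
rewrite dE; apply: (resolvent_spectral (emb := @tofrac {poly C})) => p.
exact: tofrac_eq0.
Qed.

End FiniteGraph.

(** * Lower spectral bound from a clique decomposition *)

Section CliqueDecomposition.
Context {R : realType} {T : finType}.
Variables (e : rel T) (cliques : {set {set T}}) (size_min : nat).
Local Notation C := R[i].
Implicit Types (B : {set T}) (x y : T).

Hypothesis size_min_gt1 : (1 < size_min)%N.
Hypothesis edgeP : forall x y,
  reflect (x != y /\ exists B, [/\ B \in cliques, x \in B & y \in B]) (e x y).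
Hypothesis clique_uniq : forall B B' x y, B \in cliques -> B' \in cliques ->
  x != y -> x \in B -> y \in B -> x \in B' -> y \in B' -> B = B'.
Hypothesis clique_card : forall B, B \in cliques -> (size_min <= #|B|)%N.

Let sum_edges (g : T -> T -> C) : \sum_x \sum_(y | e x y) g x y =
  \sum_(B in cliques) (\sum_(x in B) \sum_(y in B) g x y - \sum_(x in B) g x x).
Proof.
transitivity (\sum_(B in cliques) \sum_(x in B) \sum_(y in B | y != x) g x y); last first.
  apply: eq_bigr => B _; rewrite -sumrB; apply: eq_bigr => x xB.
  by rewrite [X in _ = X - _](bigD1 x)//= [RHS]addrC addKr.
rewrite [RHS](exchange_big_dep xpredT)//=; apply: eq_bigr => x _.
rewrite [RHS](exchange_big_dep xpredT)//= big_mkcond /=; apply: eq_bigr => y _.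
have [/edgeP[xy [B0 [B0s xB0 yB0]]]|nexy] := boolP (e x y); last first.
  rewrite big_pred0// => B; apply/negbTE; apply: contraNN nexy.
  case/andP => /andP[Bs xB] /andP[yB yx]; apply/edgeP; split; first by rewrite eq_sym.
  by exists B.
rewrite (bigD1 B0)/=; last by rewrite B0s xB0 yB0 eq_sym.
rewrite big_pred0 ?addr0// => B; apply/negbTE/negP.
case/andP => /andP[/andP[Bs xB] /andP[yB yx]] /eqP; apply.
exact: (clique_uniq Bs B0s xy).
Qed.

Lemma clique_lower (phi : T -> C) :
  0 <= \sum_x \sum_(y | e x y) phi x * (phi y)^* +
    ((size_min%:R - 1)^-1)%:C * \sum_x (vdegree e x)%:R * (phi x * (phi x)^*).
Proof.
have -> : \sum_x (vdegree e x)%:R * (phi x * (phi x)^*) =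
    \sum_x \sum_(y | e x y) phi x * (phi x)^*.
  apply: eq_bigr => x _; rewrite /vdegree natr_sum mulr_suml; apply: eq_bigr => y _.
  by rewrite mul1r.
rewrite (sum_edges (fun x y => phi x * (phi y)^*%R)).
rewrite (sum_edges (fun x y => phi x * (phi x)^*%R)).
rewrite mulr_sumr -big_split; apply: sumr_ge0 => B /clique_card size_B /=.
set total := \sum_(x in B) phi x; set energy := \sum_(x in B) phi x * (phi x)^*.
have -> : \sum_(x in B) \sum_(y in B) phi x * (phi y)^* = total * total^*%R.
  by rewrite mulr_suml; apply: eq_bigr => x _; rewrite rmorph_sum mulr_sumr.
have -> : \sum_(x in B) \sum_(y in B) phi x * (phi x)^* = #|B|%:R * energy.
  by rewrite mulr_sumr; apply: eq_bigr => x _; rewrite sumr_const mulr_natl.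
set k := _%:C.
have -> : total * total^*%R - energy + k * (#|B|%:R * energy - energy) =
    total * total^*%R + (k * (#|B|%:R - 1) - 1) * energy.
  by move: (total * _) => z; ring.
apply: addr_ge0; first exact: mul_conjC_ge0.
apply: mulr_ge0; last by apply: sumr_ge0 => x _; exact: mul_conjC_ge0.
have -> : k * (#|B|%:R - 1) - 1 = ((size_min%:R - 1)^-1 * (#|B|%:R - 1) - 1)%:C.
  by rewrite rmorphB rmorphM rmorphB rmorph_nat !rmorph1.
have size_minB1 : 0 < size_min%:R - 1 :> R by rewrite subr_gt0 ltr1n.
by rewrite ler0c subr_ge0 mulrC ler_pdivlMr// mul1r lerD2r ler_nat.
Qed.

End CliqueDecomposition.

(** * Cells of a self-similar graph *)

Section Cells.
Context {V : choiceType}.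
Variables (adj : rel V) (F : set V).
Implicit Types (C : set V) (x y z : V).
Hypothesis adj_sym : symmetric adj.

Lemma connected_off_sym x y : connected_off adj F x y -> connected_off adj F y x.
Proof.
case=> p []; elim: p x => [|z p IH] x /=.
  by move=> _ <- xF; exists [::].
case/andP=> xz zp pl /andP[xF zpF].
have [q [yq ql qF]] := IH z zp pl zpF.
exists (rcons q x); rewrite rcons_path yq ql adj_sym xz last_rcons; split=> //.
by rewrite -rcons_cons all_rcons xF.
Qed.

Lemma connected_off_trans x y z : connected_off adj F x y ->
  connected_off adj F y z -> connected_off adj F x z.
Proof.
case=> p [xp <- pF] [q [yq ql /= /andP[_ qF]]].
by exists (p ++ q); rewrite cat_path xp yq last_cat ql -cat_cons all_cat pF qF.
Qed.

Lemma cellE C x : cells adj F C -> C x -> C = [set y | connected_off adj F x y].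
Proof.
case=> x0 x0F -> /= x0x; apply/seteqP; split => y /= h.
  by apply: connected_off_trans h; exact: connected_off_sym.
exact: connected_off_trans h.
Qed.

Lemma cell_notin C x : cells adj F C -> C x -> ~ F x.
Proof.
case=> x0 x0F -> /= [p [_ <- /allP pF]].
by have := pF _ (mem_last x0 p); rewrite notin_setE.
Qed.

Lemma cell_adj C x y : cells adj F C -> C x -> adj x y -> ~ F y -> C y.
Proof.
move=> cC Cx xy yF; rewrite (cellE cC Cx) /=; exists [:: y]; split=> //=.
  by rewrite xy.
apply/and3P; split=> //; rewrite notin_setE//.
exact: (cell_notin cC Cx).
Qed.

Lemma vboundary_cell_sub C : cells adj F C -> vboundary adj C `<=` F.
Proof.
move=> cC y [Cy [x Cx xy]]; apply: contrapT => yF; apply: Cy.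
exact: cell_adj xy yF.
Qed.

Lemma cell_adj_vclosure C x y : cells adj F C -> C x -> adj x y -> vclosure adj C y.
Proof.
move=> cC Cx xy; have [yF|yF] := pselect (F y); last by left; exact: cell_adj xy yF.
by right; split; [move=> Cy; exact: (cell_notin cC Cy) | exists x].
Qed.

Lemma vclosure_cell_notin C x : cells adj F C -> vclosure adj C x -> ~ F x -> C x.
Proof. by move=> cC [//|bx] xF; case: xF; exact: vboundary_cell_sub bx. Qed.

Lemma vclosure_finite C : (forall x, finite_set [set y | adj x y]) ->
  finite_set C -> finite_set (vclosure adj C).
Proof.
move=> adj_fin fC; rewrite /vclosure finite_setU; split=> //.
apply: (@sub_finite_set _ _ (\bigcup_(x in C) [set y | adj x y])).
  by move=> y [_ [x Cx xy]]; exists x.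
by apply: bigcup_finite => // x _; exact: adj_fin.
Qed.

End Cells.

Section CellGraph.
Context {R : realType} {V : choiceType}.
Variables (adj : rel V) (F : set V) (C : set V).
Hypothesis X_graph : infinite_graph adj.
Hypothesis F_self_similar : symmetrically_self_similar adj F.
Hypothesis C_cell : cells adj F C.
Variables (v w : cell_vertices adj C).
Hypothesis v_boundary : vboundary adj C (val v).
Hypothesis w_boundary : vboundary adj C (val w).
Hypothesis v_neq_w : v != w.

Local Notation T := (cell_vertices adj C).

Let adj_sym : symmetric adj. Proof. by case: X_graph. Qed.
Let adj_irr : irreflexive adj. Proof. by case: X_graph. Qed.

Let F_indep x y : F x -> F y -> ~~ adj x y.
Proof. by case: F_self_similar => -[indep _ _] _ _ _; exact: indep. Qed.

Let closure_fin : finite_set (vclosure adj C).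
Proof.
apply: vclosure_finite; first by case: X_graph.
by case: F_self_similar => _ fin _ _; exact: fin.
Qed.

Let in_cell_vertices x : (x \in cell_vertices adj C) = (x \in vclosure adj C).
Proof. exact: in_fset_set. Qed.

Let vertex_closure (x : T) : vclosure adj C (val x).
Proof. by have := valP x; rewrite in_cell_vertices inE. Qed.

Let closure_vertex x : vclosure adj C x -> exists t : T, val t = x.
Proof.
move=> cx; have xT : x \in cell_vertices adj C by rewrite in_cell_vertices inE.
by exists [` xT]%fset.
Qed.

Let e : rel T := fun x y => adj (val x) (val y).
Let bd : {set T} := [set x : T | val x \in vboundary adj C]%SET.

Let bdP x : reflect (vboundary adj C (val x)) (x \in bd).
Proof. by rewrite finset.inE; apply: (iffP idP); rewrite inE. Qed.

Let card_vertices (P : pred V) :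
  #|` [fset y in cell_vertices adj C | P y]%fset| = (\sum_(y : T | P (val y)) 1)%N.
Proof. by rewrite card_fset_sum1 -big_fset_condE big_seq_fsetE. Qed.

Let cell_degreeE x : cell_degree adj C (val x) = vdegree e x.
Proof. exact: card_vertices. Qed.

Let card_bd : #|` fset_set (vboundary adj C)| = #|bd|.
Proof.
have -> : fset_set (vboundary adj C) =
    [fset y in cell_vertices adj C | y \in vboundary adj C]%fset.
  apply/fsetP => y; rewrite in_fset_set; last first.
    by apply: (sub_finite_set _ closure_fin) => z zb; right.
  rewrite !inE /=; apply/idP/andP => [yb|[_ //]]; split => //.
  by rewrite in_cell_vertices inE; right; rewrite inE in yb.
by rewrite card_vertices -sum1_card; apply: eq_bigl => x; rewrite finset.inE.
Qed.

Let e_sym : symmetric e.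
Proof. by move=> x y; exact: adj_sym. Qed.

Let bd_indep x y : x \in bd -> y \in bd -> ~~ e x y.
Proof.
by move=> /bdP xb /bdP yb; apply: F_indep; exact: (vboundary_cell_sub adj_sym C_cell).
Qed.

Let connect_path p : forall x y : T, C (val x) -> path adj (val x) p ->
  last (val x) p = val y -> all (fun z => z \notin F) (val x :: p) -> connect e x y.
Proof.
elim: p => [|z p IH] x y Cx /=.
  by move=> _ /val_inj -> _.
case/andP=> xz zp pl /and3P[xF zF pF].
have Cz : C z by apply: (cell_adj adj_sym C_cell Cx xz); move: zF; rewrite notin_setE.
have [t tz] := closure_vertex (or_introl Cz).
apply: (@connect_trans _ _ t); first by apply: connect1; rewrite /e tz.
by apply: IH; rewrite ?tz //= zF pF.
Qed.

Let connect_interior (x y : T) : C (val x) -> C (val y) -> connect e x y.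
Proof.
move=> Cx; rewrite [X in X (val y)](cellE adj_sym C_cell Cx) => -[p [xp pl pF]].
exact: connect_path xp pl pF.
Qed.

Let connect_to_interior (x : T) : exists2 t : T, C (val t) & connect e x t.
Proof.
have [Cx|[_ [y Cy yx]]] := vertex_closure x; first by exists x.
have [t tz] := closure_vertex (or_introl Cy).
by exists t; rewrite ?tz//; apply: connect1; rewrite /e tz adj_sym.
Qed.

Let e_connected x y : connect e x y.
Proof.
have [t Ct xt] := connect_to_interior x; have [s Cs ys] := connect_to_interior y.
apply: (connect_trans xt); apply: (connect_trans (connect_interior Ct Cs)).
by rewrite (sym_connect_sym e_sym).
Qed.

Let v_bd : v \in bd. Proof. exact/bdP. Qed.
Let w_bd : w \in bd. Proof. exact/bdP. Qed.

Let vdegree_gt0 x : (0 < vdegree e x)%N.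
Proof.
have [z xz] : exists z, x != z.
  by have [->|xv] := eqVneq x v; [exists w | exists v].
have /connectP[[|t p] /=] := e_connected x z.
  by move=> _ zx; rewrite zx eqxx in xz.
by case/andP => xt _ _; rewrite /vdegree (bigD1 t).
Qed.

Let bd_homog x1 x2 y1 y2 : x1 \in bd -> x2 \in bd -> x1 != x2 ->
  y1 \in bd -> y2 \in bd -> y1 != y2 -> exists f : T -> T,
  [/\ injective f, forall x y, e (f x) (f y) = e x y, f x1 = y1 & f x2 = y2].
Proof.
move=> /bdP x1b /bdP x2b /eqP x12 /bdP y1b /bdP y2b /eqP y12.
case: F_self_similar => _ _ _ homog.
have nx : val x1 <> val x2 by move/val_inj.
have ny : val y1 <> val y2 by move/val_inj.
have [f [[[ff fi _] fe _] f1 f2]] := homog C C_cell _ _ _ _ x1b x2b nx y1b y2b ny.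
pose g (x : T) : T := insubd x (f (val x)).
have gE x : val (g x) = f (val x).
  have xT : f (val x) \in cell_vertices adj C.
    by rewrite in_cell_vertices; apply/mem_set; exact: ff (vertex_closure x).
  by rewrite val_insubd xT.
exists g; split.
- move=> x y /(congr1 val); rewrite !gE => /fi fxy; apply: val_inj.
  by apply: fxy; rewrite inE; exact: vertex_closure.
- by move=> x y; rewrite /e !gE fe.
- by apply: val_inj; rewrite gE.
- by apply: val_inj; rewrite gE.
Qed.

Section ReducedTraces.
Variable f : V -> V.
Hypothesis f_bij : set_bij [set: V] F f.
Hypothesis f_adj : forall x y, adj x y <-> reduced_adj adj F (f x) (f y).

Let f_inj : injective f.
Proof. by case: f_bij => _ fi _ x y; apply: fi; rewrite inE. Qed.

Let f_neq (x y : T) : x != y -> f (val x) <> f (val y).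
Proof. by move/eqP => xy /f_inj/val_inj. Qed.

(* The cliques of the decomposition: the boundaries of cells, pulled back to
   the closure of C along the isomorphism f from X to its reduced graph. *)
Let trace (D : set V) : {set T} := [set u : T | f (val u) \in vboundary adj D]%SET.

Let traceP D u : reflect (vboundary adj D (f (val u))) (u \in trace D).
Proof. by rewrite finset.inE; apply: (iffP idP); rewrite inE. Qed.

Let traces : {set {set T}} :=
  [set B : {set T} | (1 < #|B|)%N && `[< exists2 D, cells adj F D & B = trace D >] ]%SET.

Let tracesP (B : {set T}) :
  reflect ((1 < #|B|)%N /\ exists2 D, cells adj F D & B = trace D) (B \in traces).
Proof.
rewrite finset.inE; apply: (iffP andP) => -[B1 B2]; split=> //.
  by move/asboolP: B2.
exact/asboolP.
Qed.

Let trace_edge D (x y : T) : cells adj F D -> x \in trace D -> y \in trace D ->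
  x != y -> e x y.
Proof.
by move=> cD /traceP xD /traceP yD /f_neq xy; apply/f_adj; split; last exists D.
Qed.

Let edge_traceP x y :
  reflect (x != y /\ exists B, [/\ B \in traces, x \in B & y \in B]) (e x y).
Proof.
apply: (iffP idP) => [exy|[xy [B [/tracesP[_ [D cD ->]] xB yB]]]]; last first.
  exact: trace_edge xB yB xy.
have xy : x != y by apply: contraTneq exy => ->; rewrite /e adj_irr.
split=> //; have /f_adj[_ [D [cD /traceP xB /traceP yB]]] := exy.
exists (trace D); split=> //; apply/tracesP; split; last by exists D.
by apply/card_gt1P; exists x, y.
Qed.

Let trace_uniq B B' x y : B \in traces -> B' \in traces -> x != y ->
  x \in B -> y \in B -> x \in B' -> y \in B' -> B = B'.
Proof.
move=> /tracesP[_ [D cD ->]] /tracesP[_ [D' cD' ->]] xy.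
move=> /traceP xD /traceP yD /traceP xD' /traceP yD'.
have [->//|DD'] := pselect (D = D').
case: F_self_similar => -[_ meet1 _] _ _ _.
by case: (f_neq xy); apply: (meet1 D D' cD cD' DD'); split; right.
Qed.

(* An edge of the closure of C has an endpoint outside F. *)
Let trace_interior D : cells adj F D -> (1 < #|trace D|)%N ->
  exists2 x : T, x \in trace D & C (val x).
Proof.
move=> cD /card_gt1P[x [y [xD yD xy]]]; have exy := trace_edge cD xD yD xy.
have [xF|xF] := pselect (F (val x)); last first.
  by exists x => //; exact: (vclosure_cell_notin adj_sym C_cell (vertex_closure x) xF).
exists y => //; apply: (vclosure_cell_notin adj_sym C_cell (vertex_closure y)) => yF.
by have := F_indep xF yF; rewrite -/(e x y) exy.
Qed.

Let trace_surj D z : cells adj F D -> (1 < #|trace D|)%N -> vboundary adj D z ->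
  exists2 u : T, u \in trace D & f (val u) = z.
Proof.
move=> cD D1 zD; have [x /traceP xD Cx] := trace_interior cD D1.
have [_ _ f_surj] := f_bij.
have [u _ fu] := f_surj _ (vboundary_cell_sub adj_sym cD zD).
have uC : vclosure adj C u.
  have [->|ux] := pselect (u = val x); first exact: vertex_closure.
  apply: (cell_adj_vclosure adj_sym C_cell Cx); apply/f_adj; rewrite fu; split.
    by rewrite -fu => /f_inj/esym.
  by exists D.
have [t tu] := closure_vertex uC.
by exists t; [apply/traceP|]; rewrite tu fu.
Qed.

Let trace_card B : B \in traces -> (#|bd| <= #|B|)%N.
Proof.
case/tracesP => B1 [D cD BE]; rewrite {}BE in B1 *.
case: F_self_similar => _ _ cell_isom _.
have [g [[_ g_inj _] _ g_bd]] := cell_isom C D C_cell cD.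
have /choice[h hP] (b : T) : exists u : T, b \in bd ->
    u \in trace D /\ f (val u) = g (val b).
  have [/bdP bb|] := boolP (b \in bd); last by exists b.
  have gbD : vboundary adj D (g (val b)) by rewrite -g_bd; exists (val b).
  by have [u uD fu] := trace_surj cD B1 gbD; exists u.
have h_inj : {in bd &, injective h}.
  move=> b b' /hP[_ hb] /hP[_ hb'] hbb'; apply/val_inj/g_inj.
  - by rewrite inE; exact: vertex_closure.
  - by rewrite inE; exact: vertex_closure.
  - by rewrite -hb -hb' hbb'.
rewrite -(card_in_imset h_inj); apply/subset_leq_card/fintype.subsetP => u.
by case/imsetP => b /hP[hD _] ->.
Qed.

Lemma reduced_lower (phi : T -> R[i]) :
  0 <= \sum_x \sum_(y | e x y) phi x * (phi y)^* +
       ((#|bd|%:R - 1)^-1)%:C * \sum_x (vdegree e x)%:R * (phi x * (phi x)^*).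
Proof.
apply: (clique_lower _ edge_traceP trace_uniq trace_card).
by apply/card_gt1P; exists v, w.
Qed.

End ReducedTraces.

Let cell_mxE (K : fieldType) : cell_mx K adj C (vboundary adj C `\ val v) =
  mxfun (absorb [pred x in bd | x != v] (walk_kernel e _)).
Proof.
apply/matrixP => i j; rewrite !mxE; move: (enum_val i) (enum_val j) => x y /=.
rewrite cell_degreeE -/(e x y) /absorb /walk_kernel.
have -> : (val x \notin vboundary adj C `\ val v) = (x \notin [pred x in bd | x != v]).
  congr (~~ _); rewrite [RHS]inE /=; apply/idP/andP.
    by rewrite inE => -[/= /bdP xb xv]; split; last by apply: contra_notN xv => /eqP ->.
  by rewrite inE => -[/= /bdP xb /eqP xv]; split=> // /val_inj.
by case: (x \in _); case: (e x y).
Qed.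

Lemma cell_julia : let J := julia_set (ratfun_eval (transition_function R[i] v w)) in
  real_interval J \/ cantor_set J.
Proof.
have [[_ _ [f [f_bij f_adj]]] _ _ _] := F_self_similar.
apply: (finite_graph_julia e_sym vdegree_gt0 bd_indep e_connected
  v_bd w_bd v_neq_w bd_homog (reduced_lower f_bij f_adj)).
by rewrite /transition_function card_bd /cell_resolvent cell_mxE.
Qed.

End CellGraph.

Theorem theorem9p1 (R : realType) (V : choiceType) (adj : rel V) (F : set V)
    (hX : infinite_graph adj)
    (hF : symmetrically_self_similar adj F)
    (hB : bounded_geometry adj F)
    (C : set V) (hC : cells adj F C)
    (v w : cell_vertices adj C)
    (hv : vboundary adj C (val v)) (hw : vboundary adj C (val w))
    (hvw : v <> w) :
  let d := transition_function R[i] v w in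
  let J := julia_set (ratfun_eval d) in
  real_interval J \/ cantor_set J.
Proof. by apply: (cell_julia hX hF hC hv hw); apply/eqP. Qed.
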